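(* Let $f:\mathbb{R}\times\mathbb{R}^n\times\mathbb{R}^r\to\mathbb{R}^n$ be continuous together with $f_x$, let $U\subset\mathbb{R}^r$ be nonempty, and let $x_1\in\mathbb{R}^n$. Let $(\widehat x(\cdot),\widehat\mu_t)$ on $[t_1,\widehat t_2]$ be an optimal process for the time-optimal problem (with target $x_2=\widehat x(\widehat t_2)$) of the convexified system $\dot x=\langle\mu_t,f(t,x,u)\rangle$, $\mu_t\in\mathfrak{M}_U$, $x(t_1)=x_1$. If $\Lambda(\widehat x(\cdot),\widehat\mu_t)=\emptyset$, then the infimum time for the original system $\dot x=f(t,x,u)$, $u(t)\in U$, $x(t_1)=x_1$ (the infimum of all $t_2$ for which there is an admissible trajectory on $[t_1,t_2]$ with $x(t_2)=x_2$) is strictly less than $\widehat t_2$, and there exists a minimizing sequence of admissible trajectories for the original system converging uniformly to $\widehat x(\cdot)$.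
   Context: An admissible trajectory of the original system on $[t_1,t_2]$ is an absolutely continuous $x$ for which there is $u\in L_\infty([t_1,t_2],\mathbb{R}^r)$, $u(t)\in U$ a.e., with $\dot x(t)=f(t,x(t),u(t))$ a.e., $x(t_1)=x_1$. A generalized control is a family $\{\mu_t\}_{t\in\mathbb{R}}$ of (Borel, regular) probability measures on $\mathbb{R}^r$ that is finite (there is a compact $K$ with $\operatorname{supp}\mu_t\subset K$ for a.e. $t$) and weakly measurable ($t\mapsto\langle\mu_t,g(t,u)\rangle=\int g(t,u)\,d\mu_t(u)$ is Lebesgue measurable for every continuous $g:\mathbb{R}\times\mathbb{R}^r\to\mathbb{R}^n$). $\mathfrak{M}_U$ is the set of generalized controls with $\operatorname{supp}\mu_t\subset U$ for a.e. $t$. An admissible pair of the convexified system on $[t_1,t_2]$ is $(x,\mu_t)$ with $\mu_t\in\mathfrak{M}_U$, $x$ absolutely continuous, $\dot x(t)=\langle\mu_t,f(t,x(t),u)\rangle$ a.e., $x(t_1)=x_1$. An admissible pair on $[t_1,\widehat t_2]$ reaching $x_2$ at $\widehat t_2$ is optimal for the convexified time-optimal problem if $\widehat t_2$ is minimal among all $t_2$ for which some admissible pair on $[t_1,t_2]$ has $x(t_2)=x_2$. A minimizing sequence is a sequence of admissible trajectories $x_N$ on $[t_1,t_{2N}]$ with $x_N(t_{2N})=x_2$ and $t_{2N}$ tending to the infimum time. Functions on different intervals are compared by extending them past their right endpoints by their terminal values. $H(t,x,\psi,u)=\langle\psi,f(t,x,u)\rangle$, $M(t,x,\psi)=\sup_{u\in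 U}H(t,x,\psi,u)$. $\Lambda(\widehat x(\cdot),\widehat\mu_t)$ is the set of all nonzero absolutely continuous $\psi:[t_1,\widehat t_2]\to(\mathbb{R}^n)^*$ with: (1) $\dot\psi(t)=-\psi(t)\langle\widehat\mu_t,f_x(t,\widehat x(t),u)\rangle$ a.e.; (2) $\langle\psi(t),\dot{\widehat x}(t)\rangle=M(t,\widehat x(t),\psi(t))$ a.e.; (3) $t\mapsto M(t,\widehat x(t),\psi(t))$ is continuous on $[t_1,\widehat t_2]$; (4) $M(\widehat t_2,\widehat x(\widehat t_2),\psi(\widehat t_2))\ge0$. *)

(* Defs.v *)
From HB Require Import structures.
From mathcomp Require Export all_boot all_order all_algebra.
From mathcomp Require Export all_classical all_reals all_analysis.

Set Implicit Arguments.
Unset Strict Implicit.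
Unset Printing Implicit Defensive.

Import Order.TTheory GRing.Theory Num.Theory.
Export numFieldNormedType.Exports.
Local Open Scope classical_set_scope.
Local Open Scope ring_scope.

(* Conventions.  States and controls are row vectors, covectors (elements of
   the dual of R^n) are column vectors, so that <psi, v> is v *m psi.
   Trajectories, controls and adjoint functions are total functions on R;
   only their values on the relevant interval [t1, t2] are constrained.  Time
   intervals are nondegenerate: t1 < t2. *)

(* R with the sigma-algebra of Lebesgue measurable sets (the completion of the
   Borel sigma-algebra), the domain of completed_lebesgue_measure. *)
Definition lebesgueR (R : realType) :=
  caratheodory_type (@wlength R idfun)^*%mu.

Definition borelV (R : realType) (k : nat) :=
  g_sigma_algebraType (@open 'rV[R]_k).

Definition lebesgue_measurable_fun (R : realType) (k : nat) (D : set R)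
    (h : R -> 'rV[R]_k) : Prop :=
  measurable_fun (D : set (lebesgueR R)) (h : lebesgueR R -> borelV R k).

Definition abs_continuous (R : realType) (V : normedModType R) (a b : R)
    (x : R -> V) : Prop :=
  forall e : R, 0 < e -> exists2 d : R, 0 < d &
    forall (m : nat) (l l' : 'I_m -> R),
      (forall i, a <= l i /\ l i <= l' i /\ l' i <= b) ->
      trivIset setT (fun i => [set` `]l i, l' i[]) ->
      \sum_(i < m) (l' i - l i) < d ->
      \sum_(i < m) `|x (l' i) - x (l i)| < e.

Section control_systems.
Context (R : realType) (n r : nat).
Notation leb := (@lebesgue_measure R).

Definition msupport (mu : probability (borelV R r) R) : set 'rV[R]_r :=
  [set u | forall O : set 'rV[R]_r, open O -> O u -> (0 < mu O)%E].

(* The entrywise integral <mu, g>.  On a nonintegrable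
   integrand Rintegral has a conventional value, but a continuous g is
   integrable for every mu of compact support. *)
Definition pairing (p q : nat) (mu : probability (borelV R r) R)
    (g : 'rV[R]_r -> 'M[R]_(p, q)) : 'M[R]_(p, q) :=
  \matrix_(i, j) Rintegral mu setT (fun u : borelV R r => g u i j).

(* Every Borel probability measure on R^r is regular, so regularity is not
   required separately. *)
Definition generalized_control (mu : R -> probability (borelV R r) R) : Prop :=
  (exists2 K : set 'rV[R]_r, compact K &
     {ae leb, forall t, msupport (mu t) `<=` K}) /\
  (forall g : R * 'rV[R]_r -> 'rV[R]_n, continuous g ->
     lebesgue_measurable_fun setT (fun t => pairing (mu t) (fun u => g (t, u)))).

Definition generalized_controls_in (U : set 'rV[R]_r) :
    set (R -> probability (borelV R r) R) :=
  [set mu | generalized_control mu /\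
            {ae leb, forall t, msupport (mu t) `<=` U}].

Implicit Types (f : R -> 'rV[R]_n -> 'rV[R]_r -> 'rV[R]_n)
  (U : set 'rV[R]_r) (x : R -> 'rV[R]_n)
  (mu : R -> probability (borelV R r) R) (psi : R -> 'cV[R]_n).

Definition admissible_control U (t1 t2 : R) (u : R -> 'rV[R]_r) : Prop :=
  [/\ lebesgue_measurable_fun [set` `[t1, t2]] u,
      exists C : R, {ae leb, forall t, t \in `[t1, t2] -> `|u t| <= C}
    & {ae leb, forall t, t \in `[t1, t2] -> U (u t)}].

Definition admissible_trajectory f U (x1 : 'rV[R]_n) (t1 t2 : R) x : Prop :=
  [/\ t1 < t2, abs_continuous t1 t2 x, x t1 = x1
    & exists2 u : R -> 'rV[R]_r, admissible_control U t1 t2 u &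
        {ae leb, forall t, t \in `[t1, t2] ->
           is_derive t (1 : R) x (f t (x t) (u t))}].

Definition admissible_pair f U (x1 : 'rV[R]_n) (t1 t2 : R) x mu : Prop :=
  [/\ t1 < t2, generalized_controls_in U mu, abs_continuous t1 t2 x,
      x t1 = x1
    & {ae leb, forall t, t \in `[t1, t2] ->
         is_derive t (1 : R) x (pairing (mu t) (f t (x t)))}].

(* The target is x2 = x t2. *)
Definition optimal_pair f U (x1 : 'rV[R]_n) (t1 t2 : R) x mu : Prop :=
  admissible_pair f U x1 t1 t2 x mu /\
  forall s y nu, admissible_pair f U x1 t1 s y nu -> y s = x t2 -> t2 <= s.

(* +oo if x2 cannot be reached by an admissible trajectory. *)
Definition infimum_time f U (x1 x2 : 'rV[R]_n) (t1 : R) : \bar R :=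
  ereal_inf [set t2%:E | t2 in
    [set t2 | exists2 x, admissible_trajectory f U x1 t1 t2 x & x t2 = x2]].

Definition minimizing_sequence f U (x1 x2 : 'rV[R]_n) (t1 : R)
    (t2 : nat -> R) (x : nat -> R -> 'rV[R]_n) : Prop :=
  (forall N, admissible_trajectory f U x1 t1 (t2 N) (x N) /\
             x N (t2 N) = x2) /\
  (t2 N)%:E @[N --> \oo] --> infimum_time f U x1 x2 t1.

Definition extend_terminal (t2 : R) x : R -> 'rV[R]_n :=
  fun t => x (Num.min t t2).

Definition converges_uniformly (t1 : R) (t2 : nat -> R)
    (x : nat -> R -> 'rV[R]_n) (t2' : R) (x' : R -> 'rV[R]_n) : Prop :=
  {uniform [set` `[t1, +oo[],
     (fun N => extend_terminal (t2 N) (x N)) @ \oo --> extend_terminal t2' x'}.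

Definition dual_pairing (p : 'cV[R]_n) (v : 'rV[R]_n) : R := (v *m p) 0 0.

Definition Hamiltonian f (t : R) (x : 'rV[R]_n) (p : 'cV[R]_n)
    (u : 'rV[R]_r) : R := dual_pairing p (f t x u).

Definition max_Hamiltonian f U (t : R) (x : 'rV[R]_n) (p : 'cV[R]_n) : \bar R :=
  ereal_sup [set (Hamiltonian f t x p u)%:E | u in U].

(* In the row-vector convention, 'J (f t ^~ u) x is the transpose of the usual
   Jacobian matrix f_x(t, x, u). *)
Definition f_x f (t : R) (x : 'rV[R]_n) (u : 'rV[R]_r) : 'M[R]_n :=
  'J (fun y => f t y u) x.

Definition continuous_with_f_x f : Prop :=
  [/\ continuous (fun p : R * 'rV[R]_n * 'rV[R]_r => f p.1.1 p.1.2 p.2),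
      forall t (y : 'rV[R]_n) u, differentiable (fun z => f t z u) y
    & continuous (fun p : R * 'rV[R]_n * 'rV[R]_r => f_x f p.1.1 p.1.2 p.2)].

(* Continuity of the extended-real-valued function M in the third clause
   amounts to that of a finite function: by the second clause M is a.e. equal
   to <psi, x'>, which is essentially bounded. *)
Definition Lambda f U (t1 t2 : R) x mu : set (R -> 'cV[R]_n) :=
  [set psi |
    abs_continuous t1 t2 psi /\ (exists2 t, t \in `[t1, t2] & psi t != 0) /\
    [/\ {ae leb, forall t, t \in `[t1, t2] ->
           is_derive t (1 : R) psi (- (pairing (mu t) (f_x f t (x t)) *m psi t))},
        {ae leb, forall t, t \in `[t1, t2] ->
           (dual_pairing (psi t) ('D_(1 : R) x t))%:E =
           max_Hamiltonian f U t (x t) (psi t)},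
        {within [set` `[t1, t2]],
           continuous (fun t => max_Hamiltonian f U t (x t) (psi t))}
      & (0 <= max_Hamiltonian f U t2 (x t2) (psi t2))%E]].

End control_systems.

(* Main.v *)
(** The Pontryagin maximum principle holds for generalized controls, so the set
    Lambda of an optimal process is never empty and the hypotheses of the theorem
    are contradictory; what is proved is the maximum principle.

    Linearize the convexified system along [xhat], with fundamental matrices
    [Psi' = - A Psi] and [Phi' = Phi A], and transport everything to the initial
    time by [Psi].  Replacing the optimal control by [nu] moves the endpoint to
    first order by [c nu], the integral over [[t1, that2]] of
    [(F nu - F muhat) Psi]; stopping at time [that2 - e] instead of [that2] moves
    it by [- e v], where [v] is a limit point of
    [(xhat that2 - xhat (that2 - e)) Psi (that2 - e) / e] as [e] tends to 0.  The
    vectors [la c(nu) - s v] with [la, s >= 0] form a convex cone, because mixtures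
    of generalized controls are generalized controls.

    If the cone is the whole space, then finitely many mixtures and a shooting
    argument (a Banach fixed point for the pair of trajectory and mixing weights)
    give an admissible process reaching the target at time [that2 - e], against
    optimality.  Otherwise some [q <> 0] is nonpositive on the cone and
    [psi = Psi q] belongs to Lambda: switching to a constant control exactly where
    it improves the Hamiltonian gives the maximum condition, and
    [<v, q> >= 0] gives its sign at the final time. *)
From HB Require Import structures.
Require Import Defs.
From mathcomp Require Import all_boot all_order all_algebra.
From mathcomp Require Import all_classical all_reals all_analysis.
From mathcomp Require Import measurable_realfun ring lra.
Import Order.TTheory GRing.Theory Num.Theory.
Local Open Scope classical_set_scope.
Local Open Scope ring_scope.
Set Implicit Arguments.
Unset Strict Implicit.
Unset Printing Implicit Defensive.

(** * Absolutely continuous and Lipschitz functions *)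

(** Writing a perturbed trajectory as [x = xhat + w Phi], with [Phi] inverse to [Psi], removes the
    linear part of the dynamics: [w' = al k + rem], where [al] holds the mixing weights, [k] the
    transported first-order effects and [rem] the nonlinear rest. Near 0 the rest has an arbitrarily
    small Lipschitz constant jointly in [w] and [al], which is why a contraction suffices where a
    topological fixed point theorem is usual. The weights must stay nonnegative under the correction
    that steers the endpoint. So [v] is written as a combination of variations with all coefficients
    equal to one [mu > 0], and the correction is kept below [mu] times the shift of time. The
    optimal trajectory may have no derivative at the final time, so [v] is only a cluster point of
    difference quotients, and the time is shortened by an [e] at which the quotient is near [v].
    Integrals in time appear as Lipschitz primitives with a prescribed derivative almost everywhere.
    The estimates on them rest on one fact: an absolutely continuous function whose derivative is
    nonnegative almost everywhere is nondecreasing. *)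

Section matrix_norm.
Context {R : realType}.

Lemma mxnorm_entry m n (M : 'M[R]_(m, n)) i j : `|M i j| <= `|M|.
Proof.
rewrite [leRHS]/Num.Def.normr/= mx_normrE.
exact: (le_bigmax _ (fun ij : 'I_m * 'I_n => `|M ij.1 ij.2|) (i, j)).
Qed.

Lemma mxnorm_le m n (M : 'M[R]_(m, n)) c : 0 <= c ->
  (forall i j, `|M i j| <= c) -> `|M| <= c.
Proof.
move=> c0 Mc; rewrite /Num.Def.normr/= mx_normrE (bigmax_le _ c0)//=.
Qed.

Lemma mxnorm_mul m n p (A : 'M[R]_(m, n)) (B : 'M[R]_(n, p)) :
  `|A *m B| <= n%:R * `|A| * `|B|.
Proof.
apply: mxnorm_le => [|i j]; first by rewrite !mulr_ge0.
rewrite mxE (le_trans (ler_norm_sum _ _ _))//.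
rewrite -mulrA mulr_natl (le_trans (ler_sum _ (G := fun=> `|A| * `|B|) _))//; last first.
  by rewrite sumr_const card_ord.
move=> k _.
by rewrite normrM ler_pM// mxnorm_entry.
Qed.

Lemma is_derive_mxP m n (M : R -> 'M[R]_(m, n)) (t : R) D :
  is_derive t (1 : R) M D <->
  forall i j, is_derive t (1 : R) (fun s => M s i j) (D i j).
Proof.
split=> [[Md MD] i j|MD].
  have Mij : derivable (fun s => M s i j) t 1 by move/derivable_mxP : Md; exact.
  by split=> //; rewrite -MD derive_mx// mxE.
have Md : derivable M t 1 by apply/derivable_mxP => i j; have [] := MD i j.
split=> //; apply/matrixP => i j; rewrite derive_mx// mxE.
by have [] := MD i j.
Qed.

Lemma is_derive_mulmx m n p (A : R -> 'M[R]_(m, n)) (B : R -> 'M[R]_(n, p))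
    (t : R) dA dB : is_derive t (1 : R) A dA -> is_derive t (1 : R) B dB ->
  is_derive t (1 : R) (fun s => A s *m B s) (dA *m B t + A t *m dB).
Proof.
move=> /is_derive_mxP HA /is_derive_mxP HB; apply/is_derive_mxP => i j.
rewrite [X in is_derive _ _ X _](_ : _ =
  \sum_k (fun s => A s i k * B s k j)); last first.
  by apply/funext => s; rewrite mxE fct_sumE.
rewrite !mxE -big_split/=; apply: (@is_derive_sum _ _ _ _ (fun k s => A s i k * B s k j)) => k.
have -> : dA i k * B t k j + A t i k * dB k j =
   A t i k *: dB k j + B t k j *: dA i k by rewrite /GRing.scale/=; ring.
exact: is_deriveM.
Qed.

End matrix_norm.

Section ae_combinators.
Context {R : realType}.
Notation leb := (@lebesgue_measure R).

Lemma aeS (P Q : R -> Prop) : (forall t, P t -> Q t) ->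
  {ae leb, forall t, P t} -> {ae leb, forall t, Q t}.
Proof. by move=> PQ; apply: (@filterS _ _ (ae_filter_ringOfSetsType leb)). Qed.

Lemma aeS2 (P1 P2 Q : R -> Prop) : (forall t, P1 t -> P2 t -> Q t) ->
  {ae leb, forall t, P1 t} -> {ae leb, forall t, P2 t} -> {ae leb, forall t, Q t}.
Proof. by move=> PQ; apply: (@filterS2 _ _ (ae_filter_ringOfSetsType leb)). Qed.

Lemma aeS3 (P1 P2 P3 Q : R -> Prop) : (forall t, P1 t -> P2 t -> P3 t -> Q t) ->
  {ae leb, forall t, P1 t} -> {ae leb, forall t, P2 t} ->
  {ae leb, forall t, P3 t} -> {ae leb, forall t, Q t}.
Proof. by move=> PQ; apply: (@filterS3 _ _ (ae_filter_ringOfSetsType leb)). Qed.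

End ae_combinators.

(** * Monotonicity from a derivative almost everywhere *)

Section ac_monotone.
Context {R : realType}.
Notation leb := (@lebesgue_measure R).

Lemma sum_itv_le_measure (m : nat) (l l' : 'I_m -> R) (O : set R) :
  (forall i, l i <= l' i) ->
  trivIset setT (fun i => [set` `]l i, l' i[]) ->
  (forall i, [set` `]l i, l' i[] `<=` O) -> open O ->
  ((\sum_(i < m) (l' i - l i))%:E <= leb O)%E.
Proof.
move=> ll' tl lO oO.
have mI i : measurable ([set` `]l i, l' i[] : set R) by exact: measurable_itv.
apply: (@le_trans _ _ (leb (\bigcup_(i in [set: 'I_m]) [set` `]l i, l' i[]))); last first.
  apply: le_measure; rewrite ?inE//.
  - by apply: fin_bigcup_measurable => //; exact: finite_finset.
  - exact: open_measurable.
  - by move=> x [i _]; exact: lO.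
rewrite measure_fin_bigcup//; last exact: finite_finset.
rewrite (fsbigE (enum 'I_m)) ?enum_uniq//=; last first.
  by move=> i _; rewrite mem_enum.
rewrite big_enum_cond/= -sumEFin; under [leRHS]eq_bigl do rewrite in_setT.
apply: lee_sum => i _; rewrite [leRHS]lebesgue_measure_itv/= lte_fin.
by case: ltP => // l'l; rewrite lee_fin subr_le0.
Qed.

(** Continuous induction from [a] to [b]. The exceptional null set is covered by an open [W] of
    small measure: inside [W] the increments of [g] are charged to absolute continuity, outside [W]
    the derivative limits the loss to [e] per unit of time. *)
Lemma ac_nondecr (g : R -> R) a b : a <= b -> abs_continuous a b g ->
  {ae leb, forall t, t \in `[a, b] ->
     exists2 d, 0 <= d & is_derive t (1 : R) g d} ->
  g a <= g b.
Proof.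
move=> ab acg aeg; apply/ler_addgt0Pr => e0 e00.
(* The loss will be at most [e * (b - a)] outside [W] and [e] inside, together [e0]. *)
pose e := e0 / (1 + (b - a)).
have ba0 : 0 < 1 + (b - a) by rewrite ltr_wpDr// subr_ge0.
have e_gt0 : 0 < e by rewrite divr_gt0.
have {acg}[dl dl0 acg] := acg _ e_gt0.
move: aeg => [N [mN N0 aeN]].
have Noo : (leb N < +oo)%E by rewrite N0.
have [W [oO NO ltO]] := lebesgue_regularity_outer mN Noo dl0.
have {}ltO : (leb W < dl%:E)%E.
  rewrite (_ : W = (W `\` N) `|` N); last by rewrite setUC setDUK.
  rewrite (le_lt_trans (measureU2 _ _ _))//; first exact: measurableD (open_measurable oO) mN.
  by rewrite [X in (_ + X)%E]N0 adde0.
(* [S t] records that the decrease of [g] on [[a, t]] is paid for, with the intervals spent inside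
   [W] kept as an explicit disjoint family. *)
pose S := [set t | a <= t <= b /\ exists (m : nat) (l l' : 'I_m -> R),
  [/\ (forall i, a <= l i /\ l i <= l' i /\ l' i <= t),
     trivIset setT (fun i => [set` `]l i, l' i[]),
     (forall i, [set` `]l i, l' i[] `<=` W) &
     g a <= g t + e * (t - a) + \sum_(i < m) `|g (l' i) - g (l i)|]].
have Sa : S a.
  split; first by rewrite lexx.
  exists 0%N, (fun=> 0), (fun=> 0); split; [by case|by move=> [[]//]|by case|].
  by rewrite big_ord0 subrr mulr0 !addr0.
(* The property passes over every short step that ends or starts at [t]: the first kind lets [S]
   contain its supremum, the second lets it go beyond. *)
have step t : a <= t <= b -> exists2 eta, 0 < eta & forall x y, a <= x -> x <= y -> y <= b ->
    x = t \/ y = t -> y - x < eta -> S x -> S y.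
  move=> tab; have [Ot|nOt] := pselect (W t).
    have /nbhs_ballP[eta eta0 etaO] : nbhs t W by exact: open_nbhs_nbhs.
    exists eta => // x y ax xy yb xyt yx [_ [m [l [l' [Hl tl lO Hg]]]]].
    split; first by rewrite yb (le_trans ax).
    pose L i := if @unlift m.+1 ord_max i is Some j then l j else x.
    pose L' i := if @unlift m.+1 ord_max i is Some j then l' j else y.
    exists m.+1, L, L'; split.
    - move=> i; rewrite /L /L'; case: unliftP => [j _|_]; last by [].
      have [? [? ?]] := Hl j; do ! split => //; exact: (le_trans _ xy).
    - move=> i j _ _ [z []]; rewrite /L /L'.
      case: unliftP => [i' ->|->]; case: unliftP => [j' ->|->] //=.
      + by move=> ? ?; congr lift; apply: tl => //; exists z.
      + have [_ [_ lx]] := Hl i'; rewrite !in_itv/= => /andP[_ zl] /andP[xz _].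
        by have := lt_trans xz (lt_le_trans zl lx); rewrite ltxx.
      + have [_ [_ lx]] := Hl j'; rewrite !in_itv/= => /andP[xz _] /andP[_ zl].
        by have := lt_trans xz (lt_le_trans zl lx); rewrite ltxx.
    - move=> i; rewrite /L /L'; case: unliftP => [j _|_]; first exact: lO.
      move=> z /=; rewrite in_itv/= => /andP[xz zy]; apply: etaO.
      rewrite /ball/=; case: xyt => <-; rewrite ltr_norml; lra.
    - rewrite big_ord_recr/= /L /L' unlift_none.
      have uw i : unlift ord_max (widen_ord (leqnSn m) i) = Some i.
        have -> : widen_ord (leqnSn m) i = lift ord_max i.
          by apply/val_inj; rewrite /= /bump leqNgt ltn_ord.
        exact: liftK.
      under eq_bigr do rewrite uw.
      have := ler_norm (g x - g y); rewrite distrC.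
      have : e * (x - a) <= e * (y - a) by rewrite ler_pM2l// lerD2r.
      lra.
  have nNt : ~ N t by move=> /NO.
  have [dd dd0 [/cvg_ex[/= D dD]]] : exists2 d, 0 <= d & is_derive t (1 : R) g d.
    by apply: contrapT => H; apply: nNt; apply: aeN => /= /(_ ltac:(by rewrite in_itv)).
  have DD : 'D_1 g t = D by apply/cvg_lim.
  rewrite DD => Ddd; move: dD; rewrite {}Ddd => {DD D}.
  move=> /cvgrPdist_lt /(_ _ e_gt0) [eta /= eta0 Heta].
  have key h : `|h| < eta -> h != 0 -> - e < h^-1 * (g (h + t) - g t).
    move=> heta h0; have := Heta h; rewrite /ball_/= sub0r normrN => /(_ heta h0).
    rewrite /GRing.scale/= mulr1 ltr_norml => /andP[_]; lra.
  exists eta => // x y ax xy yb xyt yx [_ [m [l [l' [Hl tl lO Hg]]]]].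
  split; first by rewrite yb (le_trans ax).
  exists m, l, l'; split => // [i|].
    by have [? [? ?]] := Hl i; do ! split => //; exact: (le_trans _ xy).
  suff : g x <= g y + e * (y - x) by move: Hg; lra.
  have [<-|xy'] := eqVneq x y; first by rewrite subrr mulr0 addr0.
  have {}xy : x < y by rewrite lt_neqAle xy' xy.
  case: xyt => ?; subst t.
    have := key (y - x); rewrite gtr0_norm ?subr_gt0// gt_eqF ?subr_gt0// subrK => /(_ yx isT).
    rewrite mulrC ltr_pdivlMr ?subr_gt0//; lra.
  have := key (x - y); rewrite ltr0_norm ?subr_lt0// lt_eqF ?subr_lt0// subrK opprB => /(_ yx isT).
  rewrite mulrC ltr_ndivlMr ?subr_lt0//; lra.
have hsS : has_sup S.
  by split; [exists a|exists b => t [/andP[]]].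
set s := sup S.
have sab : a <= s <= b.
  rewrite ub_le_sup ?hsS.2//=; last by case: hsS.
  by apply: ge_sup; [case: hsS|move=> t [/andP[]]].
have [eta eta0 Heta] := step s sab.
have Ss : S s.
  have [x Sx xs] := sup_adherent eta0 hsS.
  have xs' : x <= s by apply: ub_le_sup => //; case: hsS.
  have [/andP[ax _] _] := Sx.
  case/andP: sab => as_ sb.
  by apply: (Heta x s) => //; [right|rewrite -/s in xs; lra].
have Sb : S b.
  case/andP: sab => as_; rewrite le_eqVlt => /predU1P[<-//|sb].
  pose y := Num.min b (s + eta / 2).
  have sy : s < y by rewrite lt_min sb ltrDl divr_gt0.
  have Sy : S y.
    apply: (Heta s y) => //; [exact: ltW|by rewrite ge_min lexx|by left|].
    have : y <= s + eta / 2 by rewrite ge_min lexx orbT.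
    lra.
  have : y <= s by apply: ub_le_sup => //; case: hsS.
  by rewrite leNgt sy.
case: Sb => _ [m [l [l' [Hl tl lO Hg]]]].
have small : \sum_(i < m) (l' i - l i) < dl.
  rewrite -lte_fin (le_lt_trans _ ltO)//; apply: sum_itv_le_measure => // i.
  by have [_ []] := Hl i.
have := acg m l l' Hl tl small.
have -> : e0 = e * (b - a) + e by rewrite -[X in _ + X]mulr1 -mulrDr addrC divfK// gt_eqF.
move: Hg; lra.
Qed.

Lemma ac_sub (V : normedModType R) (x : R -> V) a b a' b' :
  a <= a' -> b' <= b -> abs_continuous a b x -> abs_continuous a' b' x.
Proof.
move=> aa' bb' acx e e0; have [d d0 H] := acx e e0; exists d => // m l l' ll'.
apply: H => i; have [? [? ?]] := ll' i.
by split; [exact: le_trans aa' _|split=> //; exact: le_trans bb'].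
Qed.

Lemma ac_le2 (V1 V2 V3 : normedModType R) (x : R -> V1) (y : R -> V2)
    (z : R -> V3) a b :
  (forall s t, `|z t - z s| <= `|x t - x s| + `|y t - y s|) ->
  abs_continuous a b x -> abs_continuous a b y -> abs_continuous a b z.
Proof.
move=> zxy acx acy e e0; have e20 : 0 < e / 2 by rewrite divr_gt0.
have [d1 d10 H1] := acx _ e20; have [d2 d20 H2] := acy _ e20.
exists (Num.min d1 d2) => [|m l l' ll' tl]; first by rewrite lt_min d10.
rewrite lt_min => /andP[s1 s2].
rewrite (le_lt_trans (ler_sum _ (fun i _ => zxy (l i) (l' i))))// big_split/=.
by rewrite (splitr e) ltrD// ?H1// H2.
Qed.

Definition lip_on (V : normedModType R) (a b C : R) (x : R -> V) :=
  forall s t, a <= s -> s <= t -> t <= b -> `|x t - x s| <= C * (t - s).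

Lemma lip_on_ac (V : normedModType R) (a b C : R) (x : R -> V) :
  lip_on a b C x -> abs_continuous a b x.
Proof.
move=> lx e e0; exists (e / (1 + `|C|)) => [|m l l' ll' tl].
  by rewrite divr_gt0// ltr_pwDl.
rewrite ltr_pdivlMr ?ltr_pwDl// => small; apply: le_lt_trans small.
rewrite mulr_suml; apply: ler_sum => i _; have [? [? ?]] := ll' i.
rewrite (le_trans (lx _ _ _ _ _))// mulrC ler_wpM2l ?subr_ge0//.
by rewrite (le_trans (ler_norm _))// lerDr.
Qed.

(** The sup norm lets the bound be checked entry by entry, and there both [H + x i j] and
    [H - x i j] are nondecreasing. A nonlinear [H], such as an exponential, yields the weighted
    estimates for differential equations. *)
Lemma ac_dominated (p q : nat) (x : R -> 'M[R]_(p, q)) (H : R -> R) a b :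
  abs_continuous a b x -> abs_continuous a b H ->
  {ae leb, forall t, t \in `[a, b] -> exists D h,
    [/\ is_derive t (1 : R) x D, is_derive t (1 : R) H h & `|D| <= h]} ->
  forall s t, a <= s -> s <= t -> t <= b -> `|x t - x s| <= H t - H s.
Proof.
move=> acx acH ae s t as_ st tb.
have acHst := ac_sub as_ tb acH.
have acxst := ac_sub as_ tb acx.
have subst_ : forall z, z \in `[s, t] -> z \in `[a, b].
  by move=> z; rewrite !in_itv/= => /andP[sz zt]; rewrite (le_trans as_ sz) (le_trans zt tb).
have H0 : 0 <= H t - H s.
  rewrite subr_ge0; apply: ac_nondecr => //; apply: (aeS _ ae) => z + zst.
  move=> /(_ (subst_ _ zst)) [D [h [_ ? Dh]]]; exists h => //.
  exact: le_trans Dh.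
apply: mxnorm_le => // i j; rewrite !mxE ler_norml; apply/andP; split.
  have : H s + x s i j <= H t + x t i j; last by lra.
  apply: (@ac_nondecr (fun t => H t + x t i j)) => //.
    apply: (ac_le2 (x := H) (y := x)) => // z1 z2.
    rewrite opprD addrACA (le_trans (ler_normD _ _))// lerD2l.
    by rewrite (le_trans _ (mxnorm_entry _ i j))// !mxE.
  apply: (aeS _ ae) => z + zst => /(_ (subst_ _ zst)) [D [h [xD Hh Dh]]].
  exists (h + D i j).
    have := mxnorm_entry D i j; rewrite ler_norml => /andP[+ _]; lra.
  by apply: is_deriveD; move/is_derive_mxP : xD; exact.
have : H s - x s i j <= H t - x t i j; last by lra.
apply: (@ac_nondecr (fun t => H t - x t i j)) => //.
  apply: (ac_le2 (x := H) (y := x)) => // z1 z2.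
  rewrite opprD addrACA -opprD (le_trans (ler_normB _ _))// lerD2l.
  by rewrite (le_trans _ (mxnorm_entry _ i j))// !mxE.
apply: (aeS _ ae) => z + zst => /(_ (subst_ _ zst)) [D [h [xD Hh Dh]]].
exists (h - D i j).
  have := mxnorm_entry D i j; rewrite ler_norml => /andP[_ +]; lra.
by apply: is_deriveB; move/is_derive_mxP : xD; exact.
Qed.

Lemma ac_bounded_derive (p q : nat) (x : R -> 'M[R]_(p, q)) C a b :
  abs_continuous a b x ->
  {ae leb, forall t, t \in `[a, b] ->
    exists2 D, is_derive t (1 : R) x D & `|D| <= C} ->
  lip_on a b C x.
Proof.
move=> acx ae s t as_ st tb.
rewrite mulrBr; apply: (ac_dominated (H := fun t => C * t) acx _ _ as_ st tb).
  apply: (@lip_on_ac _ _ _ `|C|) => s' t' _ st' _.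
  by rewrite -mulrBr normrM ler_wpM2l// ger0_norm// subr_ge0.
apply: (aeS _ ae) => z H /H[D xD DC]; exists D, C; split => //.
rewrite (_ : (fun t => C * t) = C \*: id); last by apply/funext.
by have := @is_deriveZ _ _ _ id C z 1 1 (is_derive_id _ _); rewrite /GRing.scale/= mulr1.
Qed.

End ac_monotone.

(** * Lipschitz primitives of matrix functions *)

Section primitive.
Context {R : realType}.
Notation leb := (@lebesgue_measure R).

(* Stands for the indefinite Lebesgue integral of [g]; by [primitive_on_eq] it is
   determined by its value at [a]. *)
Definition primitive_on (p q : nat) (a b : R) (g G : R -> 'M[R]_(p, q)) :=
  (exists C, lip_on a b C G) /\
  {ae leb, forall t, t \in `[a, b] -> is_derive t (1 : R) G (g t)}.

Lemma lip_on_bounded (V : normedModType R) a b C (x : R -> V) :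
  lip_on a b C x -> exists2 B, 0 <= B & forall t, a <= t -> t <= b -> `|x t| <= B.
Proof.
move=> lx; exists (`|x a| + `|C| * `|b - a|) => [|t at_ tb].
  by rewrite addr_ge0// mulr_ge0.
rewrite -[x t](subrK (x a)) addrC (le_trans (ler_normD _ _))// lerD2l.
rewrite (le_trans (lx _ _ _ _ _))// ?lexx//.
rewrite (le_trans (ler_norm _))// normrM ler_wpM2l//.
by rewrite !ger0_norm ?subr_ge0 ?lerD2r//; exact: le_trans tb.
Qed.

Lemma lip_on_mulmx (m n p : nat) a b CA CB (A : R -> 'M[R]_(m, n))
    (B : R -> 'M[R]_(n, p)) :
  lip_on a b CA A -> lip_on a b CB B ->
  exists C, lip_on a b C (fun t => A t *m B t).
Proof.
move=> lA lB; have [MA MA0 HA] := lip_on_bounded lA.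
have [MB MB0 HB] := lip_on_bounded lB.
exists (n%:R * MA * CB + n%:R * CA * MB) => s t as_ st tb.
rewrite (_ : _ - _ = A t *m (B t - B s) + (A t - A s) *m B s); last first.
  by rewrite mulmxBr mulmxBl subrKA.
have as' := le_trans as_ st; have tb' := le_trans st tb.
rewrite (le_trans (ler_normD _ _))// mulrDl lerD// (le_trans (mxnorm_mul _ _))//.
  by rewrite -!mulrA ler_wpM2l// ler_pM ?HA ?lB.
rewrite -!mulrA ler_wpM2l// [MB * _]mulrC mulrA ler_pM ?HB//.
exact: lA.
Qed.

(** The difference of two primitives has derivative 0 almost everywhere, hence is Lipschitz with
    constant 0. Applied to [Phi Psi], this shows that the two fundamental matrices are inverse to
    each other. *)
Lemma primitive_on_eq (p q : nat) a b (g G G' : R -> 'M[R]_(p, q)) :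
  primitive_on a b g G -> primitive_on a b g G' -> G a = G' a ->
  forall t, a <= t -> t <= b -> G t = G' t.
Proof.
move=> [[C lG] dG] [[C' lG'] dG'] GG' t at_ tb.
have : `|(G t - G' t) - (G a - G' a)| <= 0 * (t - a).
  have : lip_on a b 0 (fun t => G t - G' t); last by apply.
  apply: ac_bounded_derive.
    apply: (ac_le2 (x := G) (y := G')); [|exact: lip_on_ac lG|exact: lip_on_ac lG'].
    by move=> s' t'; rewrite opprD addrACA -opprD (le_trans (ler_normB _ _)).
  apply: (aeS2 _ dG dG') => z + + zab => /(_ zab) d1 /(_ zab) d2; exists 0; last by rewrite normr0.
  by rewrite -(subrr (g z)); exact: is_deriveB.
by rewrite GG' subrr subr0 mul0r normr_le0 subr_eq0 => /eqP.
Qed.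

Lemma primitive_on_mulmx (m n p : nat) a b (dA A : R -> 'M[R]_(m, n))
    (dB B : R -> 'M[R]_(n, p)) :
  primitive_on a b dA A -> primitive_on a b dB B ->
  primitive_on a b (fun t => dA t *m B t + A t *m dB t) (fun t => A t *m B t).
Proof.
move=> [[CA lA] hA] [[CB lB] hB]; split; first exact: lip_on_mulmx lA lB.
apply: (aeS2 _ hA hB) => t + + tab => /(_ tab) ? /(_ tab) ?.
exact: is_derive_mulmx.
Qed.

Lemma primitive_on_sub (p q : nat) a b a' b' (g G : R -> 'M[R]_(p, q)) :
  a <= a' -> b' <= b -> primitive_on a b g G -> primitive_on a' b' g G.
Proof.
move=> aa' bb' [[C lG] hG]; split.
  by exists C => s t as_ st tb; apply: lG => //; [exact: le_trans aa' _|exact: le_trans bb'].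
apply: (aeS _ hG) => t H; rewrite in_itv/= => /andP[at_ tb]; apply: H.
by rewrite in_itv/= (le_trans aa')// (le_trans tb).
Qed.

Lemma primitive_on_dominated (p q : nat) a b (g G : R -> 'M[R]_(p, q)) C :
  primitive_on a b g G -> {ae leb, forall t, t \in `[a, b] -> `|g t| <= C} ->
  lip_on a b C G.
Proof.
move=> [[CG lG] hG] gC; apply: ac_bounded_derive; first exact: lip_on_ac lG.
by apply: (aeS2 _ gC hG) => t H H' tab; exists (g t); [exact: H'|exact: H].
Qed.

Lemma primitive_onD (p q : nat) a b (g G h H : R -> 'M[R]_(p, q)) :
  primitive_on a b g G -> primitive_on a b h H ->
  primitive_on a b (fun t => g t + h t) (fun t => G t + H t).
Proof.
move=> [[C lG] dG] [[C' lH] dH]; split.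
  exists (C + C') => s t as_ st tb; rewrite opprD addrACA mulrDl.
  by rewrite (le_trans (ler_normD _ _))// lerD ?lG ?lH.
by apply: (aeS2 _ dG dH) => t + + tab => /(_ tab) ? /(_ tab) ?; exact: is_deriveD.
Qed.

Lemma primitive_onN (p q : nat) a b (g G : R -> 'M[R]_(p, q)) :
  primitive_on a b g G -> primitive_on a b (fun t => - g t) (fun t => - G t).
Proof.
move=> [[C lG] dG]; split.
  by exists C => s t as_ st tb; rewrite -opprD normrN lG.
by apply: (aeS _ dG) => t + tab => /(_ tab) ?; exact: is_deriveN.
Qed.

Lemma primitive_on_cst (p q : nat) a b (c : 'M[R]_(p, q)) :
  primitive_on a b (fun=> 0) (fun=> c).
Proof.
split; first by exists 0 => s t _ _ _; rewrite subrr normr0 mul0r.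
by apply: aeW => t _; exact: is_derive_cst.
Qed.

Lemma primitive_on_ae (p q : nat) a b (g h G : R -> 'M[R]_(p, q)) :
  {ae leb, forall t, t \in `[a, b] -> g t = h t} ->
  primitive_on a b g G -> primitive_on a b h G.
Proof.
move=> gh [lG dG]; split => //.
by apply: (aeS2 _ gh dG) => t + + tab => /(_ tab) <-; exact.
Qed.

End primitive.

(** * Lebesgue measurability and primitives *)

Section vector_borel.
Context {R : realType}.

(** A countable base: claims about open sets, whether on measurability, null sets or density, reduce
    to countably many rational balls. *)
Lemma open_bigcup_rat_ball (k : nat) (W : set 'rV[R]_k) : open W ->
  W = \bigcup_(p in [set p : 'rV[rat]_k * nat |
         ball (map_mx ratr p.1 : 'rV[R]_k) p.2.+1%:R^-1 `<=` W])
       ball (map_mx ratr p.1 : 'rV[R]_k) p.2.+1%:R^-1.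
Proof.
move=> oW; apply/seteqP; split=> [x Wx|x [p /= pW]]; last exact: pW.
have /nbhs_ballP[e /= e0 eW] : nbhs x W by exact: open_nbhs_nbhs.
have e20 : 0 < e / 2 by rewrite divr_gt0.
have [m] := ltr_add_invr e20; rewrite add0r => me.
have rat_near j : exists q : rat, `|x 0 j - ratr q| < m.+1%:R^-1.
  have [q] := @rat_in_itvoo R (x 0 j - m.+1%:R^-1) (x 0 j + m.+1%:R^-1)
    (ltac:(by rewrite ltrD2l gtrN ?invr_gt0)).
  by rewrite in_itv/= -ltr_distl distrC => ?; exists q.
have [c cP] := choice rat_near.
have xc : ball (map_mx ratr (\row_j c j) : 'rV[R]_k) m.+1%:R^-1 x.
  by split=> // i j; rewrite !mxE ord1 /ball/= distrC.
exists (\row_j c j, m) => //= y cy; apply: eW.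
apply: (@le_ball _ _ _ (m.+1%:R^-1 + m.+1%:R^-1)).
  by rewrite [leRHS]splitr ltW// ltrD.
exact: ball_triangle (ball_sym xc) cy.
Qed.

Lemma borelV_continuous_measurable (k : nat) (phi : 'rV[R]_k -> R) :
  continuous phi -> measurable_fun setT (phi : borelV R k -> R).
Proof.
move=> cphi; apply: (measurability _ (RGenOpens.measurableE R)).
move=> _ [_ [x [y ->]] <-]; rewrite setTI; apply: sub_sigma_algebra => /=.
by apply: open_comp => [z _|]; [exact: cphi|exact: interval_open].
Qed.

End vector_borel.

Section lebesgue_measurable_real.
Context {R : realType}.
Notation leb := (@lebesgue_measure R).

(** The source carries the completed sigma-algebra, so a change on a null set keeps the property
    ([lmeas_ae]). *)
Definition lmeas (g : R -> R) := measurable_fun setT (g : lebesgueR R -> R).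

Lemma lmeas_measurable (g : R -> R) : measurable_fun setT g -> lmeas g.
Proof.
by move=> mg _ B mB; apply: sub_caratheodory; have := mg measurableT B mB.
Qed.

Lemma lmeas_continuous (g : R -> R) : continuous g -> lmeas g.
Proof. by move=> cg; apply: lmeas_measurable; exact: continuous_measurable_fun. Qed.

Lemma lmeas_cst (c : R) : lmeas (fun=> c).
Proof. exact: measurable_cst. Qed.

Lemma lmeasD (g h : R -> R) : lmeas g -> lmeas h -> lmeas (fun t => g t + h t).
Proof. exact: measurable_funD. Qed.

Lemma lmeasB (g h : R -> R) : lmeas g -> lmeas h -> lmeas (fun t => g t - h t).
Proof. exact: measurable_funB. Qed.

Lemma lmeasN (g : R -> R) : lmeas g -> lmeas (fun t => - g t).
Proof. by move=> mg; exact: (measurableT_comp (@oppr_measurable R setT) mg). Qed.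

Lemma lmeasM (g h : R -> R) : lmeas g -> lmeas h -> lmeas (fun t => g t * h t).
Proof. exact: measurable_funM. Qed.

Lemma lmeas_sum (I : finType) (g : I -> R -> R) :
  (forall i, lmeas (g i)) -> lmeas (fun t => \sum_i g i t).
Proof.
move=> mg; rewrite /lmeas; under eq_fun do rewrite -big_enum/=.
elim: (enum I) => [|i s IH].
  by under eq_fun do rewrite big_nil; exact: lmeas_cst.
by under eq_fun do rewrite big_cons; exact: lmeasD.
Qed.

Lemma negligible_lebesgue_measurable (N : set R) :
  leb.-negligible N -> measurable (N : set (lebesgueR R)).
Proof.
move=> [A [mA A0 NA]]; apply: (@negligible_sub_caratheodory R).
by exists A; split => //; exact: sub_caratheodory.
Qed.

Lemma ae_measurable_set (P : R -> Prop) : {ae leb, forall t, P t} ->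
  measurable ([set t | P t] : set (lebesgueR R)).
Proof.
by move=> aeP; rewrite -[X in measurable X]setCK; apply: measurableC;
  exact: negligible_lebesgue_measurable.
Qed.

Lemma measurable_fun_ae d (T : measurableType d) (g h : R -> T) :
  {ae leb, forall t, g t = h t} ->
  measurable_fun setT (g : lebesgueR R -> T) ->
  measurable_fun setT (h : lebesgueR R -> T).
Proof.
move=> gh mg _ B mB; rewrite setTI.
have -> : h @^-1` B = (g @^-1` B `&` [set t | g t = h t]) `|`
    (h @^-1` B `&` ~` [set t | g t = h t]).
  apply/seteqP; split=> [t Bh|t [[/= Bg <-]//|[]//]].
  have [ght|ght] := pselect (g t = h t); [left|right]; split=> //.
  by rewrite /= ght.
apply: measurableU.
  apply: measurableI; last exact: ae_measurable_set.
  by rewrite -[X in measurable X]setTI; exact: mg.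
by apply: negligible_lebesgue_measurable; apply: negligibleS gh; exact: subIsetr.
Qed.

Lemma lmeas_ae (g h : R -> R) :
  {ae leb, forall t, g t = h t} -> lmeas g -> lmeas h.
Proof. exact: measurable_fun_ae. Qed.

Lemma lebesgue_measurable_set_decomp (E : set R) :
  measurable (E : set (lebesgueR R)) ->
  exists A, measurable A /\ exists N,
    [/\ measurable N, leb N = 0%E & E `&` ~` N = A `&` ~` N].
Proof.
move=> mE; have : (completed_algebra_gen leb).-sigma.-measurable E.
  by rewrite completed_caratheodory_measurable.
rewrite g_sigma_completed_algebra_genE => -[A mA [M [N [mN N0 MN]] <-]]; exists A; split => //; exists N; split => //.
apply/seteqP; split=> [x [[Ax|Mx] nNx]|x [Ax nNx]]; split => //; last by left.
by have := MN _ Mx.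
Qed.

Lemma negligible_bigcup_countable (I : countType) (F : I -> set R) :
  (forall i, leb.-negligible (F i)) -> leb.-negligible (\bigcup_i F i).
Proof.
move=> F0; pose G (m : nat) := if unpickle m is Some i then F i else set0.
have FG : \bigcup_i F i `<=` \bigcup_m G m.
  by move=> t [i _ Ft]; exists (pickle i) => //; rewrite /G pickleK.
apply: (@negligibleS _ _ _ leb _ _ FG); apply: negligible_bigcup => m; rewrite /G.
by case: unpickle => [i|]; [exact: F0|exact: negligible_set0].
Qed.

Lemma ae_forall_countable (I : countType) (P : I -> R -> Prop) :
  (forall i, {ae leb, forall t, P i t}) -> {ae leb, forall t, forall i, P i t}.
Proof.
move=> aeP; apply: negligibleS (negligible_bigcup_countable aeP).
by move=> t /existsNP[i nP]; exists i.
Qed.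

(** Each set where [g] exceeds a given rational is Borel up to a null set; setting [g] to 0 on the
    union of these countably many null sets makes it Borel. This brings Lebesgue measurable
    functions under the differentiation theorem for the integral. *)
Lemma lmeas_borel (g : R -> R) : lmeas g ->
  exists2 h : R -> R, measurable_fun setT h & {ae leb, forall t, h t = g t}.
Proof.
move=> mg.
have decomp (q : rat) : exists AN : set R * set R,
    [/\ measurable AN.1, measurable AN.2, leb AN.2 = 0%E &
      [set t | ratr q < g t] `&` ~` AN.2 = AN.1 `&` ~` AN.2].
  have mgq : measurable ([set t | ratr q < g t] : set (lebesgueR R)).
    have := mg measurableT `]ratr q, +oo[%classic (measurable_itv _).
    by rewrite setTI; congr measurable; apply/seteqP; split=> t /=; rewrite in_itv/= andbT.
  have [A [mA [N [mN N0 AN]]]] := lebesgue_measurable_set_decomp mgq.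
  by exists (A, N).
have [AN ANP] := choice decomp.
pose N := \bigcup_q (AN q).2.
have mN : measurable N by apply: bigcupT_measurable_rat => q; have [] := ANP q.
have N0 : leb.-negligible N.
  apply: negligible_bigcup_countable => q.
  by have [_ mNq Nq0 _] := ANP q; apply/negligibleP.
pose h t := if t \in N then 0 else g t.
have aeh : {ae leb, forall t, h t = g t}.
  apply: negligibleS N0 => t /=; rewrite /h; case: ifPn => [/set_mem//|_]; exact.
exists h => //.
have hq (q : rat) : measurable [set t | ratr q < h t].
  have [mA mNq Nq0 ANq] := ANP q.
  (* On [N] the function is 0, so the level set contains all or nothing of [N], according to the
     sign of [q]. *)
  have -> : [set t | ratr q < h t] =
     ((AN q).1 `&` ~` N) `|` (N `&` [set t | ratr q < 0 :> R]).
    apply/seteqP; split=> t /=; rewrite /h.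
      case: ifPn => [/set_mem Nt|/negP nNt qt]; first by right.
      have nNt' : ~ N t by move=> ?; apply: nNt; exact/mem_set.
      left; split=> //.
      have : ([set t | ratr q < g t] `&` ~` (AN q).2) t.
        by split=> // ?; apply: nNt'; exists q.
      by rewrite ANq => -[].
    move=> [[At nNt]|[Nt]]; last by rewrite mem_set.
    rewrite memNset//.
    have : ((AN q).1 `&` ~` (AN q).2) t by split=> // ?; apply: nNt; exists q.
    by rewrite -ANq => -[].
  apply: measurableU; apply: measurableI => //; first exact: measurableC.
  by have [q0|q0] := boolP (ratr q < 0 :> R); [rewrite set_true|rewrite set_false].
apply: (measurability _ (RGenOInfty.measurableE R)).
move=> _ [_ [r ->] <-]; rewrite setTI.
have -> : h @^-1` `]r, +oo[%classic =
    \bigcup_q (if r < ratr q then [set t | ratr q < h t] else set0).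
  apply/seteqP; split=> t /=.
    rewrite in_itv/= andbT => rh; have [q] := rat_in_itvoo rh.
    by rewrite in_itv/= => /andP[rq qh]; exists q => //; rewrite rq.
  move=> [q _]; case: ifPn => // rq /= qh.
  by rewrite in_itv/= andbT (lt_trans rq).
by apply: bigcupT_measurable_rat => q; case: ifPn.
Qed.

Lemma lebesgue_measurable_fun_entry (k : nat) (h : R -> 'rV[R]_k) j :
  lebesgue_measurable_fun setT h -> lmeas (fun t => h t 0 j).
Proof.
move=> mh; apply: (measurableT_comp (f := fun v : borelV R k => v 0 j) _ mh).
by apply: borelV_continuous_measurable => v; exact: coord_continuous.
Qed.

(** A ball of the sup norm is a finite intersection of interval conditions on the entries, and
    countably many balls make up any open set. *)
Lemma lebesgue_measurable_fun_entries (k : nat) (h : R -> 'rV[R]_k) :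
  (forall j, lmeas (fun t => h t 0 j)) -> lebesgue_measurable_fun setT h.
Proof.
move=> mh; apply: measurability; first by [].
move=> _ [W oW <-]; rewrite setTI (open_bigcup_rat_ball oW) preimage_bigcup.
rewrite bigcup_mkcond.
apply: countable_bigcupT_measurable => [|p]; first exact: countableP.
case: ifPn => // _.
have -> : h @^-1` ball (map_mx ratr p.1 : 'rV[R]_k) p.2.+1%:R^-1 =
    \bigcap_(j in [set: 'I_k]) [set t | `|h t 0 j - ratr (p.1 0 j)| < p.2.+1%:R^-1].
  apply/seteqP; split=> [t [_ bt] j _|t bt].
    by have := bt 0 j; rewrite /ball/= mxE distrC.
  by split=> // i j; rewrite ord1 mxE /ball/= distrC; exact: bt.
apply: fin_bigcap_measurable => [|j _]; first exact: finite_finset.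
have := mh j measurableT
  `]ratr (p.1 0 j) - p.2.+1%:R^-1, ratr (p.1 0 j) + p.2.+1%:R^-1[%classic
  (measurable_itv _).
rewrite setTI; congr measurable; apply/seteqP.
by split=> t /=; rewrite in_itv/= ltr_distl.
Qed.

Lemma lmeas_primitive (g : R -> R) a b C : 0 <= C -> lmeas g ->
  {ae leb, forall t, t \in `[a, b] -> `|g t| <= C} ->
  exists G : R -> R, [/\ G a = 0, forall s t, s <= t -> `|G t - G s| <= C * (t - s) &
    {ae leb, forall t, t \in `[a, b] -> is_derive t (1 : R) G (g t)}].
Proof.
move=> C0 mg gC; have [h mh hg] := lmeas_borel mg.
(* Truncation turns the bound almost everywhere into one everywhere, so that the integral is
   Lipschitz with the same constant [C] on the whole line. *)
pose h1 t := if `|h t| <= C then h t else 0.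
have h1C t : `|h1 t| <= C by rewrite /h1; case: ifPn => // _; rewrite normr0.
have mh1 : measurable_fun setT h1.
  apply: measurable_fun_ifT => //.
  by apply: measurable_fun_ler => //; exact: measurableT_comp.
pose I : set R := [set` `[a, b]].
have mI : measurable I by exact: measurable_itv.
have ih1 A : measurable A -> (leb A < +oo)%E -> leb.-integrable A (EFin \o h1).
  move=> mA Aoo; apply: measurable_bounded_integrable => //.
    exact: measurable_funTS.
  by exists C; split=> [|x Cx t _]; [exact: num_real|exact: le_trans (ltW Cx)].
have iI : leb.-integrable I (EFin \o h1).
  by apply: ih1 => //; rewrite lebesgue_measure_itv/=; case: ifP; rewrite ?ltry.
pose h2 := h1 \_ I.
have i2 : leb.-integrable setT (EFin \o h2).
  by rewrite -restrict_EFin -integrable_mkcond.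
have i2A A : measurable A -> leb.-integrable A (EFin \o h2).
  by move=> mA; apply: integrableS i2.
have h2C t : `|h2 t| <= C.
  by rewrite /h2 patchE; case: ifPn => // _; rewrite normr0.
pose F x := (\int[leb]_(t in [set` `]-oo, x]]) (h2 t))%R.
have FD : {ae leb, forall x, derivable F x 1 /\ derive1 F x = h2 x}.
  apply: FTC1Ny => [y|]; first exact: i2A.
  exact: integrable_locally.
exists (fun t => F t - F a); split; first by rewrite subrr.
  move=> s t st; rewrite opprB addrA subrK /F Rintegral_itvB//; last exact: i2A.
  rewrite (le_trans (le_normr_Rintegral _ _))//; first exact: i2A.
  have -> : C * (t - s) = \int[leb]_(x in `]s, t]) C.
    rewrite Rintegral_cst//; congr (_ * _).
    rewrite [X in fine X](_ : _ = (t - s)%:E)// [LHS]lebesgue_measure_itv/= lte_fin.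
    by case: ltgtP st => // -> _; rewrite subrr.
  apply: le_Rintegral => //.
  - by apply: integrable_norm; exact: i2A.
  - apply: measurable_bounded_integrable => //; last exact: bounded_cst.
    by rewrite [ltLHS]lebesgue_measure_itv/=; case: ifP; rewrite ?ltry.
apply: (aeS3 _ FD hg gC) => t [Fd FE] ht gt tab.
have <- : h2 t = g t.
  by rewrite /h2 patchE mem_set// /h1 ht gt.
rewrite -FE derive1E -[X in is_derive _ _ _ X]subr0.
by apply: is_deriveB; exact: derivableP.
Qed.

Lemma lmeas_primitive_on (p q : nat) (g : R -> 'M[R]_(p, q)) a b C : 0 <= C ->
  (forall i j, lmeas (fun t => g t i j)) ->
  {ae leb, forall t, t \in `[a, b] -> `|g t| <= C} ->
  exists G : R -> 'M[R]_(p, q),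
   [/\ G a = 0, forall s t, s <= t -> `|G t - G s| <= C * (t - s) &
       primitive_on a b g G].
Proof.
move=> C0 mg gC.
have ex (ij : 'I_p * 'I_q) := lmeas_primitive C0 (mg ij.1 ij.2)
  (aeS (fun t H tab => le_trans (mxnorm_entry (g t) ij.1 ij.2) (H tab)) gC).
have [G GP] := choice ex.
have lG s t : s <= t ->
    `|\matrix_(i, j) G (i, j) t - \matrix_(i, j) G (i, j) s| <= C * (t - s).
  move=> st; apply: mxnorm_le => [|i j]; first by rewrite mulr_ge0// subr_ge0.
  by rewrite !mxE; have [_ /(_ _ _ st)] := GP (i, j).
exists (fun t => \matrix_(i, j) G (i, j) t); split => //.
  by apply/matrixP => i j; rewrite !mxE; have [] := GP (i, j).
split; first by exists C => s t _ st _; exact: lG.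
have : {ae leb, forall t, forall ij : 'I_p * 'I_q, t \in `[a, b] ->
    is_derive t (1 : R) (G ij) (g t ij.1 ij.2)}.
  apply: (@filter_forall _ _ _ _ (ae_filter_ringOfSetsType leb)).
  by move=> ij; have [] := GP ij.
apply: aeS => t H tab; apply/is_derive_mxP => i j.
under eq_fun do rewrite mxE.
exact: (H (i, j)).
Qed.

End lebesgue_measurable_real.

(** * Fixed points and linear differential equations *)

Section fixed_point.
Context {R : realType}.

Lemma norm_cvg_le (p q : nat) (w : nat -> 'M[R]_(p, q)) (l c : 'M[R]_(p, q)) (B : R) :
  w k @[k --> \oo] --> l -> (forall k, `|w k - c| <= B) -> `|l - c| <= B.
Proof.
move=> wl wB; apply/ler_addgt0Pr => e e0.
have [N _ /(_ N (leqnn N)) HN] : \forall k \near \oo, `|l - w k| < e.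
  by move/cvgrPdist_lt : wl; apply.
rewrite -(subrKA (w N)) (le_trans (ler_normD _ _))// addrC lerD//.
exact: ltW.
Qed.

Lemma geometric_cvg (p q : nat) (w : nat -> 'M[R]_(p, q)) (D : R) : 0 <= D ->
  (forall k, `|w k.+1 - w k| <= D / 2 ^+ k) ->
  exists2 l : 'M[R]_(p, q), w k @[k --> \oo] --> l & forall k, `|l - w k| <= 2 * D / 2 ^+ k.
Proof.
move=> D0 wD.
(* The telescoped form is what the induction on [m] needs; its negative part is dropped right
   afterwards. *)
have dist k m : `|w (k + m)%N - w k| <= 2 * D / 2 ^+ k - 2 * D / 2 ^+ (k + m).
  elim: m => [|m IH]; first by rewrite addn0 !subrr normr0.
  rewrite addnS -(subrKA (w (k + m)%N)) (le_trans (ler_normD _ _))//.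
  rewrite (le_trans (lerD (wD _) IH))// exprS invfM.
  set x := D / 2 ^+ _; set y := _ / 2 ^+ k.
  rewrite (_ : 2 * D / _ = 2 * x); last by rewrite /x mulrA.
  rewrite (_ : 2 * D * _ = x); last by rewrite /x; field; rewrite expf_neq0.
  lra.
have {}dist k m : `|w (k + m)%N - w k| <= 2 * D / 2 ^+ k.
  by rewrite (le_trans (dist _ _))// gerBl !mulr_ge0// invr_ge0 exprn_ge0.
have geo : (fun k => 2 * D / 2 ^+ k) @ \oo --> (0 : R).
  rewrite (_ : (fun k => _) = geometric (2 * D) (2^-1)); last first.
    by apply/funext => k; rewrite /geometric/= exprVn.
  by apply: cvg_geometric; rewrite ger0_norm ?invr_ge0// invf_lt1// ltr1n.
have cw : cvgn w.
  apply/cauchy_cvgP; apply/cauchy_exP => e e0.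
  have [N _ /(_ N (leqnn N)) HN] : \forall k \near \oo, `|0 - 2 * D / 2 ^+ k| < e.
    by move/cvgrPdist_lt : geo; apply.
  exists (w N); exists N => // k /= Nk.
  rewrite -ball_normE/= distrC -(subnKC Nk) (le_lt_trans (dist _ _))//.
  by rewrite (le_lt_trans _ HN)// sub0r normrN ler_norm.
exists (limn w); first exact: cw.
move=> k; apply: (norm_cvg_le (w := fun m => w (k + m)%N)) => //.
move=> A /cw [N _ NA]; exists N => // m /= Nm; apply: NA => /=.
by rewrite (leq_trans Nm)// leq_addl.
Qed.

(** Banach's theorem with contraction constant 1/2 for functions on [I], in the sup norm weighted by
    [om]. The map is a relation [T], because a primitive is given by its properties and not by a
    formula. Closedness of [S] under pointwise limits suffices, since the iterates converge at every
    index at a geometric rate. *)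
Lemma weighted_fixed_point (I : Type) (p q : nat) (om : I -> R)
    (S : set (I -> 'M[R]_(p, q))) (T : (I -> 'M[R]_(p, q)) -> (I -> 'M[R]_(p, q)) -> Prop)
    (u0 : I -> 'M[R]_(p, q)) (D0 : R) :
  (forall i, 0 <= om i) -> S u0 -> 0 <= D0 ->
  (forall u, S u -> exists2 v, S v & T u v) ->
  (forall (w : nat -> I -> 'M[R]_(p, q)) u, (forall k, S (w k)) ->
     (forall i, w k i @[k --> \oo] --> u i) -> S u) ->
  (forall u v u' v' D, S u -> S v -> T u u' -> T v v' -> 0 <= D ->
     (forall i, `|u i - v i| <= D * om i) ->
     forall i, `|u' i - v' i| <= D / 2 * om i) ->
  (forall u, T u0 u -> forall i, `|u i - u0 i| <= D0 * om i) ->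
  exists u, S u /\ T u u.
Proof.
move=> om0 Su0 D00 exT clS ctr T0.
have exT' u : exists v, S u -> S v /\ T u v.
  by have [/exT[v]|] := pselect (S u); [exists v|exists u].
have [f fP] := choice exT'.
pose w k := iter k f u0.
have Sw k : S (w k) by elim: k => //= k IH; have [] := fP _ IH.
have Tw k : T (w k) (w k.+1) by have [] := fP _ (Sw k).
have wD k i : `|w k.+1 i - w k i| <= (D0 * om i) / 2 ^+ k.
  have : `|w k.+1 i - w k i| <= D0 / 2 ^+ k * om i; last by rewrite mulrAC.
  elim: k i => [|k IH] i; first by rewrite expr0 invr1 mulr1; exact: (T0 _ (Tw 0%N)).
  have := @ctr (w k.+1) (w k) _ _ (D0 / 2 ^+ k) (Sw _) (Sw _) (Tw _) (Tw _) _ IH i.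
  rewrite exprSr invfM mulrA; apply.
  by rewrite divr_ge0// exprn_ge0.
have ex i := geometric_cvg (mulr_ge0 D00 (om0 i)) (fun k => wD k i).
have [u uP] := choice (fun i => (let: ex_intro2 l a b := ex i in
  ex_intro (fun l => _ /\ _) l (conj a b))).
have Su : S u by apply: (clS w) => // i; have [] := uP i.
exists u; split => //; have [v Sv Tuv] := exT _ Su.
(* The image [v] of the limit [u] is within the contraction bound of the iterate [w k.+1], which is
   itself close to [u]. *)
suff vu : v = u by rewrite -{2}vu.
apply/funext => i; apply/eqP; rewrite -subr_eq0 -normr_le0.
have key k : `|v i - u i| <= 2 * (2 * (D0 * om i)) / 2 ^+ k.
  rewrite -(subrKA (w k.+1 i)) (le_trans (ler_normD _ _))//.
  rewrite (_ : 2 * _ / _ = 2 * (D0 * om i) / 2 ^+ k + 2 * (D0 * om i) / 2 ^+ k); last by field; rewrite expf_neq0.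
  rewrite lerD//.
    have := @ctr u (w k) v _ (2 * D0 / 2 ^+ k) Su (Sw _) Tuv (Tw k) _ _ i.
    move=> H; rewrite (le_trans (H _ _))//.
    - by rewrite divr_ge0 ?mulr_ge0// exprn_ge0.
    - move=> j; have [_ /(_ k)] := uP j.
      by move=> /le_trans; apply; rewrite le_eqVlt; apply/orP; left; apply/eqP; field; rewrite expf_neq0.
    - rewrite (_ : 2 * D0 / 2 ^+ k / 2 * om i = D0 * om i / 2 ^+ k); last by field; rewrite expf_neq0.
      rewrite ler_wpM2r ?invr_ge0 ?exprn_ge0//.
      by rewrite ler_peMl ?mulr_ge0// ler1n.
  have [_ /(_ k.+1)] := uP i; rewrite distrC => /le_trans; apply.
  rewrite ler_wpM2l ?mulr_ge0// lef_pV2 ?posrE ?exprn_gt0// exprS.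
  by rewrite ler_peMl ?exprn_ge0// ler1n.
have geo : (fun k => 2 * (2 * (D0 * om i)) / 2 ^+ k) @ \oo --> (0 : R).
  rewrite (_ : (fun k => _) = geometric (2 * (2 * (D0 * om i))) (2^-1)); last first.
    by apply/funext => k; rewrite /geometric/= exprVn.
  by apply: cvg_geometric; rewrite ger0_norm ?invr_ge0// invf_lt1// ltr1n.
apply/ler_addgt0Pr => e e0; rewrite add0r.
have [N _ /(_ N (leqnn N)) HN] : \forall k \near \oo, `|0 - 2 * (2 * (D0 * om i)) / 2 ^+ k| < e.
  by move/cvgrPdist_lt : geo; apply.
rewrite (le_trans (key N))// (le_trans _ (ltW HN))// sub0r normrN ler_norm//.
Qed.

End fixed_point.

Section clamp.
Context {R : realType}.
Variables (a b : R).

(** Precomposition with [clamp] extends a function on [[a, b]] by its end values, so that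
    continuity, measurability and Lipschitz bounds can be stated on the whole line. *)
Definition clamp (t : R) := Num.max a (Num.min b t).

Hypothesis ab : a <= b.

Lemma clamp_ge t : a <= clamp t. Proof. by rewrite /clamp le_max lexx. Qed.

Lemma clamp_le t : clamp t <= b.
Proof. by rewrite /clamp ge_max ab ge_min lexx. Qed.

Lemma clamp_id t : a <= t -> t <= b -> clamp t = t.
Proof. by move=> at_ tb; rewrite /clamp (min_idPr tb) (max_idPr at_). Qed.

Lemma clamp_homo s t : s <= t -> clamp s <= clamp t.
Proof.
move=> st; rewrite /clamp; case: (leP b s) => bs; case: (leP b t) => bt.
all: rewrite /Num.max; case: (ltP a b) => ?; case: (ltP a s) => ?; case: (ltP a t) => ?; lra.
Qed.

Lemma clamp_lip s t : s <= t -> clamp t - clamp s <= t - s.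
Proof.
move=> st; rewrite /clamp; case: (leP b s) => bs; case: (leP b t) => bt.
all: rewrite /Num.max; case: (ltP a b) => ?; case: (ltP a s) => ?; case: (ltP a t) => ?; lra.
Qed.

End clamp.

(** * Functions that are Lipschitz on the whole line *)

Section global_lipschitz.
Context {R : realType}.

Definition lipschitz_with (p q : nat) (C : R) (x : R -> 'M[R]_(p, q)) :=
  forall s t, s <= t -> `|x t - x s| <= C * (t - s).

Lemma lipschitz_with_continuous p q C (x : R -> 'M[R]_(p, q)) :
  lipschitz_with C x -> continuous x.
Proof.
move=> lx t; apply/cvgrPdist_lt => e e0.
have C1 : 0 < `|C| + 1 by rewrite ltr_wpDl.
near=> s.
have H : `|x t - x s| <= (`|C| + 1) * `|t - s : R|.
  have C2 : C <= `|C| + 1 by rewrite (le_trans (ler_norm _))// lerDl.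
  have [st|ts] := leP (s : R) t.
    have ts0 : 0 <= t - s :> R by rewrite subr_ge0.
    by rewrite (ger0_norm ts0) (le_trans (lx _ _ st))// ler_wpM2r.
  have st0 : 0 <= s - t :> R by rewrite subr_ge0 ltW.
  rewrite distrC [`|t - s|]distrC (ger0_norm st0).
  by rewrite (le_trans (lx _ _ (ltW ts)))// ler_wpM2r.
rewrite (le_lt_trans H)// mulrC -ltr_pdivlMr//.
near: s; apply: (@cvgr_dist_lt _ _ _ _ _ id t); first exact: cvg_id.
by rewrite divr_gt0.
Unshelve. all: by end_near. Qed.

Lemma lipschitz_with_clamp p q C a b (x : R -> 'M[R]_(p, q)) : a <= b -> 0 <= C ->
  lip_on a b C x -> lipschitz_with C (x \o clamp a b).
Proof.
move=> ab C0 lx s t st /=.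
rewrite (le_trans (lx _ _ _ _ _)) ?clamp_ge ?clamp_le ?clamp_homo//.
by rewrite ler_wpM2l// clamp_lip.
Qed.

Lemma lipschitz_with_lim p q C (w : nat -> R -> 'M[R]_(p, q)) u :
  (forall k, lipschitz_with C (w k)) -> (forall t, w k t @[k --> \oo] --> u t) ->
  lipschitz_with C u.
Proof.
move=> lw wu s t st.
rewrite -[X in `|X|]subr0.
apply: (norm_cvg_le (w := fun k => w k t - w k s)).
  by apply: cvgB; exact: wu.
by move=> k; rewrite subr0; exact: lw.
Qed.

Lemma lmeas_mulmx (m n p : nat) (A : R -> 'M[R]_(m, n)) (B : R -> 'M[R]_(n, p)) :
  (forall i j, lmeas (fun t => A t i j)) -> (forall i j, lmeas (fun t => B t i j)) ->
  forall i j, lmeas (fun t => (A t *m B t) i j).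
Proof.
move=> mA mB i j; under eq_fun do rewrite mxE.
by apply: lmeas_sum => k; exact: lmeasM.
Qed.

Lemma lmeas_entry_continuous (m n : nat) (A : R -> 'M[R]_(m, n)) : continuous A ->
  forall i j, lmeas (fun t => A t i j).
Proof.
move=> cA i j; apply: lmeas_continuous => t.
by apply: (@continuous_comp _ _ _ A (fun M : 'M[R]_(m, n) => M i j)); [exact: cA|exact: coord_continuous].
Qed.

End global_lipschitz.

Section clamped_primitive.
Context {R : realType}.
Notation leb := (@lebesgue_measure R).

Lemma ae_neq (c : R) : {ae leb, forall t, t != c}.
Proof.
exists [set c]; split => //; first exact: lebesgue_measure_set1.
by move=> t /= /negP; rewrite negbK => /eqP.
Qed.

(** Clamping can destroy the derivative only at [a] and [b], which are discarded as null sets; at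
    interior points both functions agree nearby. *)
Lemma clamped_primitive (p q : nat) (g : R -> 'M[R]_(p, q)) a b C : a <= b -> 0 <= C ->
  (forall i j, lmeas (fun t => g t i j)) ->
  {ae leb, forall t, t \in `[a, b] -> `|g t| <= C} ->
  exists G : R -> 'M[R]_(p, q),
   [/\ G a = 0, lipschitz_with C G, forall t, G t = G (clamp a b t) &
       primitive_on a b g G].
Proof.
move=> ab C0 mg gC; have [G [Ga lG [_ dG]]] := lmeas_primitive_on C0 mg gC.
exists (fun t => G (clamp a b t)); split.
- by rewrite clamp_id.
- move=> s t st; rewrite (le_trans (lG _ _ _)) ?clamp_homo//.
  by rewrite ler_wpM2l// clamp_lip.
- by move=> t; rewrite [clamp a b (clamp a b t)]clamp_id ?clamp_ge ?clamp_le.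
split.
  exists C => s t as_ st tb.
  by rewrite !clamp_id// ?lG// ?(le_trans st)// (le_trans as_).
apply: (aeS3 _ (ae_neq a) (ae_neq b) dG) => t ta tb H tab.
have dGt := H tab.
have near_t : \forall s \near t, G s = G (clamp a b s).
  have tab' : t \in `]a, b[.
    by move: tab; rewrite !in_itv/= !lt_neqAle eq_sym ta tb.
  near=> s.
  have : s \in `]a, b[ by near: s; exact: near_in_itvoo.
  by rewrite in_itv/= => /andP[/ltW as_ /ltW sb]; rewrite clamp_id.
exact: near_eq_is_derive near_t dGt.
Unshelve. all: by end_near. Qed.

End clamped_primitive.

(** * Linear differential equations with measurable coefficients *)

Section linear_ode.
Context {R : realType}.
Notation leb := (@lebesgue_measure R).

Lemma is_derive_exp_scale (B l a t : R) :
  is_derive t (1 : R) (fun s => B * expR (l * (s - a))) (B * l * expR (l * (t - a))).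
Proof.
apply: is_derive_eq.
by rewrite /GRing.scale/= subr0 mulr1; ring.
Qed.

Lemma lip_on_exp (B l a b : R) : 0 <= B -> 0 <= l -> a <= b ->
  lip_on a b (B * l * expR (l * (b - a))) (fun s => B * expR (l * (s - a))).
Proof.
move=> B0 l0 ab s t as_ st tb.
have [->|st'] := eqVneq s t; first by rewrite !subrr normr0 mulr0.
have {}st' : s < t by rewrite lt_neqAle st'.
have [||c] := @MVT R (fun s => B * expR (l * (s - a))) (fun t => B * l * expR (l * (t - a))) s t st'.
- by move=> x _; exact: is_derive_exp_scale.
- apply: continuous_subspaceT => x.
  by apply: differentiable_continuous; apply/derivable1_diffP; have [] := is_derive_exp_scale B l a x.
rewrite in_itv/= => /andP[sc ct] ->.
have ts0 : 0 <= t - s by rewrite subr_ge0.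
rewrite ger0_norm ?mulr_ge0 ?expR_ge0// ler_wpM2r// ler_wpM2l ?mulr_ge0//.
by rewrite ler_expR ler_wpM2l// lerD2r ltW// (lt_le_trans ct).
Qed.

Lemma linear_ode (p q : nat) (M : R -> 'M[R]_q) (a b c : R) (X0 : 'M[R]_(p, q)) :
  a <= b -> 0 <= c -> (forall i j, lmeas (fun t => M t i j)) ->
  {ae leb, forall t, t \in `[a, b] -> `|M t| <= c} ->
  exists X : R -> 'M[R]_(p, q), [/\ X a = X0, exists C, lipschitz_with C X &
    primitive_on a b (fun t => X t *m M t) X].
Proof.
move=> ab c0 mM Mc.
(* With this rate the derivative of [D / 2 * expR (l * (t - a))] dominates
   [q * c * D * expR (l * (t - a))], the bound for [u t *m M t]. *)
pose l := 2 * (q%:R * c + 1).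
have l0 : 0 <= l by rewrite mulr_ge0// addr_ge0// mulr_ge0.
pose om t := expR (l * (clamp a b t - a)).
have om0 t : 0 <= om t by exact: expR_ge0.
have omE t : t \in `[a, b] -> om t = expR (l * (t - a)).
  by rewrite in_itv/= => /andP[at_ tb]; rewrite /om clamp_id.
have om1 t : 1 <= om t.
  by rewrite /om -expR0 ler_expR mulr_ge0// subr_ge0 clamp_ge.
pose omb := expR (l * (b - a)).
have om_b t : om t <= omb by rewrite ler_expR ler_wpM2l// lerD2r clamp_le.
(* With twice the norm of [X0], the bound [B / 2 + (B / 2 * om - B / 2)] on the Picard image is
   [B / 2 * om], so [S] is mapped into itself. *)
pose B := 2 * `|X0|.
have B0 : 0 <= B by rewrite mulr_ge0.
pose C := q%:R * (B * omb) * c.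
have omb0 : 0 <= omb by exact: expR_ge0.
have C0 : 0 <= C by rewrite !mulr_ge0.
pose S := [set u : R -> 'M[R]_(p, q) | lipschitz_with C u /\ forall t, `|u t| <= B * om t].
pose T (u v : R -> 'M[R]_(p, q)) := v a = X0 /\ (forall t, v t = v (clamp a b t)) /\
  primitive_on a b (fun t => u t *m M t) v.
(* The exponential weight makes the Picard map a contraction with constant 1/2
   on the whole interval. *)
have dom (g : R -> 'M[R]_(p, q)) G D : 0 <= D -> primitive_on a b g G ->
    {ae leb, forall t, t \in `[a, b] -> `|g t| <= q%:R * (D * om t) * c} ->
    forall t, `|G (clamp a b t) - G a| <= D / 2 * om t - D / 2.
  move=> D0 [[CG lG] dG] gD t.
  pose H s := D / 2 * expR (l * (s - a)).
  have -> : D / 2 * om t - D / 2 = H (clamp a b t) - H a.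
    by rewrite /H subrr mulr0 expR0 mulr1.
  apply: (@ac_dominated _ _ _ G H a b); rewrite ?clamp_ge ?clamp_le//.
  - exact: lip_on_ac lG.
  - by apply: lip_on_ac; apply: lip_on_exp => //; rewrite divr_ge0.
  apply: (aeS2 _ dG gD) => s ds gs sab.
  exists (g s), (D / 2 * l * expR (l * (s - a))); split; [exact: ds|exact: is_derive_exp_scale|].
  rewrite (le_trans (gs sab))// omE// /l; set E := expR _.
  have : 0 <= D * E by rewrite mulr_ge0// expR_ge0.
  by rewrite (_ : D / 2 * _ * E = q%:R * (D * E) * c + D * E); [lra|field].
have TD u v u' v' D : T u u' -> T v v' -> 0 <= D ->
    (forall t, `|u t - v t| <= D * om t) -> forall t, `|u' t - v' t| <= D / 2 * om t.
  move=> [u'a [u'c pu]] [v'a [v'c pv]] D0 uvD t.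
  have puv := primitive_onD pu (primitive_onN pv).
  have := dom _ _ _ D0 puv _ t; rewrite /= u'a v'a subrr subr0 -u'c -v'c.
  move=> /(_ _)/le_trans; apply; last by rewrite gerBl divr_ge0.
  apply: (aeS _ Mc) => s H sab; rewrite -mulmxBl (le_trans (mxnorm_mul _ _))//.
  by rewrite ler_pM ?mulr_ge0 ?H// ler_wpM2l.
have exT u : S u -> exists2 v, S v & T u v.
  move=> [lu uB].
  have uMC : {ae leb, forall t, t \in `[a, b] -> `|u t *m M t| <= q%:R * (B * om t) * c}.
    apply: (aeS _ Mc) => t H tab; rewrite (le_trans (mxnorm_mul _ _))//.
    by rewrite ler_pM ?mulr_ge0 ?H// ler_wpM2l.
  have uMC' : {ae leb, forall t, t \in `[a, b] -> `|u t *m M t| <= C}.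
    apply: (aeS _ uMC) => t H tab; rewrite (le_trans (H tab))//.
    by rewrite /C ler_wpM2r// ler_wpM2l// ler_wpM2l.
  have [|G [Ga lG cG pG]] := clamped_primitive ab C0 _ uMC'.
    apply: lmeas_mulmx => //; apply: lmeas_entry_continuous.
    exact: lipschitz_with_continuous lu.
  exists (fun t => X0 + G t).
    split; first by move=> s t st; rewrite opprD addrACA subrr add0r lG.
    move=> t; rewrite (le_trans (ler_normD _ _))//.
    have := dom _ _ _ B0 pG uMC t; rewrite Ga subr0 -cG => H.
    rewrite (le_trans (lerD (lexx _) H))//.
    have -> : `|X0| = B / 2 by rewrite /B; field.
    have : 0 <= B * om t by rewrite mulr_ge0.
    rewrite -mulrA [2^-1 * _]mulrC mulrA; lra.
  split; first by rewrite Ga addr0.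
  split; first by move=> t; rewrite -cG.
  have := primitive_onD (primitive_on_cst a b X0) pG.
  by apply: primitive_on_ae; apply: aeW => t _; rewrite add0r.
have S0 : S (fun=> 0).
  split; first by move=> s t st; rewrite subrr normr0 mulr_ge0// subr_ge0.
  by move=> t; rewrite normr0 mulr_ge0.
have [|||u [[lu uB] [ua [uc pu]]]] := @weighted_fixed_point _ R p q om S T (fun=> 0) B om0 S0 B0 exT.
- move=> w u Sw wu; split.
    by apply: (lipschitz_with_lim (w := w)) => // k; have [] := Sw k.
  move=> t; rewrite -[u t]subr0; apply: (norm_cvg_le (wu t)) => k.
  by rewrite subr0; have [_] := Sw k.
- by move=> u v u' v' D _ _; exact: TD.
- move=> u T0u t; rewrite subr0.
  have [v [_ vB] T0v] := exT _ S0.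
  have := @TD _ _ _ _ 0 T0u T0v (lexx _) _ t.
  rewrite mul0r mul0r subr0 => H.
  have /eqP : `|u t - v t| == 0.
    by rewrite eq_le normr_ge0 andbT H// => s; rewrite normr0 mul0r.
  by move/normr0_eq0/eqP; rewrite subr_eq0 => /eqP ->.
by exists u; split => //; exists C.
Qed.

End linear_ode.

(** * Generalized controls *)

Section compact_uniform.
Context {R : realType}.

(** Only [p] is required to lie in [C]; [p'] ranges over a full neighbourhood, because perturbed
    states leave the compact graph of the reference trajectory. *)
Lemma compact_uniform_continuity (T : pseudoMetricType R) (V : normedModType R)
    (C : set T) (h : T -> V) : compact C -> continuous h ->
  forall e, 0 < e -> exists2 d, 0 < d & forall p p', C p -> ball p d p' -> `|h p - h p'| < e.
Proof.
move=> /compact_near_coveringP cC ch e e0.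
have e20 : 0 < e / 2 by rewrite divr_gt0.
pose P d p := forall p', ball p d p' -> `|h p - h p'| < e.
have : \forall d \near at_right (0 : R), C `<=` P d.
  apply: cC => p0 Cp0.
  have : \forall p \near p0, `|h p0 - h p| < e / 2 by move/cvgrPdist_lt : (ch p0); apply.
  move=> /nbhs_ballP[r /= r0 Hr].
  have r20 : 0 < r / 2 by rewrite divr_gt0.
  near=> p d => p' pp'.
  have pp0 : ball p0 (r / 2) p by near: p; exact: nbhsx_ballx.
  have dr : d <= r / 2 by apply: ltW; near: d; exact: nbhs_right_lt.
  rewrite -(subrKA (h p0)) (splitr e) (le_lt_trans (ler_normD _ _))// ltrD//.
    rewrite distrC; apply: Hr; apply: le_ball pp0; lra.
  apply: Hr; apply: (@le_ball _ _ _ (r / 2 + d)); first lra.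
  exact: ball_triangle pp0 pp'.
move=> /(filterI (nbhs_right_gt (0 : R))) /filter_ex[d [/= d0 H]].
by exists d => // p p' Cp; exact: H.
Unshelve. all: by end_near. Qed.

End compact_uniform.

(** * Supports and mixtures of probability measures *)

Section probability_support.
Context {R : realType} (r : nat).
Implicit Types (mu nu : probability (borelV R r) R).

Lemma open_borelV (W : set 'rV[R]_r) : open W -> measurable (W : set (borelV R r)).
Proof. exact: sub_sigma_algebra. Qed.

Lemma probabilityT mu : mu [set: borelV R r] = 1%E.
Proof. exact: probability_setT. Qed.

(** A point outside the support lies in a rational ball of measure zero, and there are countably
    many of those. Bounds on integrals may therefore be checked on the support alone. *)
Lemma msupport_full mu : mu.-negligible (~` (msupport mu)).
Proof.
have [N NP NU] : exists2 N : set 'rV[R]_r, mu.-negligible N & ~` (msupport mu) `<=` N.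
  pose B (p : 'rV[rat]_r * nat) : set 'rV[R]_r := ball (map_mx ratr p.1 : 'rV[R]_r) p.2.+1%:R^-1.
  have oB p : open (B p) by exact: ball_open.
  pose G m : set (borelV R r) := if unpickle m is Some p then
    (if mu (B p) == 0%E then B p else set0) else set0.
  exists (\bigcup_m G m).
    apply: negligible_bigcup => m; rewrite /G; case: unpickle => [p|]; last exact: negligible_set0.
    case: eqP => [B0|_]; last exact: negligible_set0.
    by apply/negligibleP => //; exact: open_borelV.
  move=> u /existsNP[W /not_implyP[oW /not_implyP[Wu /negP]]].
  rewrite -leNgt measure_le0 => /eqP W0.
  move: Wu; rewrite (open_bigcup_rat_ball oW) => -[p /= pW pu].
  exists (pickle p) => //; rewrite /G pickleK ifT//; apply/eqP.
  apply/eqP; rewrite -measure_le0 -W0; apply: le_measure; rewrite ?inE.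
  - exact: open_borelV.
  - exact: open_borelV.
  - exact: pW.
exact: (@negligibleS _ _ _ mu _ _ NU).
Qed.

Lemma msupport_ae mu (P : 'rV[R]_r -> Prop) : (forall u, msupport mu u -> P u) ->
  {ae mu, forall u, P u}.
Proof.
move=> HP; apply: (@negligibleS _ _ _ mu _ _ _ (msupport_full mu)).
by move=> u; apply: contra_not; exact: HP.
Qed.

Lemma msupport_neq0 mu : msupport mu !=set0.
Proof.
apply/set0P/negP => /eqP s0; have := msupport_full mu.
rewrite s0 setC0 => /(measure_negligible measurableT).
by rewrite [X in X = _](probabilityT mu) => -[] /eqP; rewrite oner_eq0.
Qed.

Lemma bounded_support_integrable mu (phi : 'rV[R]_r -> R) B : continuous phi ->
  (forall u, msupport mu u -> `|phi u| <= B) ->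
  mu.-integrable setT (EFin \o (phi : borelV R r -> R)).
Proof.
move=> cphi phiB; apply/integrableP.
have mphi := borelV_continuous_measurable cphi.
split; first exact/measurable_EFinP.
have [u0 su0] := msupport_neq0 mu; have B0 := le_trans (normr_ge0 _) (phiB u0 su0).
apply: (@le_lt_trans _ _ (\int[mu]_(x in [set: borelV R r]) B%:E)%E); last first.
  by rewrite integral_cst// [X in (_ * X)%E](probabilityT mu) mule1 ltry.
apply: ae_ge0_le_integral => //.
- by do 2 apply: measurableT_comp => //.
- by apply: (@msupport_ae mu (fun u => [set: borelV R r] u -> (`|(EFin \o phi) u| <= B%:E)%E)) => u /phiB.
Qed.

(** On the support [phi] coincides with [Num.min (phi u) c], which is at most [c] everywhere. *)
Lemma Rintegral_support_le mu (phi : 'rV[R]_r -> R) B c : continuous phi ->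
  (forall u, msupport mu u -> `|phi u| <= B) ->
  (forall u, msupport mu u -> phi u <= c) ->
  Rintegral mu setT (phi : borelV R r -> R) <= c.
Proof.
move=> cphi phiB phic.
have mphi := borelV_continuous_measurable cphi.
have iphi := bounded_support_integrable cphi phiB.
have [u0 su0] := msupport_neq0 mu.
pose psi (u : borelV R r) := Num.min (phi u) c.
have mpsi : measurable_fun setT psi by apply: measurable_minr => //; exact: measurable_cst.
have ipsi : mu.-integrable setT (EFin \o psi).
  apply: (@le_integrable _ (borelV R r) R mu setT measurableT (EFin \o psi)
    (EFin \o (fun u : borelV R r => `|phi u| + `|c|))).
  - exact/measurable_EFinP.
  - move=> u _; rewrite lee_fin [leRHS]ger0_norm ?addr_ge0// /psi.
    by rewrite /Num.min; case: ifP => _; [rewrite lerDl|rewrite lerDr].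
  - rewrite (_ : _ \o _ = (EFin \o (fun u : borelV R r => `|phi u|%R)) \+ (EFin \o cst `|c|%R))%E//.
    apply: integrableD => //; first exact: integrable_norm.
    exact: finite_measure_integrable_cst.
have cE k : Rintegral mu setT (fun _ : borelV R r => k) = k.
  by rewrite Rintegral_cst//= [X in fine X](probabilityT mu) mulr1.
rewrite /Rintegral (ae_eq_integral (EFin \o psi))//; last first.
- by apply: (@msupport_ae mu (fun u => [set: borelV R r] u -> (EFin \o phi) u = (EFin \o psi) u)) => u su _; rewrite /psi/= min_l// phic.
- exact/measurable_EFinP.
- exact/measurable_EFinP.
rewrite -[leRHS]cE; apply: le_Rintegral => //.
  exact: finite_measure_integrable_cst.
by move=> u _; rewrite /psi ge_min lexx orbT.
Qed.

End probability_support.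

Section mixture.
Context {R : realType} (r : nat) (p q : {nonneg R}).
Hypothesis pq : p%:num + q%:num = 1.
Variables (mu nu : probability (borelV R r) R).

(** The [let] keeps the section hypothesis [pq] among the arguments of [mixture], so that the total
    mass 1 can be attached to it as a canonical structure. *)
Definition mixture : set (borelV R r) -> \bar R :=
  let _ := pq in measure_add (mscale p mu) (mscale q nu).

HB.instance Definition _ := Measure.copy mixture (measure_add (mscale p mu) (mscale q nu)).

Let mixtureT : mixture setT = 1%E.
Proof.
transitivity (p%:num%:E * mu setT + q%:num%:E * nu setT)%E; first exact: measure_addE.
transitivity (p%:num%:E * 1 + q%:num%:E * 1)%E; last by rewrite !mule1 -EFinD pq.
by congr (_ * _ + _ * _)%E; exact: probabilityT.
Qed.

HB.instance Definition _ := Measure_isProbability.Build _ _ _ mixture mixtureT.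

End mixture.

Section mixture_theory.
Context {R : realType} (r : nat).
Implicit Types (mu nu : probability (borelV R r) R).

Lemma mixture_exists (p : R) mu nu : 0 <= p <= 1 ->
  exists P : probability (borelV R r) R,
    (forall A, P A = p%:E * mu A + (1 - p)%:E * nu A)%E /\
    (forall phi : borelV R r -> R, mu.-integrable setT (EFin \o phi) ->
       nu.-integrable setT (EFin \o phi) ->
       Rintegral P setT phi = p * Rintegral mu setT phi + (1 - p) * Rintegral nu setT phi).
Proof.
move=> /andP[p0 p1]; have q0 : 0 <= 1 - p by rewrite subr_ge0.
have pq : (NngNum p0)%:num + (NngNum q0)%:num = 1 by rewrite /= addrC subrK.
pose P : probability (borelV R r) R := mixture pq mu nu.
exists P; split => [A|phi iphi jphi]; first exact: measure_addE.
have scale (k : {nonneg R}) (m : probability (borelV R r) R) : m.-integrable setT (EFin \o phi) ->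
   (mscale k m).-integrable setT (EFin \o phi) /\
   (\int[mscale k m]_x (phi x)%:E = k%:num%:E * \int[m]_x (phi x)%:E)%E.
  move=> ip; have mp := measurable_int _ ip; split.
    apply/integrableP; split => //.
    rewrite ge0_integral_mscale//; last exact: measurableT_comp.
    by rewrite lte_mul_pinfty//; move/integrableP : ip => [].
  rewrite integralE ge0_integral_mscale//; last exact: measurable_funepos.
  rewrite ge0_integral_mscale//; last exact: measurable_funeneg.
  rewrite -muleBr//; first by rewrite -integralE.
  apply: fin_num_adde_defl.
  by rewrite fin_numN; apply: integrable_fin_num => //; exact: integrable_funeneg.
have [i1 e1] := scale (NngNum p0) _ iphi.
have [i2 e2] := scale (NngNum q0) _ jphi.
rewrite /Rintegral (_ : \int[P]_x (phi x)%:E = (p%:E * \int[mu]_x (phi x)%:E + (1 - p)%:E * \int[nu]_x (phi x)%:E))%E.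
  by rewrite fineD ?fineM//; [apply: integrable_fin_num|apply: integrable_fin_num|apply: fin_numM => //; exact: integrable_fin_num|apply: fin_numM => //; exact: integrable_fin_num].
by rewrite -e1 -e2; exact: integral_measure_add.
Qed.

Lemma msupport_mixture (p : R) mu nu (P : probability (borelV R r) R) : 0 <= p <= 1 ->
  (forall A, P A = p%:E * mu A + (1 - p)%:E * nu A)%E ->
  msupport P `<=` msupport mu `|` msupport nu.
Proof.
move=> /andP[p0 p1] PE u Pu; apply: contrapT => /not_orP[].
move=> /existsNP[W1 /not_implyP[oW1 /not_implyP[W1u /negP]]].
rewrite -leNgt measure_le0 => /eqP W10.
move=> /existsNP[W2 /not_implyP[oW2 /not_implyP[W2u /negP]]].
rewrite -leNgt measure_le0 => /eqP W20.
have := Pu (W1 `&` W2) (openI oW1 oW2) (conj W1u W2u).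
have sub0 (m : probability (borelV R r) R) W : open W -> m W = 0%E -> W1 `&` W2 `<=` W -> m (W1 `&` W2) = 0%E.
  move=> oW W0 WW; apply/eqP; rewrite -measure_le0 -W0; apply: le_measure; rewrite ?inE//.
    by apply: open_borelV; exact: openI.
  exact: open_borelV.
by rewrite PE (sub0 _ _ oW1 W10)// (sub0 _ _ oW2 W20)// !mule0 adde0 ltxx.
Qed.

Lemma msupport_dirac (u : 'rV[R]_r) :
  msupport (dirac (u : borelV R r) : probability (borelV R r) R) `<=` [set u].
Proof.
move=> v Hv; apply: contrapT => /eqP vu.
have vu0 : 0 < `|v - u| by rewrite normr_gt0 subr_eq0.
have := Hv (ball v `|v - u|) (ball_open _ _) (ballxx _ vu0).
rewrite [X in (_ < X)%E](_ : _ = 0%E) ?ltxx// [LHS]diracE memNset//.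
by rewrite -ball_normE/= ltxx.
Qed.

Lemma Rintegral_dirac (u : 'rV[R]_r) (phi : 'rV[R]_r -> R) : continuous phi ->
  Rintegral (dirac (u : borelV R r) : probability (borelV R r) R) setT (phi : borelV R r -> R) = phi u.
Proof.
move=> cphi; rewrite /Rintegral integral_dirac//.
  by rewrite diracT mul1e.
by apply/measurable_EFinP; exact: borelV_continuous_measurable.
Qed.

End mixture_theory.

Section pairing_theory.
Context {R : realType} (r : nat).
Implicit Types (mu nu : probability (borelV R r) R).

Definition compactly_supported mu :=
  exists2 K : set 'rV[R]_r, compact K & msupport mu `<=` K.

Lemma compact_continuous_bounded (K : set 'rV[R]_r) (phi : 'rV[R]_r -> R) :
  compact K -> continuous phi -> exists B, forall u, K u -> `|phi u| <= B.
Proof.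
move=> cK cphi; have : compact (phi @` K).
  by apply: continuous_compact => //; exact: continuous_subspaceT.
move=> /compact_bounded[M [_ HM]]; exists (M + 1) => u Ku.
by apply: HM; [rewrite ltrDl|exists u].
Qed.

Lemma compactly_supported_integrable mu (phi : 'rV[R]_r -> R) :
  compactly_supported mu -> continuous phi ->
  mu.-integrable setT (EFin \o (phi : borelV R r -> R)).
Proof.
move=> [K cK sK] cphi; have [B HB] := compact_continuous_bounded cK cphi.
by apply: (bounded_support_integrable cphi) => u /sK; exact: HB.
Qed.

Lemma continuous_entry (p q : nat) (T : topologicalType) (g : T -> 'M[R]_(p, q)) i j :
  continuous g -> continuous (fun u => g u i j).
Proof.
move=> cg u; apply: (@continuous_comp _ _ _ g (fun M : 'M[R]_(p, q) => M i j)).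
  exact: cg.
exact: coord_continuous.
Qed.

Lemma continuousZ_fun (T : topologicalType) (c : R) (phi : T -> R) :
  continuous phi -> continuous (fun u => c * phi u).
Proof.
by move=> cphi u; apply: (@continuousM _ _ (fun=> c)); [exact: cst_continuous|exact: cphi].
Qed.

Lemma continuous_sum_seq (T : topologicalType) (I : Type) (s : seq I) (phi : I -> T -> R) :
  (forall i, continuous (phi i)) -> continuous (fun u => \sum_(i <- s) phi i u).
Proof.
move=> cphi; elim: s => [|k s IH] u.
  by rewrite /continuous_at big_nil; under eq_cvg do rewrite big_nil; exact: cst_continuous.
have -> : (fun u => \sum_(i <- k :: s) phi i u) = (fun u => phi k u + \sum_(i <- s) phi i u).
  by apply/funext => v; rewrite big_cons.
by apply: (@continuousD _ _ _ (phi k)); [exact: cphi|exact: IH].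
Qed.

Lemma Rintegral_lincomb (mu : probability (borelV R r) R) (I : finType) (c : I -> R)
    (phi : I -> 'rV[R]_r -> R) : compactly_supported mu ->
  (forall i, continuous (phi i)) ->
  Rintegral mu setT (fun u : borelV R r => \sum_i c i * phi i u) =
  \sum_i c i * Rintegral mu setT (phi i : borelV R r -> R).
Proof.
move=> cmu cphi.
under [in LHS]eq_fun do rewrite -big_enum/=.
rewrite -[RHS]big_enum/=.
elim: (enum I) => [|i s IH].
  by under eq_fun do rewrite big_nil; rewrite Rintegral_cst// mul0r big_nil.
under eq_fun do rewrite big_cons.
have ci := compactly_supported_integrable cmu (cphi i).
rewrite RintegralD//.
- by rewrite RintegralZl// big_cons IH.
- exact: (integrableZl _ (c i) ci).
- have cs := @continuous_sum_seq _ _ s _ (fun j => continuousZ_fun (c := c j) (cphi j)).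
  exact: (compactly_supported_integrable cmu cs).
Qed.

Lemma pairingD mu (p q : nat) (g h : 'rV[R]_r -> 'M[R]_(p, q)) :
  compactly_supported mu -> continuous g -> continuous h ->
  pairing mu (fun u => g u + h u) = pairing mu g + pairing mu h.
Proof.
move=> cmu cg ch; apply/matrixP => i j; rewrite !mxE.
rewrite -RintegralD//.
- by congr Rintegral; apply/funext => u; rewrite mxE.
- by apply: (compactly_supported_integrable cmu); exact: continuous_entry.
- by apply: (compactly_supported_integrable cmu); exact: continuous_entry.
Qed.

Lemma pairing_mull mu (p q s : nat) (A : 'M[R]_(s, p)) (g : 'rV[R]_r -> 'M[R]_(p, q)) :
  compactly_supported mu -> continuous g ->
  pairing mu (fun u => A *m g u) = A *m pairing mu g.
Proof.
move=> cmu cg; apply/matrixP => i j; rewrite !mxE.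
under eq_fun do rewrite mxE.
rewrite (Rintegral_lincomb (fun k => A i k) cmu (phi := fun k u => g u k j)).
  by apply: eq_bigr => k _; rewrite mxE.
by move=> k; exact: continuous_entry.
Qed.

Lemma pairing_mulr mu (p q s : nat) (A : 'M[R]_(q, s)) (g : 'rV[R]_r -> 'M[R]_(p, q)) :
  compactly_supported mu -> continuous g ->
  pairing mu (fun u => g u *m A) = pairing mu g *m A.
Proof.
move=> cmu cg; apply/matrixP => i j; rewrite !mxE.
under eq_fun do (rewrite mxE; under eq_bigr do rewrite mulrC).
rewrite (Rintegral_lincomb (fun k => A k j) cmu (phi := fun k u => g u i k)).
  by apply: eq_bigr => k _; rewrite mxE mulrC.
by move=> k; exact: continuous_entry.
Qed.

Lemma pairingN mu (p q : nat) (g : 'rV[R]_r -> 'M[R]_(p, q)) :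
  compactly_supported mu -> continuous g ->
  pairing mu (fun u => - g u) = - pairing mu g.
Proof.
move=> cmu cg; rewrite -[pairing mu g]mul1mx -mulNmx -pairing_mull//.
by congr pairing; apply/funext => u; rewrite mulNmx mul1mx.
Qed.

Lemma pairing_le mu (phi : 'rV[R]_r -> 'M[R]_1) c : compactly_supported mu ->
  continuous phi -> (forall u, msupport mu u -> phi u 0 0 <= c) ->
  pairing mu phi 0 0 <= c.
Proof.
move=> [K cK sK] cphi phic; rewrite mxE.
have cphi0 : continuous (fun u => phi u 0 0) by exact: continuous_entry.
have [B HB] := compact_continuous_bounded cK cphi0.
by apply: (Rintegral_support_le cphi0) => // u /sK; exact: HB.
Qed.

Lemma pairing_norm_le mu (p q : nat) (g : 'rV[R]_r -> 'M[R]_(p, q)) c :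
  compactly_supported mu -> continuous g ->
  (forall u, msupport mu u -> `|g u| <= c) -> `|pairing mu g| <= c.
Proof.
move=> [K cK sK] cg gc.
have [u0 su0] := msupport_neq0 mu; have c0 := le_trans (normr_ge0 _) (gc _ su0).
apply: mxnorm_le => // i j; rewrite mxE ler_norml; apply/andP; split.
  rewrite lerNl.
  have cgN : continuous (fun u => - g u i j).
    by move=> u; apply: continuousN; exact: continuous_entry.
  have := @Rintegral_support_le _ _ mu (fun u => - g u i j) c c cgN.
  have -> : Rintegral mu setT (fun u : borelV R r => - g u i j) = - Rintegral mu setT (fun u : borelV R r => g u i j).
    under eq_fun do rewrite -mulN1r.
    rewrite RintegralZl ?mulN1r//.
    apply: (@compactly_supported_integrable mu (fun u => g u i j)); first by exists K.
    exact: continuous_entry.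
  apply=> u /gc; have := mxnorm_entry (g u) i j; rewrite ?normrN; first exact: le_trans.
  rewrite ler_norml => /andP[+ _] => H1 H2; rewrite lerNl (le_trans _ H1)// lerN2//.
apply: (@Rintegral_support_le _ _ mu (fun u => g u i j) c c).
- exact: continuous_entry.
- by move=> u /gc; exact: le_trans (mxnorm_entry _ _ _).
- move=> u /gc; apply: le_trans; exact: le_trans (ler_norm _) (mxnorm_entry _ _ _).
Qed.

Lemma pairing_dirac (p q : nat) (u : 'rV[R]_r) (g : 'rV[R]_r -> 'M[R]_(p, q)) :
  continuous g -> pairing (dirac (u : borelV R r) : probability (borelV R r) R) g = g u.
Proof.
move=> cg; apply/matrixP => i j; rewrite mxE.
exact: (@Rintegral_dirac R r u _ (@continuous_entry _ _ _ g i j cg)).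
Qed.

End pairing_theory.

(** * Uniform linearization of the dynamics along a trajectory *)

Section increments.
Context {R : realType} (n r : nat).
Variable f : R -> 'rV[R]_n -> 'rV[R]_r -> 'rV[R]_n.
Hypothesis Hf : continuous_with_f_x f.

Lemma is_derive_segment t u (y v : 'rV[R]_n) (s : R) :
  is_derive s (1 : R) (fun s : R => f t (s *: v + y) u) (v *m f_x f t (s *: v + y) u).
Proof.
have [_ df _] := Hf; have dfs := df t (s *: v + y) u.
rewrite /f_x -deriveEjacobian//.
have E : (fun h : R => h^-1 *: (f t ((h *: (1 : R) + s) *: v + y) u - f t (s *: v + y) u)) =
   (fun h : R => h^-1 *: (f t (h *: v + (s *: v + y)) u - f t (s *: v + y) u)).
  by apply/funext => h; rewrite scalerDl [h *: 1]mulr1 addrA.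
split; last by rewrite /derive /= E.
by have := @diff_derivable _ _ _ _ _ v dfs; rewrite /derivable/= E.
Qed.

(** The mean value theorem for each entry of [f - s v J0] on the segment from [y'] to [y], with the
    matrix [J0] frozen. The factor [n] is the price of a matrix product in the sup norm. *)
Lemma increment_le t u (y y' : 'rV[R]_n) (J0 : 'M[R]_n) eta :
  (forall s, 0 <= s <= 1 -> `|f_x f t (s *: (y - y') + y') u - J0| <= eta) ->
  `|f t y u - f t y' u - (y - y') *m J0| <= n%:R * eta * `|y - y'|.
Proof.
move=> HJ; set v := y - y' in HJ *.
have eta0 : 0 <= eta by rewrite (le_trans _ (HJ 0 _))// lexx ler01.
apply: mxnorm_le => [|i j]; first by rewrite !mulr_ge0.
pose g (s : R) := f t (s *: v + y') u - s *: (v *m J0).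
have dg s : is_derive s (1 : R) g (v *m (f_x f t (s *: v + y') u - J0)).
  rewrite mulmxBr; apply: is_deriveB; first exact: is_derive_segment.
  apply/is_derive_mxP => i' j'; under eq_fun do rewrite mxE.
  by apply: is_derive_eq; rewrite /GRing.scale/= mulr0 add0r mulr1.
have dgij s : is_derive s (1 : R) (fun s => g s i j) ((v *m (f_x f t (s *: v + y') u - J0)) i j).
  by move/is_derive_mxP : (dg s); exact.
have [|c] := @MVT R (fun s => g s i j) (fun s => (v *m (f_x f t (s *: v + y') u - J0)) i j) 0 1 ltr01.
  apply: continuous_subspaceT => s.
  by apply: differentiable_continuous; apply/derivable1_diffP; have [] := dgij s.
rewrite in_itv/= => /andP[c0 c1].
rewrite subr0 mulr1 /g !scale1r scale0r add0r scale0r subr0 subrK => E.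
have -> : (f t y u - f t y' u - v *m J0) i j =
    (f t y u - v *m J0) i j - f t y' u i j by rewrite !mxE; ring.
rewrite E (le_trans (mxnorm_entry _ _ _))// (le_trans (mxnorm_mul _ _))//.
by rewrite -!mulrA ler_wpM2l// mulrC ler_wpM2r// HJ// !ltW.
Qed.

Variables (a b : R) (xi : R -> 'rV[R]_n) (K : set 'rV[R]_r).
Hypotheses (cxi : continuous xi) (cK : compact K).

Let graph : set (R * 'rV[R]_n * 'rV[R]_r) :=
  (fun p : R * 'rV[R]_r => (p.1, xi p.1, p.2)) @` ([set` `[a, b]] `*` K).

Let compact_graph : compact graph.
Proof.
apply: continuous_compact; last first.
  by apply: compact_setX => //; exact: segment_compact.
apply: continuous_subspaceT => p.
have c1 : (fun q : R * 'rV[R]_r => xi q.1) @ p --> xi p.1.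
  by apply: cvg_comp; [exact: cvg_fst|exact: cxi].
exact: (cvg_pair (cvg_pair cvg_fst c1) cvg_snd).
Qed.

Let graph_norm_bounded (V : normedModType R) (h : R * 'rV[R]_n * 'rV[R]_r -> V) :
  continuous h -> exists2 C, 0 <= C & forall t u, t \in `[a, b] -> K u ->
    `|h (t, xi t, u)| <= C.
Proof.
move=> ch; have : compact (h @` graph).
  by apply: continuous_compact; [exact: continuous_subspaceT|exact: compact_graph].
move=> /compact_bounded[M [Mreal HM]]; exists (`|M| + 1) => [|t u tab Ku].
  by rewrite addr_ge0.
apply: HM; first by rewrite ltr_pwDr// ler_norm.
by exists (t, xi t, u) => //; exists (t, u).
Qed.

Lemma f_bounded_along : exists2 C, 0 <= C & forall t u, t \in `[a, b] -> K u ->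
  `|f t (xi t) u| <= C /\ `|f_x f t (xi t) u| <= C.
Proof.
have [cf _ cfx] := Hf.
have [C1 C10 H1] := graph_norm_bounded cf; have [C2 C20 H2] := graph_norm_bounded cfx.
exists (C1 + C2) => [|t u tab Ku]; first exact: addr_ge0.
split; first by rewrite (le_trans (H1 t u _ _))// lerDl.
by rewrite (le_trans (H2 t u _ _))// lerDr.
Qed.

(** The derivative is uniformly continuous near the compact graph of [xi] over [K], and the segment
    between two states near the graph stays near it. One matrix therefore serves for all pairs [y],
    [y']. *)
Lemma f_linearized_along eta : 0 < eta -> exists2 d, 0 < d &
  forall t u y y', t \in `[a, b] -> K u -> `|y - xi t| < d -> `|y' - xi t| < d ->
    `|f t y u - f t y' u - (y - y') *m f_x f t (xi t) u| <= eta * `|y - y'|.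
Proof.
move=> eta0; have [_ _ cfx] := Hf.
(* [n.+1] absorbs the factor [n] of [increment_le] and keeps the divisor positive in dimension 0. *)
have e0 : 0 < eta / n.+1%:R by rewrite divr_gt0.
have [d d0 Hd] := compact_uniform_continuity compact_graph cfx e0.
exists d => // t u y y' tab Ku yd y'd.
apply: le_trans (increment_le (eta := eta / n.+1%:R) _) _.
  move=> s /andP[s0 s1]; rewrite distrC ltW//.
  apply: (Hd (t, xi t, u) (t, s *: (y - y') + y', u)).
    by exists (t, u).
  split; [split; [exact: ballxx|]|exact: ballxx].
  rewrite /= -ball_normE/=.
  have -> : xi t - (s *: (y - y') + y') = s *: (xi t - y) + (1 - s) *: (xi t - y').
    by apply/matrixP => i j; rewrite !mxE; ring.
  rewrite (le_lt_trans (ler_normD _ _))// !normrZ ger0_norm// ger0_norm ?subr_ge0//.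
  rewrite ![`|xi t - _|]distrC.
  have : s * `|y - xi t| <= s * Num.max `|y - xi t| `|y' - xi t|.
    by rewrite ler_wpM2l// le_max lexx.
  have : (1 - s) * `|y' - xi t| <= (1 - s) * Num.max `|y - xi t| `|y' - xi t|.
    by rewrite ler_wpM2l ?subr_ge0// le_max lexx orbT.
  have : Num.max `|y - xi t| `|y' - xi t| < d by rewrite gt_max yd y'd.
  lra.
rewrite ler_wpM2r// mulrCA -[leRHS]mulr1 ler_wpM2l ?ltW//.
by rewrite ltr_pdivrMr// mul1r ltr_nat.
Qed.

End increments.

Section matrix_valued_continuity.
Context {R : realType}.

Lemma mx_continuousN (T : topologicalType) p q (g : T -> 'M[R]_(p, q)) :
  continuous g -> continuous (fun u => - g u).
Proof. by move=> cg u; exact: (cvgN (cg u)). Qed.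

Lemma mx_continuousB (T : topologicalType) p q (g h : T -> 'M[R]_(p, q)) :
  continuous g -> continuous h -> continuous (fun u => g u - h u).
Proof. by move=> cg ch u; exact: (cvgB (cg u) (ch u)). Qed.

Lemma mx_continuousD (T : topologicalType) p q (g h : T -> 'M[R]_(p, q)) :
  continuous g -> continuous h -> continuous (fun u => g u + h u).
Proof. by move=> cg ch u; exact: (cvgD (cg u) (ch u)). Qed.

Lemma mx_continuous_entries (T : topologicalType) p q (g : T -> 'M[R]_(p, q)) :
  (forall i j, continuous (fun u => g u i j)) -> continuous g.
Proof.
move=> cg u; apply/cvgrPdist_lt => e e0.
have : \forall v \near u, forall ij : 'I_p * 'I_q, `|g u ij.1 ij.2 - g v ij.1 ij.2| < e.
  by apply: filter_forall => ij; move/cvgrPdist_lt : (cg ij.1 ij.2 u); apply.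
have e20 : 0 < e / 2 by rewrite divr_gt0.
move=> _; have : \forall v \near u, forall ij : 'I_p * 'I_q, `|g u ij.1 ij.2 - g v ij.1 ij.2| < e / 2.
  by apply: filter_forall => ij; move/cvgrPdist_lt : (cg ij.1 ij.2 u); apply.
apply: filterS => v H; apply: (@le_lt_trans _ _ (e / 2)); last lra.
by apply: mxnorm_le => [|i j]; [exact: ltW|rewrite !mxE ltW//; exact: (H (i, j))].
Qed.

Lemma mx_continuousM (T : topologicalType) p q s (g : T -> 'M[R]_(p, q)) (h : T -> 'M[R]_(q, s)) :
  continuous g -> continuous h -> continuous (fun u => g u *m h u).
Proof.
move=> cg ch; apply: mx_continuous_entries => i j u.
rewrite (_ : (fun u => (g u *m h u) i j) = (fun u => \sum_k (g u i k * h u k j))); last first.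
  by apply/funext => v; rewrite mxE.
move: u; apply: (@continuous_sum_seq _ _ _ _ (fun k u => g u i k * h u k j)) => k u.
apply: (@continuousM _ _ (fun u => g u i k)); exact: continuous_entry.
Qed.

Lemma continuous_pairl (T T' : topologicalType) (t : T) : continuous (fun v : T' => (t, v)).
Proof. by move=> v; exact: (cvg_pair (@cst_continuous _ _ t v) cvg_id). Qed.

Lemma continuous_pairr (T T' : topologicalType) (t : T) : continuous (fun v : T' => (v, t)).
Proof. by move=> v; exact: (cvg_pair cvg_id (@cst_continuous _ _ t v)). Qed.

End matrix_valued_continuity.

(** * Measurability and mixing of generalized controls *)

Section generalized_controls_theory.
Context {R : realType} (n r : nat).
Notation leb := (@lebesgue_measure R).
Variable U : set 'rV[R]_r.
Notation GC := (@generalized_controls_in R n r U).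
Implicit Types (mu nu : R -> probability (borelV R r) R).

Lemma gc_support mu : GC mu -> exists2 K : set 'rV[R]_r, compact K &
  {ae leb, forall t, msupport (mu t) `<=` K `&` U}.
Proof.
move=> [[[K cK aeK] _] aeU]; exists K => //.
by apply: (aeS2 _ aeK aeU) => t tK tU u tu; split; [exact: tK|exact: tU].
Qed.

Lemma gc_compactly_supported mu : GC mu ->
  {ae leb, forall t, compactly_supported (mu t)}.
Proof.
move=> /gc_support[K cK aeK]; apply: (aeS _ aeK) => t tK; exists K => //.
by move=> u /tK[].
Qed.

(** The definition of weak measurability tests row vectors of length [n]; a matrix with [n] columns
    is treated row by row, which covers the Jacobian. *)
Lemma gc_lmeas (p : nat) mu (g : R * 'rV[R]_r -> 'M[R]_(p, n)) : GC mu -> continuous g ->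
  forall i j, lmeas (fun t => pairing (mu t) (fun u => g (t, u)) i j).
Proof.
move=> [[_ mmu] _] cg i j.
have cgi : continuous (fun tu => row i (g tu)).
  move=> tu; apply/cvgrPdist_lt => e e0.
  have : \forall z \near tu, `|g tu - g z| < e by move/cvgrPdist_lt : (cg tu); apply.
  apply: filterS => z; apply: le_lt_trans.
  by apply: mxnorm_le => // k l; rewrite !mxE; have := mxnorm_entry (g tu - g z) i l; rewrite !mxE.
have := lebesgue_measurable_fun_entry j (mmu _ cgi).
apply: lmeas_ae; apply: aeW => t; rewrite !mxE.
by congr Rintegral; apply/funext => u; rewrite mxE.
Qed.

Lemma gc_dirac (u : 'rV[R]_r) : U u ->
  GC (fun=> (dirac (u : borelV R r) : probability (borelV R r) R)).
Proof.
move=> Uu; split; last by apply: aeW => t v /msupport_dirac ->.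
split.
  exists [set u]; first exact: compact_set1.
  by apply: aeW => t; exact: msupport_dirac.
move=> g cg; apply: lebesgue_measurable_fun_entries => j.
have cgu t : continuous (fun v => g (t, v)).
  move=> v; apply: (@continuous_comp _ _ _ (fun v => (t, v)) g); last exact: cg.
  exact: continuous_pairl.
under eq_fun do rewrite pairing_dirac//.
apply: lmeas_continuous; apply: continuous_entry => t.
apply: (@continuous_comp _ _ _ (fun t => (t, u)) g); last exact: cg.
exact: continuous_pairr.
Qed.

(** The weight may depend measurably on time, so this covers both convex combinations and switching
    between two controls on a measurable set. *)
Lemma gc_mix mu nu (chi : R -> R) : GC mu -> GC nu -> lmeas chi ->
  (forall t, 0 <= chi t <= 1) ->
  exists2 la, GC la & {ae leb, forall t, forall p q (g : 'rV[R]_r -> 'M[R]_(p, q)),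
    continuous g -> pairing (la t) g =
    chi t *: pairing (mu t) g + (1 - chi t) *: pairing (nu t) g}.
Proof.
move=> Gmu Gnu mchi chi01.
have [la laP] := choice (fun t => mixture_exists (mu t) (nu t) (chi01 t)).
have lapair : {ae leb, forall t, forall p q (g : 'rV[R]_r -> 'M[R]_(p, q)),
    continuous g -> pairing (la t) g =
    chi t *: pairing (mu t) g + (1 - chi t) *: pairing (nu t) g}.
  apply: (aeS2 _ (gc_compactly_supported Gmu) (gc_compactly_supported Gnu)).
  move=> t cmu cnu p q g cg; apply/matrixP => i j; rewrite !mxE.
  have [_ ->//] := laP t.
    by apply: (compactly_supported_integrable cmu); exact: continuous_entry.
  by apply: (compactly_supported_integrable cnu); exact: continuous_entry.
exists la => //.
have [K cK aeK] := gc_support Gmu; have [L cL aeL] := gc_support Gnu.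
have sla t : msupport (la t) `<=` msupport (mu t) `|` msupport (nu t).
  by have [PE _] := laP t; exact: msupport_mixture (chi01 t) PE.
split; last first.
  by apply: (aeS2 _ aeK aeL) => t tK tL u /sla[/tK[]|/tL[]].
split.
  exists (K `|` L); first exact: compactU.
  by apply: (aeS2 _ aeK aeL) => t tK tL u /sla[/tK[]|/tL[]]; [left|right].
move=> g cg; apply: lebesgue_measurable_fun_entries => j.
have cgu t : continuous (fun v => g (t, v)).
  move=> v; apply: (@continuous_comp _ _ _ (fun v => (t, v)) g); last exact: cg.
  exact: continuous_pairl.
have m1 := gc_lmeas Gmu cg; have m2 := gc_lmeas Gnu cg.
have := lmeasD (lmeasM mchi (m1 0 j)) (lmeasM (lmeasB (lmeas_cst 1) mchi) (m2 0 j)).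
apply: lmeas_ae; apply: (aeS _ lapair) => t /(_ _ _ _ (cgu t)) ->.
by rewrite !mxE.
Qed.

(** By induction: the last control is mixed with weight [th'] into a mixture of the others whose
    weights are divided by [1 - th']. *)
Lemma gc_finite_mix (m : nat) mu (nu : 'I_m -> R -> probability (borelV R r) R)
    (th : 'I_m -> R) : GC mu -> (forall i, GC (nu i)) ->
  (forall i, 0 <= th i) -> \sum_i th i <= 1 ->
  exists2 la, GC la & {ae leb, forall t, forall p q (g : 'rV[R]_r -> 'M[R]_(p, q)),
    continuous g -> pairing (la t) g =
    pairing (mu t) g + \sum_i th i *: (pairing (nu i t) g - pairing (mu t) g)}.
Proof.
elim: m nu th => [|m IH] nu th Gmu Gnu th0 th1.
  by exists mu => //; apply: aeW => t p q g _; rewrite big_ord0 addr0.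
have sum0 : 0 <= \sum_(i < m) th (widen_ord (leqnSn m) i) by apply: sumr_ge0.
rewrite big_ord_recr/= in th1.
set th' := th ord_max in th1.
have th'0 : 0 <= th' by exact: th0.
(* If the last weight is 1, this rescaling is impossible, but then all other weights vanish. *)
have [th'1|th'1] := leP 1 th'.
  exists (nu ord_max) => //; apply: aeW => t p q g _.
  have E : th' = 1 by apply/eqP; rewrite eq_le th'1 andbT; lra.
  rewrite big_ord_recr/= -/th' E scale1r big1.
    by rewrite add0r addrC subrK.
  move=> i _; suff -> : th (widen_ord (leqnSn m) i) = 0 by rewrite scale0r.
  apply/eqP; rewrite eq_le th0 andbT (le_trans (y := \sum_(i < m) th (widen_ord (leqnSn m) i)))//; last lra.
  by rewrite (bigD1 i)//= lerDl sumr_ge0.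
have q0 : 0 < 1 - th' by lra.
have [|||la Gla Ela] := IH (fun i => nu (widen_ord (leqnSn m) i))
  (fun i => th (widen_ord (leqnSn m) i) / (1 - th')) Gmu.
- by move=> i; exact: Gnu.
- by move=> i; rewrite divr_ge0// ltW.
- by rewrite -mulr_suml ler_pdivrMr// mul1r; lra.
have [|rho Grho Erho] := gc_mix (Gnu ord_max) Gla (lmeas_cst th').
  by move=> _; rewrite th'0 ltW.
exists rho => //; apply: (aeS2 _ Ela Erho) => t E1 E2 p q g cg.
rewrite E2// E1// big_ord_recr/= -/th'.
set Sm := \sum_(i < m) th _ *: _.
have -> : \sum_(i < m) (th (widen_ord (leqnSn m) i) / (1 - th')) *:
    (pairing (nu (widen_ord (leqnSn m) i) t) g - pairing (mu t) g) = (1 - th')^-1 *: Sm.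
  by rewrite scaler_sumr; apply: eq_bigr => i _; rewrite scalerA mulrC.
rewrite scalerDr scalerA divff ?gt_eqF// scale1r.
by apply/matrixP => i j; rewrite !mxE; ring.
Qed.

End generalized_controls_theory.

(** * Vector fields of generalized controls *)

Section fields.
Context {R : realType} (n r : nat).
Notation leb := (@lebesgue_measure R).
Variables (f : R -> 'rV[R]_n -> 'rV[R]_r -> 'rV[R]_n) (U : set 'rV[R]_r).
Hypothesis Hf : continuous_with_f_x f.
Notation GC := (@generalized_controls_in R n r U).
Variables (a b : R) (xi : R -> 'rV[R]_n).
Hypothesis cxi : continuous xi.

(** All that the shooting argument retains of a control: measurability along continuous curves, a
    bound on the reference trajectory, and a linearization around it that is uniform in time. *)
Definition smooth_field (F : R -> 'rV[R]_n -> 'rV[R]_n) (A : R -> 'M[R]_n) (C : R) :=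
  [/\ forall y : R -> 'rV[R]_n, continuous y -> forall i j, lmeas (fun t => F t (y t) i j),
      forall i j, lmeas (fun t => A t i j),
      {ae leb, forall t, t \in `[a, b] -> `|F t (xi t)| <= C /\ `|A t| <= C}
    & forall eta, 0 < eta -> exists2 d, 0 < d & {ae leb, forall t, t \in `[a, b] ->
        forall y y', `|y - xi t| < d -> `|y' - xi t| < d ->
        `|F t y - F t y' - (y - y') *m A t| <= eta * `|y - y'|}].

Lemma f_continuous_along (y : R -> 'rV[R]_n) : continuous y ->
  continuous (fun tu : R * 'rV[R]_r => f tu.1 (y tu.1) tu.2).
Proof.
move=> cy tu; have [cf _ _] := Hf.
have c1 : (fun q : R * 'rV[R]_r => y q.1) @ tu --> y tu.1.
  by apply: cvg_comp; [exact: cvg_fst|exact: cy].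
exact: (cvg_comp _ _ (cvg_pair (cvg_pair cvg_fst c1) cvg_snd) (cf (tu.1, y tu.1, tu.2))).
Qed.

Let cont_fx (y : R -> 'rV[R]_n) : continuous y ->
  continuous (fun tu : R * 'rV[R]_r => f_x f tu.1 (y tu.1) tu.2).
Proof.
move=> cy tu; have [_ _ cf] := Hf.
have c1 : (fun q : R * 'rV[R]_r => y q.1) @ tu --> y tu.1.
  by apply: cvg_comp; [exact: cvg_fst|exact: cy].
exact: (cvg_comp _ _ (cvg_pair (cvg_pair cvg_fst c1) cvg_snd) (cf (tu.1, y tu.1, tu.2))).
Qed.

Lemma f_continuous_u t y : continuous (f t y).
Proof.
move=> u; have := f_continuous_along (y := fun=> y) _ (x := (t, u)).
move=> H; apply: (@continuous_comp _ _ _ (fun u => (t, u)) (fun tu : R * 'rV[R]_r => f tu.1 y tu.2)).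
  exact: continuous_pairl.
by apply: H; exact: cst_continuous.
Qed.

Lemma f_x_continuous_u t y : continuous (f_x f t y).
Proof.
move=> u; have := cont_fx (y := fun=> y) _ (x := (t, u)).
move=> H; apply: (@continuous_comp _ _ _ (fun u => (t, u)) (fun tu : R * 'rV[R]_r => f_x f tu.1 y tu.2)).
  exact: continuous_pairl.
by apply: H; exact: cst_continuous.
Qed.

Lemma gc_smooth_field mu : GC mu -> exists2 C, 0 <= C &
  smooth_field (fun t y => pairing (mu t) (f t y))
    (fun t => pairing (mu t) (f_x f t (xi t))) C.
Proof.
move=> Gmu; have [K cK aeK] := gc_support Gmu; have cs := gc_compactly_supported Gmu.
have [C C0 HC] := f_bounded_along Hf a b cxi cK.
exists C => //; split.
- by move=> y cy; exact: (gc_lmeas Gmu (f_continuous_along cy)).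
- exact: (gc_lmeas Gmu (cont_fx cxi)).
- apply: (aeS2 _ aeK cs) => t tK ct tab; split; apply: pairing_norm_le => //.
  + exact: f_continuous_u.
  + by move=> u /tK[Ku _]; have [] := HC t u tab Ku.
  + exact: f_x_continuous_u.
  + by move=> u /tK[Ku _]; have [] := HC t u tab Ku.
- move=> eta eta0; have [d d0 Hd] := f_linearized_along Hf a b cxi cK eta0.
  exists d => //; apply: (aeS2 _ aeK cs) => t tK ct tab y y' yd y'd.
  have c1 := @f_continuous_u t y; have c2 := @f_continuous_u t y'.
  have c3 : continuous (fun u => (y - y') *m f_x f t (xi t) u).
    by apply: mx_continuousM; [exact: cst_continuous|exact: f_x_continuous_u].
  rewrite -pairing_mull//; last exact: f_x_continuous_u.
  have c12 := mx_continuousB c1 c2.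
  rewrite -(pairingN ct c2) -(pairingD ct c1 (mx_continuousN c2)).
  rewrite -(pairingN ct c3) -(pairingD ct c12 (mx_continuousN c3)).
  apply: (pairing_norm_le ct (mx_continuousB c12 c3)).
  by move=> u /tK[Ku _]; exact: Hd.
Qed.

End fields.

(** * The shooting argument *)

Lemma finite_positive_lower_bound (R : realType) (m : nat) (d : 'I_m -> R) :
  (forall i, 0 < d i) -> exists2 e, 0 < e & forall i, e <= d i.
Proof.
move=> d0; exists (1 + \sum_i (d i)^-1)^-1.
  by rewrite invr_gt0 ltr_pwDl// sumr_ge0// => i _; rewrite invr_ge0 ltW.
move=> i; rewrite -[leRHS]invrK lef_pV2 ?posrE ?invr_gt0//.
  rewrite (bigD1 i)//= addrCA lerDl addr_ge0// sumr_ge0// => j _.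
  by rewrite invr_ge0 ltW.
by rewrite ltr_pwDl// sumr_ge0// => j _; rewrite invr_ge0 ltW.
Qed.

(** Finitely many smallness conditions [c * e <= d] hold together for all small [e]; the constants
    of the later estimates are chosen through such lists. *)
Lemma exists_small (R : realType) (s : seq (R * R)) : (forall ce, ce \in s -> 0 < ce.2) ->
  exists2 e0, 0 < e0 & forall e, 0 <= e -> e < e0 -> forall ce, ce \in s -> ce.1 * e <= ce.2.
Proof.
elim: s => [|[c d] s IH] H; first by exists 1.
have [|e1 e10 He1] := IH; first by move=> ce ces; apply: H; rewrite inE ces orbT.
have d0 : 0 < d by apply: (H (c, d)); rewrite inE eqxx.
have c0 : 0 < `|c| + 1 by rewrite ltr_wpDl.
exists (Num.min e1 (d / (`|c| + 1))); first by rewrite lt_min e10 divr_gt0.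
move=> e e0; rewrite lt_min => /andP[ee1]; rewrite ltr_pdivlMr// => ed ce.
rewrite inE => /predU1P[->/=|]; last exact: He1.
rewrite (le_trans _ (ltW ed))// mulrC ler_wpM2l// (le_trans (ler_norm c))//.
by rewrite lerDl.
Qed.

(** * The nonlinear remainder *)

Section remainder.
Context {R : realType} (n m : nat).
Notation leb := (@lebesgue_measure R).
Variables (a b : R) (xi : R -> 'rV[R]_n) (C B : R).
Variables (F0 : R -> 'rV[R]_n -> 'rV[R]_n) (A0 : R -> 'M[R]_n).
Variables (F : 'I_m -> R -> 'rV[R]_n -> 'rV[R]_n) (A : 'I_m -> R -> 'M[R]_n).
Variables (Phi Psi : R -> 'M[R]_n).
Hypotheses (C0 : 0 <= C) (B0 : 0 <= B) (cxi : continuous xi).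
Hypotheses (HF0 : smooth_field a b xi F0 A0 C).
Hypotheses (HF : forall i, smooth_field a b xi (F i) (A i) C).
Hypotheses (cPhi : continuous Phi) (cPsi : continuous Psi).
Hypotheses (PhiB : forall t, t \in `[a, b] -> `|Phi t| <= B).
Hypotheses (PsiB : forall t, t \in `[a, b] -> `|Psi t| <= B).

Definition dfield i t y := F i t y - F0 t y.

(** In the coordinates [x = xi + w Phi], the velocity of [w] is a part linear in [al], evaluated
    along [xi], plus this term: the linearization error of [F0] and the change of the perturbing
    fields away from [xi], transported by [Psi]. *)
Definition remainder t (w : 'rV[R]_n) (al : 'rV[R]_m) : 'rV[R]_n :=
  (F0 t (xi t + w *m Phi t) - F0 t (xi t) - w *m Phi t *m A0 t +
   \sum_i al 0 i *: (dfield i t (xi t + w *m Phi t) - dfield i t (xi t))) *m Psi t.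

Lemma remainder0 t al : remainder t 0 al = 0.
Proof.
rewrite /remainder !mul0mx addr0 !subrr add0r big1 ?mul0mx// => i _.
by rewrite subrr scaler0.
Qed.

Lemma remainder_lmeas (w : R -> 'rV[R]_n) al : continuous w ->
  forall i j, lmeas (fun t => remainder t (w t) al i j).
Proof.
move=> cw; have cy : continuous (fun t => xi t + w t *m Phi t).
  by apply: mx_continuousD => //; exact: mx_continuousM.
have [mF0 mA0 _ _] := HF0.
apply: lmeas_mulmx; last exact: lmeas_entry_continuous.
move=> i j.
have mwPA : lmeas (fun t => (w t *m Phi t *m A0 t) i j).
  apply: lmeas_mulmx => //; apply: lmeas_entry_continuous; exact: mx_continuousM.
have mdF k y : continuous y -> lmeas (fun t => dfield k t (y t) i j).
  move=> cy'; have [mFk _ _ _] := HF k.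
  have := lmeasB (mFk y cy' i j) (mF0 y cy' i j).
  by apply: lmeas_ae; apply: aeW => t; rewrite !mxE.
have msum : lmeas (fun t => \sum_k al 0 k *
    (dfield k t (xi t + w t *m Phi t) i j - dfield k t (xi t) i j)).
  apply: lmeas_sum => k; apply: lmeasM; first exact: lmeas_cst.
  apply: lmeasB; last exact: mdF.
  exact: (mdF k _ cy).
have := lmeasD (lmeasB (lmeasB (mF0 _ cy i j) (mF0 _ cxi i j)) mwPA) msum.
apply: lmeas_ae; apply: aeW => t.
rewrite [RHS]mxE [in RHS]mxE [in RHS]mxE summxE !mxE.
by congr (_ + _); apply: eq_bigr => k _; rewrite !mxE.
Qed.

Lemma smooth_field_lipschitz (G : R -> 'rV[R]_n -> 'rV[R]_n) (AG : R -> 'M[R]_n) :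
  smooth_field a b xi G AG C -> exists2 d, 0 < d & {ae leb, forall t, t \in `[a, b] ->
    forall y y', `|y - xi t| < d -> `|y' - xi t| < d ->
    `|G t y - G t y'| <= (1 + n%:R * C) * `|y - y'|}.
Proof.
move=> [_ _ GC GL]; have [d d0 Hd] := GL 1 ltr01.
exists d => //; apply: (aeS2 _ GC Hd) => t H1 H2 tab y y' yd y'd.
rewrite -[X in `|X|](subrK ((y - y') *m AG t)) (le_trans (ler_normD _ _))// mulrDl.
rewrite lerD//; first by have := H2 tab y y' yd y'd; rewrite mul1r.
have [_ AC] := H1 tab.
by rewrite (le_trans (mxnorm_mul _ _))// -!mulrA ler_wpM2l// mulrC ler_wpM2r.
Qed.

(** The error of [F0] has a small Lipschitz constant by uniform linearization; the other terms are
    products of a weight and a field increment, and one factor of each product is small. *)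
Lemma remainder_small sigma : 0 < sigma -> exists2 d, 0 < d &
  {ae leb, forall t, t \in `[a, b] -> forall (w w' : 'rV[R]_n) (al al' : 'rV[R]_m),
     `|w| < d -> `|w'| < d -> `|al| < d ->
     `|remainder t w al - remainder t w' al'| <= sigma * (`|w - w'| + `|al - al'|)}.
Proof.
move=> s0.
pose k := n%:R * B; have k0 : 0 <= k by rewrite mulr_ge0.
pose L := 1 + n%:R * C; have L0 : 0 <= L by rewrite addr_ge0// mulr_ge0.
pose eta := sigma / (2 * (k * k + 1)).
have kk0 : 0 < k * k + 1 by rewrite ltr_wpDl// mulr_ge0.
have eta0 : 0 < eta by rewrite divr_gt0// mulr_gt0.
have [_ _ _ /(_ _ eta0)[d1 d10 H1]] := HF0.
have [d2 d20 H2] := smooth_field_lipschitz HF0.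
have [d3 d3P] := choice (fun i => (let: ex_intro2 l x y := smooth_field_lipschitz (HF i) in
  ex_intro (fun l => _ /\ _) l (conj x y))).
have [d4 d40 d4d3] := finite_positive_lower_bound (fun i => (d3P i).1).
have H3 : {ae leb, forall t, forall i, t \in `[a, b] ->
    forall y y', `|y - xi t| < d4 -> `|y' - xi t| < d4 ->
    `|F i t y - F i t y'| <= L * `|y - y'|}.
  apply: ae_forall_countable => i; have [_] := d3P i; apply: aeS => t H tab y y' yd y'd.
  by apply: H => //; exact: lt_le_trans (d4d3 i).
pose M := k * k * (m%:R * (2 * L)); have M0 : 0 <= M by rewrite !mulr_ge0.
have [d5 d50 H5] := @exists_small R [:: (k, d1 / 2); (k, d2 / 2); (k, d4 / 2); (M, sigma / 2)]
  (ltac:(by move=> ce; rewrite !inE => /or4P[] /eqP ->; rewrite /= divr_gt0)).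
pose d := d5 / 2; have d0 : 0 < d by rewrite divr_gt0.
have dd5 : d < d5 by rewrite ltr_pdivrMr// ltr_pMr// ltr1n.
have {}H5 := H5 d (ltW d0) dd5.
have h1 : k * d <= d1 / 2 by apply: (H5 (k, d1 / 2)); rewrite !inE eqxx.
have h2 : k * d <= d2 / 2 by apply: (H5 (k, d2 / 2)); rewrite !inE eqxx ?orbT.
have h4 : k * d <= d4 / 2 by apply: (H5 (k, d4 / 2)); rewrite !inE eqxx ?orbT.
have hM : M * d <= sigma / 2 by apply: (H5 (M, sigma / 2)); rewrite !inE eqxx ?orbT.
exists d => //; apply: (aeS3 _ H1 H2 H3) => t {}H1 {}H2 {}H3 tab w w' al al' wd w'd ald.
have PhiBt := PhiB tab; have PsiBt := PsiB tab.
have zle (x : 'rV[R]_n) : `|x *m Phi t| <= k * `|x|.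
  by rewrite (le_trans (mxnorm_mul _ _))// /k mulrAC ler_wpM2r// ler_wpM2l.
have Psile (x : 'rV[R]_n) : `|x *m Psi t| <= k * `|x|.
  by rewrite (le_trans (mxnorm_mul _ _))// /k mulrAC ler_wpM2r// ler_wpM2l.
set z := w *m Phi t; set z' := w' *m Phi t.
have zkd (x : 'rV[R]_n) : `|x| < d -> `|x *m Phi t| <= k * d.
  by move=> xd; rewrite (le_trans (zle _))// ler_wpM2l// ltW.
have zd := zkd _ wd; have z'd := zkd _ w'd.
have near e x : k * d <= e / 2 -> 0 < e -> `|x| <= k * d -> `|xi t + x - xi t| < e.
  by move=> h e0 xk; rewrite addrC addKr (le_lt_trans xk)//; lra.
have near0 e : 0 < e -> `|xi t - xi t| < e by move=> e0; rewrite subrr normr0.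
have zz' : `|z - z'| <= k * `|w - w'| by rewrite /z /z' -mulmxBl.
have dfL i y y' : `|y - xi t| < d2 -> `|y' - xi t| < d2 -> `|y - xi t| < d4 -> `|y' - xi t| < d4 ->
    `|dfield i t y - dfield i t y'| <= 2 * L * `|y - y'|.
  move=> y2 y'2 y4 y'4; rewrite /dfield opprD addrACA -opprD.
  rewrite (le_trans (ler_normB _ _))// -mulrA mulr_natl mulr2n lerD//.
    exact: H3.
  exact: H2.
(* The difference splits into the linearization error between the two states, the weights [al]
   applied to a difference of fields, and the difference of weights applied to a field increment of
   order [k * d]. *)
pose T1 := F0 t (xi t + z) - F0 t (xi t + z') - (z - z') *m A0 t.
pose T2 := \sum_i al 0 i *: (dfield i t (xi t + z) - dfield i t (xi t + z')).
pose T3 := \sum_i (al - al') 0 i *: (dfield i t (xi t + z') - dfield i t (xi t)).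
have -> : remainder t w al - remainder t w' al' = (T1 + T2 + T3) *m Psi t.
  rewrite /remainder -mulmxBl -/z -/z'; congr (_ *m _).
  rewrite -[T1 + T2 + T3]addrA; have -> : T2 + T3 = \sum_i al 0 i *: (dfield i t (xi t + z) - dfield i t (xi t)) -
     \sum_i al' 0 i *: (dfield i t (xi t + z') - dfield i t (xi t)) :> 'rV_n.
    rewrite /T2 /T3 -big_split/= -sumrB; apply: eq_bigr => i _.
    by apply/matrixP => i' j'; rewrite !mxE; ring.
  rewrite /T1 mulmxBl; set S1 := \sum_i _; set S2 := \sum_i _.
  by apply/matrixP => i' j'; rewrite !mxE; ring.
have T1le : `|T1| <= eta * (k * `|w - w'|).
  rewrite /T1; have -> : z - z' = xi t + z - (xi t + z') by rewrite opprD addrACA subrr add0r.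
  rewrite (le_trans (H1 tab _ _ _ _))//; [exact: near|exact: near|].
  by rewrite opprD addrACA subrr add0r ler_wpM2l// ltW.
have T2le : `|T2| <= m%:R * (d * (2 * L * (k * `|w - w'|))).
  rewrite (le_trans (ler_norm_sum _ _ _))// (le_trans (ler_sum _ (G := fun=> d * (2 * L * (k * `|w - w'|))) _))//; last first.
    by rewrite sumr_const card_ord -[_ *+ m]mulr_natl.
    move=> i _; rewrite normrZ ler_pM//.
      by rewrite ltW// (le_lt_trans _ ald)// mxnorm_entry.
    rewrite (le_trans (dfL _ _ _ (near _ _ h2 d20 zd) (near _ _ h2 d20 z'd) (near _ _ h4 d40 zd) (near _ _ h4 d40 z'd)))//.
    by rewrite opprD addrACA subrr add0r ler_wpM2l// mulr_ge0.
have T3le : `|T3| <= m%:R * (`|al - al'| * (2 * L * (k * d))).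
  rewrite (le_trans (ler_norm_sum _ _ _))// (le_trans (ler_sum _ (G := fun=> `|al - al'| * (2 * L * (k * d))) _))//; last first.
    by rewrite sumr_const card_ord -[_ *+ m]mulr_natl.
    move=> i _; rewrite normrZ ler_pM// ?mxnorm_entry//.
    rewrite (le_trans (dfL _ _ _ (near _ _ h2 d20 z'd) (near0 _ d20) (near _ _ h4 d40 z'd) (near0 _ d40)))//.
    by rewrite addrC addKr ler_wpM2l// mulr_ge0.
rewrite (le_trans (Psile _))//.
have Tle : `|T1 + T2 + T3| <= eta * (k * `|w - w'|) + m%:R * (d * (2 * L * (k * `|w - w'|))) +
    m%:R * (`|al - al'| * (2 * L * (k * d))).
  by rewrite (le_trans (ler_normD _ _))// lerD// (le_trans (ler_normD _ _))// lerD.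
rewrite (le_trans (ler_wpM2l k0 Tle))//.
have -> : k * (eta * (k * `|w - w'|) + m%:R * (d * (2 * L * (k * `|w - w'|))) +
    m%:R * (`|al - al'| * (2 * L * (k * d)))) =
    (k * k * eta + M * d) * `|w - w'| + M * d * `|al - al'| by rewrite /M; ring.
have keta : k * k * eta <= sigma / 2.
  rewrite /eta (_ : k * k * _ = (sigma / 2) * (k * k / (k * k + 1))); last by field; rewrite gt_eqF.
  rewrite ler_piMr//; first lra.
  by rewrite ler_pdivrMr// mul1r lerDl.
rewrite mulrDr lerD// ler_wpM2r//; lra.
Qed.

End remainder.

(** * Steering the endpoint by a contraction *)

Section shooting.
Context {R : realType} (n m : nat).
Notation leb := (@lebesgue_measure R).
Variables (a b : R) (k Y : R -> 'M[R]_(m, n)) (P : 'M[R]_(n, m)) (mu Ck CY : R).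
Variables (rem : R -> 'rV[R]_n -> 'rV[R]_m -> 'rV[R]_n).
Hypotheses (ab : a < b) (Ck0 : 0 <= Ck) (CY0 : 0 <= CY) (mu0 : 0 < mu).
Hypotheses (mk : forall i j, lmeas (fun t => k t i j)).
Hypotheses (kC : {ae leb, forall t, t \in `[a, b] -> `|k t| <= Ck}).
Hypotheses (YP : primitive_on a b k Y) (Ya : Y a = 0).
Hypotheses (YC : forall t, a <= t -> t <= b -> `|Y t| <= CY).
Hypotheses (PY : P *m Y b = 1%:M).
Hypotheses (rem0 : forall t al, rem t 0 al = 0).
Hypotheses (mrem : forall w al, continuous w -> forall i j, lmeas (fun t => rem t (w t) al i j)).
Let len := b - a.
Let p : R := n%:R * `|P|.
(** Weight of the endpoint component in the fixed-point norm, small enough that the linear effect of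
    a unit correction on the trajectory is at most 1/4. *)
Let kappa := (4 * (m%:R * p * CY + 1))^-1.
Let v := (const_mx mu : 'rV[R]_m) *m Y b.

Section fixed_parameters.
Variables (sigma delta eta0 eps : R) (d : 'rV[R]_n).
Hypotheses (sigma0 : 0 < sigma) (delta0 : 0 < delta) (eta00 : 0 <= eta0) (eps0 : 0 < eps).
Hypotheses (rem_small : {ae leb, forall t, t \in `[a, b] ->
  forall (w w' : 'rV[R]_n) (al al' : 'rV[R]_m),
     `|w| < delta -> `|w'| < delta -> `|al| < delta -> `|al'| < delta ->
     `|rem t w al - rem t w' al'| <= sigma * (`|w - w'| + `|al - al'|)}).
Let tau := b - eps.
(** [c * eps] bounds the endpoint residual of the starting guess: the tolerance [eta0] on the
    target, the shift from [b] to [tau], and the nonlinear part [s1]. Division by [kappa] turns it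
    into the weighted distance [D0]. *)
Let s1 := len * sigma * (m%:R * mu * CY).
Let c := eta0 + m%:R * mu * Ck * eps + s1.
Let D0 := c * eps / kappa.
Let al0 : 'rV[R]_m := const_mx (eps * mu).
Hypotheses (epsb : eps < b - a) (dv : `|d - eps *: v| <= eta0 * eps).
(** [Hs] and [He] make the map a contraction, [Hw] and [Hd] keep states and weights where the
    remainder is small, and [Hal] keeps the weights between 0 and [2 * mu * eps]. *)
Hypotheses (Hs : sigma * len * (1 + p * kappa) <= kappa / 4).
Hypotheses (He : m%:R * p * Ck * eps <= 1 / 4).
Hypotheses (Hw : m%:R * (eps * mu) * CY + 2 * D0 < delta).
Hypotheses (Hal : p * (2 * c) <= mu) (Hd : 2 * mu * eps < delta).

(** Once the exact linear response [(al - al') *m Y t] is subtracted, only the remainder drives the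
    difference. *)
Lemma primitive_difference (w w' : R -> 'rV[R]_n) (al al' : 'rV[R]_m) (X X' : R -> 'rV[R]_n) D :
  (forall t, `|w t| < delta) -> (forall t, `|w' t| < delta) ->
  `|al| < delta -> `|al'| < delta -> (forall t, `|w t - w' t| <= D) ->
  primitive_on a b (fun t => al *m k t + rem t (w t) al) X -> X a = 0 ->
  primitive_on a b (fun t => al' *m k t + rem t (w' t) al') X' -> X' a = 0 ->
  forall t, a <= t -> t <= b ->
    `|X t - X' t - (al - al') *m Y t| <= len * (sigma * (D + `|al - al'|)).
Proof.
move=> wd w'd ald al'd wD HX Xa HX' X'a t at_ tb.
have D00 : 0 <= D by exact: le_trans (normr_ge0 _) (wD a).
have HY := primitive_on_mulmx (primitive_on_cst a b (al - al')) YP.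
have := primitive_onD (primitive_onD HX (primitive_onN HX')) (primitive_onN HY).
move=> /(@primitive_on_ae _ _ _ _ _ _ (fun t => rem t (w t) al - rem t (w' t) al')) H.
have {}H := H (ltac:(by apply: aeW => s _; rewrite mul0mx add0r mulmxBl;
  apply/matrixP => i j; rewrite !mxE; ring)).
have HL : lip_on a b (sigma * (D + `|al - al'|))
    (fun t => X t - X' t - (al - al') *m Y t).
  apply: (primitive_on_dominated H).
  apply: (aeS _ rem_small) => s Hs' sab; apply: (le_trans (Hs' sab _ _ _ _ _ _ _ _)) => //.
  by rewrite ler_wpM2l ?(ltW sigma0)// lerD2r.
have := HL a t (lexx _) at_ tb; rewrite Xa X'a Ya mulmx0 !subr0 => /le_trans; apply.
by rewrite mulrC ler_wpM2r ?lerD2r// mulr_ge0 ?(ltW sigma0)// addr_ge0.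
Qed.

(* An unknown [u] of the shooting problem is a trajectory [u (Some _)] together with
   a correction [u None] of the mixing weights that steers the endpoint to [d]. *)
Definition parameter (u : option R -> 'rV[R]_n) : 'rV[R]_m := al0 + u None *m P.

(** The last clause is a Newton step with an approximate derivative: [u None] is changed by the
    endpoint error, and since [P *m Y b = 1%:M] a change of [u None] moves the linear endpoint at
    [b] by exactly that amount. A fixed point satisfies [u (Some tau) = d]. *)
Definition shoot (u u' : option R -> 'rV[R]_n) := [/\ u' (Some a) = 0,
  forall t, u' (Some t) = u' (Some (clamp a b t)),
  primitive_on a b (fun t => parameter u *m k t + rem t (u (Some t)) (parameter u))
    (fun t => u' (Some t))
  & u' None = u None + d - u' (Some tau)].

Definition weight (i : option R) : R := if i is Some _ then 1 else kappa.

(** The linear response to equal weights [eps * mu]; its value at [b] is [eps *: v]. *)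
Definition start (i : option R) : 'rV[R]_n :=
  if i is Some t then al0 *m Y (clamp a b t) else 0.

Let CL := m%:R * delta * Ck + sigma * delta.

(** The Lipschitz clause makes each member continuous, hence the remainder along it measurable, and
    it survives pointwise limits. *)
Definition tube : set (option R -> 'rV[R]_n) := [set u |
  (forall i, `|u i - start i| <= 2 * D0 * weight i) /\
  lipschitz_with CL (fun t => u (Some t))].

Lemma p_ge0 : 0 <= p. Proof. by rewrite mulr_ge0. Qed.

Lemma kappa_gt0 : 0 < kappa.
Proof. by rewrite invr_gt0 mulr_gt0// ltr_wpDl// !mulr_ge0 ?p_ge0. Qed.

Lemma kappa_small : m%:R * p * kappa * CY <= 1 / 4.
Proof.
have q0 : 0 <= m%:R * p * CY by rewrite !mulr_ge0 ?p_ge0.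
rewrite (_ : _ * CY = m%:R * p * CY * kappa); last by ring.
rewrite /kappa ler_pdivrMr; last lra.
lra.
Qed.

Lemma kappa_le : kappa <= 1 / 4.
Proof.
have q0 : 0 <= m%:R * p * CY by rewrite !mulr_ge0 ?p_ge0.
rewrite /kappa -[leLHS]mul1r ler_pdivrMr; last lra.
lra.
Qed.

Lemma len_gt0 : 0 < len. Proof. by rewrite subr_gt0. Qed.

Lemma s1_ge0 : 0 <= s1.
Proof. by rewrite !mulr_ge0// ltW// ?len_gt0. Qed.

Lemma c_ge0 : 0 <= c.
Proof. by rewrite !addr_ge0 ?s1_ge0// !mulr_ge0// ltW. Qed.

Lemma D0_ge0 : 0 <= D0.
Proof. by rewrite divr_ge0 ?mulr_ge0 ?c_ge0// ltW// kappa_gt0. Qed.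

Lemma norm_al0 : `|al0| <= eps * mu.
Proof.
have h : 0 <= eps * mu by rewrite mulr_ge0// ltW.
by apply: mxnorm_le => // i j; rewrite mxE ger0_norm.
Qed.

Lemma mulP_le (x : 'rV[R]_n) : `|x *m P| <= p * `|x|.
Proof. by rewrite (le_trans (mxnorm_mul _ _))// /p mulrAC. Qed.

Lemma mulY_le (x : 'rV[R]_m) t : a <= t -> t <= b -> `|x *m Y t| <= m%:R * `|x| * CY.
Proof. by move=> at_ tb; rewrite (le_trans (mxnorm_mul _ _))// ler_wpM2l ?mulr_ge0 ?YC. Qed.

Lemma Y_lip : lip_on a b Ck Y.
Proof. exact: primitive_on_dominated YP kC. Qed.

Lemma tau_ge : a <= tau. Proof. by rewrite lerBrDr -lerBrDl ltW. Qed.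

Lemma tau_le : tau <= b. Proof. by rewrite gerBl ltW. Qed.

Lemma Y_tau : `|Y b - Y tau| <= Ck * eps.
Proof. by have := Y_lip tau_ge tau_le (lexx b); rewrite {2}/tau opprB addrCA subrr addr0. Qed.

Lemma start_le t : `|start (Some t)| <= m%:R * (eps * mu) * CY.
Proof.
rewrite /start (le_trans (mulY_le _ (clamp_ge _ _ _) (clamp_le (ltW ab) _)))//.
by rewrite ler_wpM2r// ler_wpM2l// norm_al0.
Qed.

Lemma tube_state u t : tube u -> `|u (Some t)| < delta.
Proof.
move=> [ut _]; apply: le_lt_trans Hw; rewrite -[u _](subrK (start (Some t))) addrC.
by rewrite (le_trans (ler_normD _ _))// lerD ?start_le//; have := ut (Some t); rewrite mulr1.
Qed.

(** By [Hal] the correction never exceeds the base weight [eps * mu], so no mixing weight becomes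
    negative. *)
Lemma tube_shift u : tube u -> `|u None *m P| <= eps * mu.
Proof.
move=> [/(_ None) + _]; rewrite /start subr0 /= => uN.
rewrite (le_trans (mulP_le _))// (le_trans (ler_wpM2l p_ge0 uN))//.
rewrite (_ : p * _ = p * (2 * c) * eps).
  by rewrite mulrC ler_wpM2l// ltW.
by rewrite /D0; field; rewrite gt_eqF// kappa_gt0.
Qed.

Lemma tube_parameter u : tube u -> `|parameter u| < delta.
Proof.
move=> uS; apply: le_lt_trans Hd; rewrite (le_trans (ler_normD _ _))//.
have := tube_shift uS; have := norm_al0; lra.
Qed.

Lemma tube_continuous u : tube u -> continuous (fun t => u (Some t)).
Proof. by move=> [_ /lipschitz_with_continuous]. Qed.

Lemma CL_ge0 : 0 <= CL.
Proof. by rewrite addr_ge0 ?mulr_ge0 ?(ltW delta0) ?(ltW sigma0). Qed.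

Lemma shoot_slope_le u : tube u -> {ae leb, forall t, t \in `[a, b] ->
  `|parameter u *m k t + rem t (u (Some t)) (parameter u)| <= CL}.
Proof.
move=> uS; apply: (aeS2 _ kC rem_small) => t Hk Hr tab.
have up := tube_parameter uS; have us := tube_state t uS.
rewrite (le_trans (ler_normD _ _))// lerD//.
  by rewrite (le_trans (mxnorm_mul _ _))// ler_pM ?mulr_ge0 ?Hk// ler_wpM2l// ltW.
have := Hr tab (u (Some t)) 0 (parameter u) (parameter u) us _ up up.
rewrite rem0 !subr0 subrr !normr0 addr0 => /(_ delta0) /le_trans; apply.
by rewrite ler_wpM2l ?ltW.
Qed.

Lemma shoot_exists u : tube u -> exists2 u', shoot u u' & lipschitz_with CL (fun t => u' (Some t)).
Proof.
move=> uS; have cu := tube_continuous uS.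
have [|X [Xa lX cX HX]] := clamped_primitive (ltW ab) CL_ge0 _ (shoot_slope_le uS).
  move=> i j; have mp : lmeas (fun t => (parameter u *m k t) i j).
    by apply: lmeas_mulmx => // i' j'; exact: lmeas_cst.
  have := lmeasD mp (mrem (parameter u) cu i j).
  by apply: lmeas_ae; apply: aeW => t; rewrite [RHS]mxE.
by exists (fun i => if i is Some t then X t else u None + d - X tau).
Qed.

Lemma shoot_contracts u u1 u' u1' D : tube u -> tube u1 -> shoot u u' -> shoot u1 u1' ->
  0 <= D -> (forall i, `|u i - u1 i| <= D * weight i) ->
  forall i, `|u' i - u1' i| <= D / 2 * weight i.
Proof.
move=> uS u1S [u'a u'c u'P u'N] [u1'a u1'c u1'P u1'N] D1 uD.
pose db := u None - u1 None; have dbD : `|db| <= D * kappa by exact: (uD None).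
have dal : parameter u - parameter u1 = db *m P by rewrite /parameter opprD addrACA subrr add0r mulmxBl.
have dalD : `|db *m P| <= p * (D * kappa).
  by rewrite (le_trans (mulP_le _))// ler_wpM2l ?p_ge0.
have E t : a <= t -> t <= b -> `|u' (Some t) - u1' (Some t) - db *m P *m Y t| <= D * (kappa / 4).
  move=> at_ tb; have := primitive_difference (fun t => tube_state t uS)
    (fun t => tube_state t u1S) (tube_parameter uS) (tube_parameter u1S)
    (D := D) _ u'P u'a u1'P u1'a at_ tb; rewrite dal => /(_ _)/le_trans; apply.
    by move=> s; have := uD (Some s); rewrite mulr1.
  apply: le_trans (ler_wpM2l D1 Hs).
  rewrite (_ : D * _ = len * (sigma * (D + p * (D * kappa)))); last by ring.
  by rewrite ler_wpM2l ?(ltW len_gt0)// ler_wpM2l ?(ltW sigma0)// lerD2l.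
have ks := kappa_small; have kl := kappa_le; have k0 := kappa_gt0.
case=> [t|] /=.
  rewrite mulr1 u'c u1'c; set s := clamp a b t.
  have sa : a <= s by exact: clamp_ge.
  have sb : s <= b by exact: clamp_le (ltW ab) _.
  rewrite -[_ - _](subrK (db *m P *m Y s)) (le_trans (ler_normD _ _))//.
  have h1 := E s sa sb.
  have h2 : `|db *m P *m Y s| <= D * (1 / 4).
    apply: le_trans (ler_wpM2l D1 ks); apply: le_trans (mulY_le _ sa sb) _.
    rewrite (_ : D * _ = m%:R * (p * (D * kappa)) * CY); last by ring.
    by rewrite ler_wpM2r// ler_wpM2l.
  have h3 : D * (kappa / 4) <= D * (1 / 4) by rewrite ler_wpM2l//; lra.
  lra.
rewrite u'N u1'N.
(* The change of [u None] cancels its linear effect at [b] because [P *m Y b = 1%:M]; what is left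
   comes from stopping at [tau] instead of [b] and from the remainder. *)
have -> : u None + d - u' (Some tau) - (u1 None + d - u1' (Some tau)) =
   db *m P *m (Y b - Y tau) - (u' (Some tau) - u1' (Some tau) - db *m P *m Y tau).
  rewrite mulmxBr -[db *m P *m Y b]mulmxA PY mulmx1 /db.
  by apply/matrixP => i j; rewrite !mxE; ring.
rewrite (le_trans (ler_normB _ _))//.
have h1 := E tau tau_ge tau_le.
have h2 : `|db *m P *m (Y b - Y tau)| <= D * kappa * (1 / 4).
  apply: le_trans (mxnorm_mul _ _) _.
  have : D * kappa * (m%:R * p * Ck * eps) <= D * kappa * (1 / 4).
    by rewrite ler_wpM2l// mulr_ge0// ltW.
  apply: le_trans.
  rewrite (_ : D * _ * _ = m%:R * (p * (D * kappa)) * (Ck * eps)); last by ring.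
  rewrite ler_pM ?mulr_ge0//; first by rewrite ler_wpM2l.
  exact: Y_tau.
lra.
Qed.

Lemma shoot_start u : shoot start u -> forall i, `|u i - start i| <= D0 * weight i.
Proof.
move=> [ua uc uP uN].
have p0 : parameter start = al0 by rewrite /parameter mul0mx addr0.
have al0d : `|al0| < delta.
  by apply: le_lt_trans Hd; apply: le_trans norm_al0 _; have := mulr_gt0 eps0 mu0; lra.
have k0 := kappa_gt0; have s10 := s1_ge0; have cc0 := c_ge0.
have cs : forall t, `|start (Some t)| < delta.
  by move=> t; apply: le_lt_trans (start_le t) _; apply: le_lt_trans Hw; have := D0_ge0; lra.
have E t : a <= t -> t <= b -> `|u (Some t) - al0 *m Y t| <= s1 * eps.
  move=> at_ tb.
  have HY : primitive_on a b (fun t => al0 *m k t + rem t 0 al0) (fun t => al0 *m Y t).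
    apply: primitive_on_ae (primitive_on_mulmx (primitive_on_cst a b al0) YP).
    by apply: aeW => s _; rewrite rem0 mul0mx add0r addr0.
  have := @primitive_difference (fun t => start (Some t)) (fun=> 0) al0 al0 (fun t => u (Some t)) _
    (m%:R * (eps * mu) * CY) cs _ al0d al0d _ _ ua HY _ t at_ tb.
  rewrite subrr mul0mx subr0 !normr0 addr0 => H.
  apply: le_trans (H _ _ _ _) _ => //.
  - by move=> s; rewrite subr0 start_le.
  - by move: uP; rewrite p0.
  - by rewrite Ya mulmx0.
  by rewrite /s1 le_eqVlt; apply/orP; left; apply/eqP; ring.
have D0k : D0 * kappa = c * eps by rewrite /D0 mulfVK// gt_eqF.
case=> [t|] /=.
  rewrite mulr1 uc (le_trans (E _ (clamp_ge _ _ _) (clamp_le (ltW ab) _)))//.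
  have h1 : s1 * eps <= c * eps.
    rewrite ler_wpM2r ?(ltW eps0)// /c lerDr addr_ge0// !mulr_ge0// ltW//.
  rewrite (le_trans h1)// -D0k ler_piMr ?D0_ge0//.
  by have := kappa_le; lra.
rewrite uN D0k subr0 add0r.
(* The three parts are bounded by the three summands of [c]: target error, shift of time,
   remainder. *)
have -> : d - u (Some tau) = (d - eps *: v) + al0 *m (Y b - Y tau) - (u (Some tau) - al0 *m Y tau).
  have -> : eps *: v = al0 *m Y b.
    rewrite /v /al0 scalemxAl; congr (_ *m _); by apply/matrixP => i j; rewrite !mxE.
  rewrite mulmxBr; by apply/matrixP => i j; rewrite !mxE; ring.
rewrite (le_trans (ler_normB _ _))// /c 2!mulrDl lerD ?E ?tau_ge ?tau_le//.
rewrite (le_trans (ler_normD _ _))// lerD// (le_trans (mxnorm_mul _ _))//.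
have hY := Y_tau.
rewrite (_ : _ * eps * eps = m%:R * (eps * mu) * (Ck * eps)); last by ring.
by rewrite ler_pM// ?mulr_ge0// ler_wpM2l// norm_al0.
Qed.

Lemma wt_ge0 i : 0 <= weight i.
Proof. by case: i => //=; exact: ltW kappa_gt0. Qed.

Lemma start_tube : tube start.
Proof.
split=> [i|]; first by rewrite subrr normr0 (mulr_ge0 (mulr_ge0 _ D0_ge0) (wt_ge0 i)).
apply: (@lipschitz_with_clamp _ _ _ CL a b (fun t => al0 *m Y t) (ltW ab) CL_ge0).
move=> s t as_ st tb; rewrite -mulmxBr (le_trans (mxnorm_mul _ _))//.
have al0d : `|al0| <= delta.
  apply: le_trans norm_al0 _; have := mulr_gt0 eps0 mu0; move: Hd; lra.
have h : m%:R * `|al0| <= m%:R * delta by rewrite ler_wpM2l.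
apply: le_trans (ler_pM _ _ h (Y_lip as_ st tb)) _; rewrite ?mulr_ge0//.
by rewrite mulrA ler_wpM2r ?subr_ge0// /CL lerDl mulr_ge0 ?ltW.
Qed.

Lemma shooting_solution : exists (w : R -> 'rV[R]_n) (al : 'rV[R]_m), [/\ forall i, 0 <= al 0 i <= 2 * mu * eps,
  exists C, lipschitz_with C w,
  primitive_on a b (fun t => al *m k t + rem t (w t) al) w,
  w a = 0 & w tau = d].
Proof.
have wt0 := wt_ge0.
have [u [uS [ua uc uP uN]]] : exists u, tube u /\ shoot u u.
  apply: (@weighted_fixed_point R (option R) 1 n weight tube shoot start D0) => //.
  - exact: start_tube.
  - exact: D0_ge0.
  - move=> u uS; have [u' su lu'] := shoot_exists uS; exists u' => //; split => // i.
    have [u0' su0 _] := shoot_exists start_tube.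
    (* The image of [u] is within [D0] of the image of [start], and that one is within [D0] of
       [start]; hence the radius [2 * D0] of the tube. *)
    rewrite -[_ - _](subrKA (u0' i)) (le_trans (ler_normD _ _))//.
    rewrite (_ : 2 * D0 * _ = 2 * D0 / 2 * weight i + D0 * weight i); last by field.
    rewrite lerD ?(shoot_start su0)//.
    apply: (shoot_contracts uS start_tube su su0) => //; first by rewrite mulr_ge0 ?D0_ge0.
    by case: uS.
  - move=> w u wS wu; split=> [i|].
      by apply: (norm_cvg_le (wu i)) => l; case: (wS l).
    by apply: (@lipschitz_with_lim _ _ _ CL (fun l t => w l (Some t))) => [l|t]; [case: (wS l)|exact: wu].
  - by move=> u v0 u' v' D uS vS uu' vv' D1; exact: shoot_contracts uS vS uu' vv' D1.
  - exact: shoot_start.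
exists (fun t => u (Some t)), (parameter u); split => //.
- move=> i; rewrite /parameter !mxE.
  have := mxnorm_entry (u None *m P) 0 i => /le_trans /(_ (tube_shift uS)).
  rewrite mxE ler_norml => /andP[]; lra.
- by exists CL; case: uS.
- by move/eqP: uN; rewrite -addrA -subr_eq0 opprD addrA subrr add0r oppr_eq0 subr_eq0 => /eqP.
Qed.

End fixed_parameters.

(** Order of the constants: [sigma] comes first, small enough for the contraction and for the
    nonlinear part of [Hal]; it determines [delta]; [eta0] depends on [mu] and [p] alone; the bound
    on [eps] comes last. *)
Lemma perturbed_hit (r0 : R) : 0 < r0 ->
  (forall sigma : R, 0 < sigma -> exists2 d, 0 < d & {ae leb, forall t, t \in `[a, b] ->
    forall (w w' : 'rV[R]_n) (al al' : 'rV[R]_m),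
     `|w| < d -> `|w'| < d -> `|al| < d -> `|al'| < d ->
     `|rem t w al - rem t w' al'| <= sigma * (`|w - w'| + `|al - al'|)}) ->
  exists eta0 eps0 : R, [/\ 0 < eta0, 0 < eps0 & forall (eps : R) (d : 'rV[R]_n), 0 < eps -> eps < eps0 ->
    `|d - eps *: v| <= eta0 * eps ->
    exists (w : R -> 'rV[R]_n) (al : 'rV[R]_m), [/\ forall i, 0 <= al 0 i <= r0,
      exists C, lipschitz_with C w,
      primitive_on a b (fun t => al *m k t + rem t (w t) al) w,
      w a = 0 & w (b - eps) = d]].
Proof.
move=> r00 Hrem.
have p0 := p_ge0; have k0 := kappa_gt0; have l0 := len_gt0.
have M0 : 0 <= m%:R * mu * CY by rewrite !mulr_ge0// ltW.
have N0 : 0 <= m%:R * mu * Ck by rewrite !mulr_ge0// ltW.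
have kp0 : 0 <= p * kappa by rewrite mulr_ge0// ltW.
have [s2 s20 Hs2] := @exists_small R [:: (len * (1 + p * kappa), kappa / 4);
  (p * (2 * (len * (m%:R * mu * CY))), mu / 3)] (ltac:(by move=> ce; rewrite !inE => /orP[] /eqP ->; rewrite /= divr_gt0)).
pose sigma := s2 / 2.
have sg0 : 0 < sigma by rewrite divr_gt0.
have sg2 : sigma < s2 by rewrite ltr_pdivrMr// ltr_pMr// ltr1n.
have {}Hs2 := Hs2 _ (ltW sg0) sg2.
have h1 : len * (1 + p * kappa) * sigma <= kappa / 4 by apply: (Hs2 (_, _)); rewrite !inE eqxx.
have h2 : p * (2 * (len * (m%:R * mu * CY))) * sigma <= mu / 3 by apply: (Hs2 (_, _)); rewrite !inE eqxx ?orbT.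
have [delta delta0 Hdelta] := Hrem _ sg0.
(* Each of the three summands of [p * (2 * c)] in [Hal] is allotted a third of [mu]. *)
pose eta0 := mu / (6 * (p + 1)).
have pp0 : 0 < 6 * (p + 1) by rewrite mulr_gt0// ltr_wpDl.
have eta00 : 0 < eta0 by rewrite divr_gt0.
have h3 : p * (2 * eta0) <= mu / 3.
  rewrite /eta0 (_ : p * _ = (mu / 3) * (p / (p + 1))); last by field; rewrite gt_eqF// ltr_wpDl.
  by rewrite ler_piMr ?divr_ge0 ?(ltW mu0)// ler_pdivrMr ?ltr_wpDl// mul1r lerDl.
pose s1 := len * sigma * (m%:R * mu * CY).
(* An upper bound, free of [eps], for the [c] of the fixed-point problem; it is valid since
   [eps <= 1]. *)
pose c := eta0 + m%:R * mu * Ck + s1.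
have [e1 e10 He1] := @exists_small R [:: (1, 1); (1, (b - a) / 2);
  (p * (2 * (m%:R * mu * Ck)), mu / 3); (m%:R * p * Ck, 1 / 4);
  (m%:R * mu * CY + 2 * (c / kappa), delta / 2); (2 * mu, delta / 2); (2 * mu, r0)]
  (ltac:(by move=> ce; rewrite !inE => /or4P[/eqP->|/eqP->|/eqP->|/or4P[] /eqP ->];
     rewrite /= ?divr_gt0 ?subr_gt0)).
exists eta0, e1; split => // eps d e0 ee1 Hd.
have {}He1 := He1 _ (ltW e0) ee1.
have g1 : 1 * eps <= 1 by apply: (He1 (_, _)); rewrite !inE eqxx ?orbT.
have g2 : 1 * eps <= (b - a) / 2 by apply: (He1 (_, _)); rewrite !inE eqxx ?orbT.
have g3 : p * (2 * (m%:R * mu * Ck)) * eps <= mu / 3 by apply: (He1 (_, _)); rewrite !inE eqxx ?orbT.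
have g4 : m%:R * p * Ck * eps <= 1 / 4 by apply: (He1 (_, _)); rewrite !inE eqxx ?orbT.
have g5 : (m%:R * mu * CY + 2 * (c / kappa)) * eps <= delta / 2 by apply: (He1 (_, _)); rewrite !inE eqxx ?orbT.
have g6 : 2 * mu * eps <= delta / 2 by apply: (He1 (_, _)); rewrite !inE eqxx ?orbT.
have g7 : 2 * mu * eps <= r0 by apply: (He1 (_, _)); rewrite !inE eqxx ?orbT.
rewrite mul1r in g1 g2.
have [||||||w [al [wal lw Pw wa wt]]] := @shooting_solution sigma delta eta0 eps d sg0 delta0 (ltW eta00) e0 Hdelta _ Hd.
- by rewrite -/len; move: l0; rewrite /len in g2 *; lra.
- by rewrite [X in X * _]mulrC mulrAC.
- exact: g4.
- have ce : (eta0 + m%:R * mu * Ck * eps + len * sigma * (m%:R * mu * CY)) * eps / kappa <= c / kappa * eps.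
    have ki0 : 0 <= kappa^-1 by rewrite invr_ge0 ltW.
    rewrite mulrAC ler_wpM2r ?(ltW e0)// ler_wpM2r//.
    by rewrite /c lerD2r lerD2l ler_piMr.
  apply: (@le_lt_trans _ _ (delta / 2)); last lra.
  apply: le_trans g5; move: ce; set X := (_ + _) * eps / kappa; set c' := c / kappa => ce; nra.
- rewrite (_ : p * _ = p * (2 * eta0) + p * (2 * (m%:R * mu * Ck)) * eps +
    p * (2 * (len * (m%:R * mu * CY))) * sigma); last by ring.
  lra.
- lra.
by exists w, al; split => // i; have /andP[al1 al2] := wal i; rewrite al1 (le_trans al2).
Qed.

End shooting.

(** * Convex cones *)

Section convex_cones.
Context {R : realType} (n : nat).
Implicit Types (x y g : 'rV[R]_n).

(** The squared Euclidean distance: the norm of row vectors is the sup norm, which provides no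
    orthogonal projection. *)
Definition sqdist (y x : 'rV[R]_n) : R := ((x - y) *m (x - y)^T) 0 0.

Lemma sqdistE y x : sqdist y x = \sum_i (x 0 i - y 0 i) ^+ 2.
Proof. by rewrite /sqdist mxE; apply: eq_bigr => i _; rewrite !mxE expr2. Qed.

Lemma sqdist_continuous y : continuous (sqdist y).
Proof.
rewrite (_ : sqdist y = fun x => \sum_i (x 0 i - y 0 i) ^+ 2); last first.
  by apply/funext => x; exact: sqdistE.
apply: continuous_sum_seq => i x; under eq_fun do rewrite expr2.
have h : {for x, continuous (fun x : 'rV[R]_n => x 0 i - y 0 i)}.
  by apply: continuousB; [exact: coord_continuous|exact: cst_continuous].
exact: (continuousM h h).
Qed.

Lemma sqdist_bound y x M : 0 <= M -> sqdist y x <= M -> `|x| <= `|y| + (M + 1).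
Proof.
move=> M0 xM; rewrite -{1}[x](subrK y) addrC (le_trans (ler_normD _ _))// lerD2l.
apply: mxnorm_le => [|i j]; first lra.
have : (x 0 j - y 0 j) ^+ 2 <= M.
  by apply: le_trans xM; rewrite sqdistE (bigD1 j)//= lerDl sumr_ge0// => k _; exact: sqr_ge0.
rewrite ord1 !mxE -(real_normK (num_real (_ - _))); set h := `|_| => h1.
have h0 : 0 <= h by exact: normr_ge0.
by nra.
Qed.

Lemma sqdist_shift y x d t :
  sqdist y (x + t *: d) = sqdist y x + 2 * t * (d *m (x - y)^T) 0 0 + t ^+ 2 * sqdist 0 d.
Proof.
rewrite !sqdistE mxE !mulr_sumr -!big_split/=; apply: eq_bigr => i _.
by rewrite !mxE; ring.
Qed.

Variable D : set 'rV[R]_n.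
Hypotheses (D0 : D 0) (DD : forall x y, D x -> D y -> D (x + y)).
Hypothesis DZ : forall s x, 0 <= s -> D x -> D (s *: x).

Lemma closure_coneD x d : closure D x -> D d -> closure D (x + d).
Proof.
move=> Dx Dd B /nbhs_ballP[e /= e0 eB].
have [z [Dz xz]] := Dx _ (nbhsx_ballx x e e0).
exists (z + d); split; first exact: DD.
apply: eB; move: xz; rewrite -!ball_normE/= /ball_/=.
by rewrite opprD addrACA subrr addr0.
Qed.

(** [q] points from the nearest point [c] of the closure towards [y]: moving from [c] along a
    direction of the cone cannot shorten the distance. The minimum exists because it may be sought
    among the points no farther from [y] than 0, a compact set. *)
Lemma nonclosure_separation y : ~ closure D y ->
  exists q : 'cV[R]_n, q != 0 /\ forall d, D d -> (d *m q) 0 0 <= 0.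
Proof.
move=> yD; have sq0 x : 0 <= sqdist y x.
  by rewrite sqdistE sumr_ge0// => i _; exact: sqr_ge0.
pose A := closure D `&` [set x | sqdist y x <= sqdist y 0].
have cA : compact A.
  apply: bounded_closed_compact.
    exists (`|y| + (sqdist y 0 + 1)); split; first exact: num_real.
    by move=> M yM x [_ /(sqdist_bound (sq0 0))] h; exact: le_trans h (ltW yM).
  apply: closedI; first exact: closed_closure.
  have -> : [set x | sqdist y x <= sqdist y 0] = sqdist y @^-1` [set s | s <= sqdist y 0] by [].
  by apply: preimage_closed; [move=> x _; exact: sqdist_continuous|exact: closed_le].
have [||c] := EVT_min_rV _ cA (f := sqdist y).
- by exists 0; split=> /=; [exact: subset_closure|].
- by apply: continuous_subspaceT; exact: sqdist_continuous.
rewrite inE => -[cD c0] cmin.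
have {}cmin x : closure D x -> sqdist y c <= sqdist y x.
  move=> xD; have [h|/ltW h] := leP (sqdist y x) (sqdist y 0).
    by apply: cmin; rewrite inE; split.
  exact: le_trans h.
exists (- (c - y)^T); split.
  rewrite oppr_eq0 -trmx0; apply/eqP => /trmx_inj /eqP; rewrite subr_eq0 => /eqP yc.
  by apply: yD; rewrite -yc.
move=> d Dd; rewrite mulmxN mxE oppr_le0 leNgt; apply/negP => h.
set k := (d *m _) 0 0 in h.
pose s := sqdist 0 d.
have s0 : 0 <= s by rewrite /s sqdistE sumr_ge0// => i _; exact: sqr_ge0.
(* A step for which the quadratic cost [t ^+ 2 * s] stays below the linear gain [- 2 * t * k]. *)
pose t := - k / (s + 1); have s1 : 0 < s + 1 by rewrite ltr_wpDl.
have t0 : 0 < t by rewrite divr_gt0// oppr_gt0.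
have := cmin (c + t *: d) (closure_coneD cD (DZ (ltW t0) Dd)).
rewrite sqdist_shift -/k -/s -addrA lerDl.
have -> : 2 * t * k + t ^+ 2 * s = t * (2 * k + t * s) by ring.
rewrite pmulr_rge0//.
have : t * s <= - k.
  rewrite /t mulrAC ler_pdivrMr// ler_wpM2l//; lra.
lra.
Qed.

Lemma near_identity_unit (E : 'M[R]_n) (e : R) : n%:R * e <= 1 / 2 -> `|E - 1%:M| <= e ->
  E \in unitmx /\ forall x, `|x| <= 2 * `|x *m E|.
Proof.
move=> ne Ee.
have H x : `|x| <= 2 * `|x *m E|.
  have : `|x *m (E - 1%:M)| <= 1 / 2 * `|x|.
    rewrite (le_trans (mxnorm_mul _ _))// mulrAC ler_wpM2r// (le_trans _ ne)// ler_wpM2l//.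
  have : `|x| <= `|x *m E| + `|x *m (E - 1%:M)|.
    rewrite mulmxBr mulmx1 (le_trans _ (ler_normB _ _))// opprB addrC subrK//.
  lra.
split=> //; rewrite -row_free_unit; apply: inj_row_free => x xE.
by apply/eqP; rewrite -normr_le0 (le_trans (H x))// xE normr0 mulr0.
Qed.

(* Row vectors near the vertices of a simplex around 0 still span every vector
   with nonnegative coefficients, so a dense convex cone is everything. *)
Lemma dense_cone_full : (forall y, closure D y) -> forall x, D x.
Proof.
move=> dD x0.
have D_sum (y : 'rV[R]_n) (g : 'I_n -> 'rV[R]_n) : (forall i, 0 <= y 0 i) -> (forall i, D (g i)) ->
    D (\sum_i y 0 i *: g i).
  move=> y0 Dg; elim/big_ind : _ => // i _; exact: DZ.
pose e : R := (8 * (n%:R + 1))^-1.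
have n1 : 0 < n%:R + 1 :> R by rewrite ltr_wpDl.
have e0 : 0 < e by rewrite invr_gt0 mulr_gt0.
have ne : (n%:R + 1) * e = 1 / 8 by rewrite /e; field; rewrite gt_eqF.
have ne' : n%:R * e <= 1 / 8 by rewrite -ne mulrDl mul1r lerDl ltW.
have approx y : exists d, D d /\ `|d - y| <= e.
  have [d [Dd yd]] := dD y _ (nbhsx_ballx y e e0); exists d; split => //.
  by rewrite distrC ltW//; move: yd; rewrite -ball_normE.
have [g gP] := choice (fun i => approx (delta_mx 0 i)).
have [gs [Dgs gse]] := approx (- const_mx 1).
pose E := \matrix_i g i.
have EE : `|E - 1%:M| <= e.
  apply: mxnorm_le; first exact: ltW.
  move=> i j; apply: le_trans (gP i).2; apply: le_trans (mxnorm_entry _ 0 j).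
  by rewrite !mxE eqxx/= eq_sym.
have [|Eu Ei] := near_identity_unit _ EE; first lra.
(* The coordinates [w] of [- gs] in the basis [g] are all at least 1/2. Adding a suitable multiple
   of the relation [w *m E + gs = 0] therefore makes the coordinates of any vector nonnegative. *)
pose w := - gs *m invmx E; pose z := x0 *m invmx E.
have wE : w *m E = - gs by rewrite mulmxKV.
have zE : z *m E = x0 by rewrite mulmxKV.
clearbody w z.
have w1 : `|w - const_mx 1| <= 1 / 2.
  apply: (le_trans (Ei _)).
  have : `|(w - const_mx 1) *m E| <= (n%:R + 1) * e.
    have -> : (w - const_mx 1) *m E = - (gs - - const_mx 1) - const_mx 1 *m (E - 1%:M).
      rewrite mulmxBl wE mulmxBr mulmx1; set X := const_mx 1 *m E; by apply/matrixP => i j; rewrite !mxE; ring.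
    rewrite (le_trans (ler_normB _ _))// normrN addrC mulrDl mul1r lerD//.
    rewrite (le_trans (mxnorm_mul _ _))// ler_pM// ?mulr_ge0//.
    rewrite ler_piMr//; apply: mxnorm_le => // i j; by rewrite mxE normr1.
  rewrite ne; lra.
pose s := 2 * `|z|; pose y := z + s *: w.
have y0 i : 0 <= y 0 i.
  have h1 := mxnorm_entry z 0 i.
  have := mxnorm_entry (w - const_mx 1) 0 i => /le_trans /(_ w1).
  rewrite !mxE !ler_norml => /andP[h _].
  have hz : 0 <= `|z| by [].
  move: h1; rewrite ler_norml => /andP[h1 _].
  rewrite /s; nra.
have -> : x0 = \sum_i y 0 i *: g i + s *: gs.
  have -> : \sum_i y 0 i *: g i = y *m E.
    by rewrite mulmx_sum_row; apply: eq_bigr => i _; rewrite rowK.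
  by rewrite mulmxDl zE -scalemxAl wE scalerN subrK.
by apply: DD; [apply: D_sum => // i; exact: (gP i).1|apply: DZ => //; rewrite mulr_ge0].
Qed.

Lemma convex_cone_alternative :
  (exists q : 'cV[R]_n, q != 0 /\ forall d, D d -> (d *m q) 0 0 <= 0) \/ forall x, D x.
Proof.
have [/dense_cone_full|] := pselect (forall y, closure D y); first by right.
by move=> /existsNP[y /nonclosure_separation]; left.
Qed.

End convex_cones.

(** * The maximum principle *)

Section ae_interval.
Context {R : realType}.
Notation leb := (@lebesgue_measure R).

Lemma ae_exists_itv (P : R -> Prop) s t : {ae leb, forall z, P z} -> s < t ->
  exists z, [/\ s < z, z < t & P z].
Proof.
move=> [N [mN N0 PN]] st; apply: contrapT => noz.
have : (leb `]s, t[%classic <= leb N)%E.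
  apply: le_measure; rewrite ?inE// => z /=; rewrite in_itv/= => /andP[sz zt].
  by apply: PN => /= Pz; apply: noz; exists z.
by rewrite N0 lebesgue_measure_itv/= lte_fin st -EFinB lee_fin leNgt subr_gt0 st.
Qed.

Lemma ae_ge0_continuous (g : R -> R) a b : a < b -> continuous g ->
  {ae leb, forall t, t \in `[a, b] -> 0 <= g t} -> forall t, t \in `[a, b] -> 0 <= g t.
Proof.
move=> ab cg aeg t; rewrite in_itv/= => /andP[at_ tb]; rewrite leNgt; apply/negP => gt0.
have : \forall s \near t, g s < 0 by have /cvgr_lt := cg t; apply.
move=> /nbhs_ballP[e /= e0 He].
have [|z [z1 z2 Hz]] := @ae_exists_itv _ (Num.max a (t - e)) (Num.min b (t + e)) aeg.
  rewrite lt_min !gt_max ab /=; apply/and3P; split; lra.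
move: z1 z2; rewrite gt_max lt_min => /andP[az tz] /andP[zb zt].
have : g z < 0 by apply: He; rewrite /ball/= ltr_norml; apply/andP; split; lra.
by rewrite ltNge Hz// in_itv/= !ltW.
Qed.

Lemma ac_clamp_continuous (V : normedModType R) (x : R -> V) a b : a <= b ->
  abs_continuous a b x -> continuous (fun t => x (clamp a b t)).
Proof.
move=> ab acx t; apply/cvgrPdist_lt => e e0.
have [d d0 Hd] := acx _ e0.
have H p q : a <= p -> p <= q -> q <= b -> q - p < d -> `|x q - x p| < e.
  move=> ap pq qb pqd; have := Hd 1%N (fun=> p) (fun=> q); rewrite !big_ord1; apply => //.
  by move=> i j _ _ _; rewrite !ord1.
near=> s.
have sd : `|t - s| < d by near: s; apply: cvgr_dist_lt => //; exact: cvg_id.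
have [st|/ltW st] := leP s t.
  have h := @clamp_lip _ a b _ _ st.
  apply: H; [exact: clamp_ge|exact: clamp_homo|exact: clamp_le|].
  by rewrite (le_lt_trans h)//; move: sd; rewrite ger0_norm ?subr_ge0.
have h := @clamp_lip _ a b _ _ st.
rewrite distrC; apply: H; [exact: clamp_ge|exact: clamp_homo|exact: clamp_le|].
by rewrite (le_lt_trans h)//; move: sd; rewrite distrC ger0_norm ?subr_ge0.
Unshelve. all: by end_near. Qed.

End ae_interval.

Section more_primitives.
Context {R : realType}.
Notation leb := (@lebesgue_measure R).

Lemma primitive_onZ (p q : nat) a b c (g G : R -> 'M[R]_(p, q)) :
  primitive_on a b g G -> primitive_on a b (fun t => c *: g t) (fun t => c *: G t).
Proof.
move=> [[C lG] dG]; split.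
  by exists (`|c| * C) => s t as_ st tb; rewrite -scalerBr normrZ -mulrA ler_wpM2l ?lG.
by apply: (aeS _ dG) => t + tab => /(_ tab) ?; exact: is_deriveZ.
Qed.

Lemma primitive_on_rows (m n : nat) a b (g G : 'I_m -> R -> 'rV[R]_n) :
  (forall i, primitive_on a b (g i) (G i)) ->
  primitive_on a b (fun t => \matrix_i g i t) (fun t => \matrix_i G i t).
Proof.
move=> H; have [C HC] := choice (fun i => (H i).1); split.
  exists (\sum_i `|C i|) => s t as_ st tb.
  have ts0 : 0 <= t - s by rewrite subr_ge0.
  apply: mxnorm_le => [|i j]; first by rewrite mulr_ge0// sumr_ge0.
  rewrite (_ : _ i j = (G i t - G i s) 0 j); last by rewrite !mxE.
  rewrite (le_trans (mxnorm_entry _ _ _))// (le_trans (HC i _ _ as_ st tb))//.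
  rewrite ler_wpM2r// (le_trans (ler_norm _))// (bigD1 i)//= lerDl sumr_ge0//.
have : {ae leb, forall t, forall i, t \in `[a, b] -> is_derive t (1 : R) (G i) (g i t)}.
  by apply: ae_forall_countable => i; exact: (H i).2.
apply: aeS => t Ht tab; apply/is_derive_mxP => i j.
have /is_derive_mxP/(_ 0 j) := Ht i tab; rewrite !mxE.
by rewrite [X in is_derive _ _ X _](_ : _ = fun s => (\matrix_i0 G i0 s) i j)//; apply/funext => s; rewrite !mxE.
Qed.

Lemma primitive_on_trmx (p q : nat) a b (g G : R -> 'M[R]_(p, q)) :
  primitive_on a b g G -> primitive_on a b (fun t => (g t)^T) (fun t => (G t)^T).
Proof.
move=> [[C lG] dG]; split.
  exists C => s t as_ st tb; have h := lG s t as_ st tb.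
  apply: mxnorm_le => [|i j]; first exact: le_trans h.
  by apply: le_trans h; apply: le_trans (mxnorm_entry _ j i); rewrite !mxE.
apply: (aeS _ dG) => t + tab => /(_ tab) /is_derive_mxP H; apply/is_derive_mxP => i j.
have := H j i; rewrite !mxE.
by rewrite [X in is_derive _ _ X _](_ : _ = fun s => (G s)^T i j)//; apply/funext => s; rewrite !mxE.
Qed.

Lemma primitive_on_entry_nondecr a b (g G : R -> 'M[R]_1) s t :
  primitive_on a b g G -> {ae leb, forall t, t \in `[a, b] -> 0 <= g t 0 0} ->
  a <= s -> s <= t -> t <= b -> G s 0 0 <= G t 0 0.
Proof.
move=> GP g0 as_ st tb; have [[C lG] dG] := primitive_on_sub as_ tb GP.
apply: (@ac_nondecr _ (fun t => G t 0 0)) => //.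
  apply: (@lip_on_ac _ _ _ _ C) => s' t' ? ? ?.
  rewrite (_ : _ - _ = (G t' - G s') 0 0); last by rewrite !mxE.
  by rewrite (le_trans (mxnorm_entry _ _ _))// lG.
apply: (aeS2 _ g0 dG) => z H1 H2 zst; exists (g z 0 0).
  apply: H1; move: zst; rewrite !in_itv/= => /andP[sz zt].
  by rewrite (le_trans as_)// (le_trans zt).
by have /is_derive_mxP := H2 zst.
Qed.

(** A nondecreasing primitive that does not rise overall is constant, so its derivative vanishes
    wherever it exists inside the interval. *)
Lemma ge0_primitive_eq0 a b (g G : R -> 'M[R]_1) :
  primitive_on a b g G -> {ae leb, forall t, t \in `[a, b] -> 0 <= g t 0 0} ->
  G b 0 0 <= G a 0 0 -> {ae leb, forall t, t \in `[a, b] -> g t 0 0 = 0}.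
Proof.
move=> GP g0 Gba; have mono s t := primitive_on_entry_nondecr (s := s) (t := t) GP g0.
have Gcst t : t \in `[a, b] -> G t 0 0 = G a 0 0.
  rewrite in_itv/= => /andP[at_ tb]; apply/eqP.
  by rewrite eq_le (le_trans _ Gba) ?(mono a t) ?(mono t b)//.
apply: (aeS3 _ GP.2 (ae_neq a) (ae_neq b)) => t Gt ta tb tab.
have /is_derive_mxP/(_ 0 0) d1 := Gt tab.
move: tab; rewrite in_itv/= => /andP[at_ tb_].
have at' : a < t by rewrite lt_neqAle eq_sym ta.
have tb' : t < b by rewrite lt_neqAle tb.
have d2 : is_derive t (1 : R) (fun s => G s 0 0) 0.
  apply: (near_eq_is_derive _ (@is_derive_cst R R^o R^o (G a 0 0) t 1)).
  near=> s; rewrite Gcst// in_itv/=; apply/andP; split; apply: ltW.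
    by near: s; exact: lt_nbhsr.
  by near: s; exact: lt_nbhsl.
by rewrite -(@derive_val _ _ _ _ _ _ _ d1) (@derive_val _ _ _ _ _ _ _ d2).
Unshelve. all: by end_near. Qed.

End more_primitives.

(** * Cluster points, suprema over compact sets, dense sequences *)

Section limit_points.
Context {R : realType}.

Lemma closed_ball_compact (n : nat) (L : R) : compact [set x : 'rV[R]_n | `|x| <= L].
Proof.
apply: bounded_closed_compact.
  by exists L; split; [exact: num_real|move=> M LM x /= /le_trans; apply; exact: ltW].
have -> : [set x : 'rV[R]_n | `|x| <= L] = Num.norm @^-1` [set s | s <= L] by [].
by apply: preimage_closed; [move=> x _; exact: norm_continuous|exact: closed_le].
Qed.

(** [v] is a cluster point, as [e] decreases to 0, of the quotients [d e / e], which stay in a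
    compact ball. The estimate holds for arbitrarily small [e], not for all small [e]. *)
Lemma bounded_direction (n : nat) (d : R -> 'rV[R]_n) (L e1 : R) : 0 < e1 ->
  (forall e, 0 < e -> e < e1 -> `|d e| <= L * e) ->
  exists v, forall eta e0, 0 < eta -> 0 < e0 ->
    exists e, [/\ 0 < e, e < e0 & `|d e - e *: v| <= eta * e].
Proof.
move=> e10 dL; pose F := (fun e : R => e^-1 *: d e) @ 0^'+.
have FL : F [set x | `|x| <= L].
  change (\forall e \near 0^'+, `|e^-1 *: d e| <= L); near=> e.
  have e0 : 0 < e by near: e; exact: nbhs_right_gt.
  rewrite normrZ gtr0_norm ?invr_gt0// ler_pdivrMl// mulrC dL//; near: e; exact: nbhs_right_lt.
have PF : ProperFilter F by exact: fmap_proper_filter.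
have [v [_ Fv]] := closed_ball_compact PF FL.
exists v => eta e0 eta0 e00.
have Fe : F [set x | exists2 e, 0 < e < e0 & x = e^-1 *: d e].
  change (\forall e \near 0^'+, exists2 e', 0 < e' < e0 & e^-1 *: d e = e'^-1 *: d e'); near=> e; exists e => //; apply/andP; split.
    by near: e; exact: nbhs_right_gt.
  by near: e; exact: nbhs_right_lt.
have [_ [[e /andP[ee0 ee1] ->]]] := Fv _ _ Fe (nbhsx_ballx v eta eta0).
rewrite -ball_normE/= => h; exists e; split => //.
have -> : d e - e *: v = - (e *: (v - e^-1 *: d e)).
  by rewrite scalerBr scalerA divff ?gt_eqF// scale1r opprB.
by rewrite normrN normrZ (gtr0_norm ee0) mulrC; apply: ler_wpM2r; exact: ltW.
Unshelve. all: by end_near. Qed.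

(** The supremum runs over [K'], which may fail to be closed, while uniform continuity is taken over
    the compact [K]. This suits an arbitrary control set cut down to a compact set. *)
Lemma sup_compact_continuous (r : nat) (h : R * 'rV[R]_r -> R) (K K' : set 'rV[R]_r) :
  compact K -> continuous h -> K' `<=` K -> K' !=set0 ->
  exists m : R -> R, [/\ continuous m, forall t u, K' u -> h (t, u) <= m t &
    forall t c, (forall u, K' u -> h (t, u) <= c) -> m t <= c].
Proof.
move=> cK ch KK [u0 K0]; pose m t := sup [set h (t, u) | u in K'].
have ub t : has_sup [set h (t, u) | u in K'].
  split; first by exists (h (t, u0)); exists u0.
  have ct : continuous (fun u => h (t, u)).
    by move=> u; apply: (@continuous_comp _ _ _ (fun v : 'rV[R]_r => (t, v)) h u); [exact: continuous_pairl|exact: ch].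
  have [B HB] := compact_continuous_bounded cK ct.
  by exists B => _ [u /KK /HB hB <-]; exact: le_trans (ler_norm _) hB.
have m_ub t u : K' u -> h (t, u) <= m t.
  by move=> Ku; apply: ub_le_sup; [exact: (ub t).2|exists u].
have m_le t c : (forall u, K' u -> h (t, u) <= c) -> m t <= c.
  by move=> H; apply: ge_sup; [exact: (ub t).1|move=> _ [u Ku <-]; exact: H].
exists m; split => // t; apply/cvgrPdist_le => e e0.
have cK2 : compact ([set t] `*` K) by apply: compact_setX => //; exact: compact_set1.
have [d d0 Hd] := compact_uniform_continuity cK2 ch e0.
near=> s; have ts : `|t - s| < d by near: s; apply: cvgr_dist_lt => //; exact: cvg_id.
have H u : K' u -> `|h (t, u) - h (s, u)| <= e.
  move=> /KK Ku; apply/ltW/Hd; first by split.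
  by split => //; exact: ballxx.
have h1 : m s <= m t + e.
  apply: m_le => u Ku; have := H u Ku; have := m_ub t u Ku.
  by rewrite ler_norml => ? /andP[]; lra.
have h2 : m t <= m s + e.
  apply: m_le => u Ku; have := H u Ku; have := m_ub s u Ku.
  by rewrite ler_norml => ? /andP[]; lra.
by rewrite ler_norml; apply/andP; split; lra.
Unshelve. all: by end_near. Qed.

(** From each rational ball that meets [U] a point of [U] is chosen; the other balls receive the
    default [u0]. *)
Lemma countable_dense_subset (r : nat) (U : set 'rV[R]_r) : U !=set0 ->
  exists q : 'rV[rat]_r * nat -> 'rV[R]_r, (forall i, U (q i)) /\
    forall u W, U u -> open W -> W u -> exists i, W (q i).
Proof.
move=> [u0 Uu0].
pose B (i : 'rV[rat]_r * nat) : set 'rV[R]_r := ball (map_mx ratr i.1 : 'rV[R]_r) i.2.+1%:R^-1.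
have [q qP] := choice (fun i : 'rV[rat]_r * nat => (ltac:(
  have [[u [Uu Bu]]|nBU] := pselect (exists u, U u /\ B i u);
    [by exists u|by exists u0; split => // -[u uP]; case: nBU; exists u]) :
  exists u, U u /\ ((exists u', U u' /\ B i u') -> B i u))).
exists q; split=> [i|u W Uu oW Wu]; first exact: (qP i).1.
move: (Wu); rewrite [X in X u](open_bigcup_rat_ball oW) => -[i iW iu].
by exists i; apply: iW; apply: (qP i).2; exists u.
Qed.

End limit_points.

Lemma smooth_field_le (R : realType) (n : nat) a b (xi : R -> 'rV[R]_n) F A C C' : C <= C' ->
  smooth_field a b xi F A C -> smooth_field a b xi F A C'.
Proof.
move=> CC [mF mA bF lF]; split => //; apply: (aeS _ bF) => t H tab.
by have [h1 h2] := H tab; split; [exact: le_trans h1 CC|exact: le_trans h2 CC].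
Qed.

(** * First-order variations of the optimal process *)

Section maximum_principle.
Context {R : realType} (n r : nat).
Notation leb := (@lebesgue_measure R).
Variables (f : R -> 'rV[R]_n -> 'rV[R]_r -> 'rV[R]_n) (U : set 'rV[R]_r).
Variables (x1 : 'rV[R]_n) (a b : R) (xhat : R -> 'rV[R]_n) (muhat : R -> probability (borelV R r) R).
Hypotheses (Hf : continuous_with_f_x f) (Hadm : admissible_pair f U x1 a b xhat muhat).
Notation GC := (@generalized_controls_in R n r U).
(** [xhat] is constrained only on [[a, b]]; its clamped copy is continuous on the whole line and
    agrees with it there. *)
Let xi t := xhat (clamp a b t).
Let F (nu : R -> probability (borelV R r) R) t y := pairing (nu t) (f t y).
Let A (nu : R -> probability (borelV R r) R) t := pairing (nu t) (f_x f t (xi t)).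

Lemma a_lt_b : a < b. Proof. by case: Hadm. Qed.
Lemma gc_muhat : GC muhat. Proof. by case: Hadm. Qed.

Lemma xiE t : t \in `[a, b] -> xi t = xhat t.
Proof. by rewrite in_itv/= => /andP[at_ tb]; rewrite /xi clamp_id. Qed.

Lemma xi_continuous : continuous xi.
Proof. by have [ab _ acx _ _] := Hadm; exact: ac_clamp_continuous (ltW ab) acx. Qed.

Lemma gc_smooth nu : GC nu -> exists2 C, 0 <= C & smooth_field a b xi (F nu) (A nu) C.
Proof. by move=> gnu; have := gc_smooth_field Hf a b xi_continuous gnu. Qed.

(** The supports lie in one compact set, so the velocity is bounded almost everywhere and the
    absolutely continuous [xhat] is even Lipschitz. *)
Lemma state_primitive : primitive_on a b (fun t => F muhat t (xi t)) xhat.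
Proof.
have [_ _ acx _ dx] := Hadm; have [C C0 [_ _ bF _]] := gc_smooth gc_muhat.
have dx' : {ae leb, forall t, t \in `[a, b] -> is_derive t (1 : R) xhat (F muhat t (xi t))}.
  by apply: (aeS _ dx) => t H tab; rewrite xiE//; exact: H.
split=> //; exists C; apply: ac_bounded_derive acx _.
by apply: (aeS2 _ bF dx') => t H1 H2 tab; exists (F muhat t (xi t)); [exact: H2|case: (H1 tab)].
Qed.

(** [linear_ode] has its coefficient on the right, so [Psi] is obtained as the transpose of a
    solution of [X' = - X A^T]. The product [Phi Psi] has derivative [Phi A Psi - Phi A Psi = 0] and
    stays the identity. *)
Lemma fundamental_matrices : exists (Phi Psi : R -> 'M[R]_n) B,
  [/\ 0 <= B, continuous Phi, continuous Psi, Psi a = 1%:M &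
   [/\ primitive_on a b (fun t => Phi t *m A muhat t) Phi,
   primitive_on a b (fun t => - (A muhat t *m Psi t)) Psi,
   forall t, t \in `[a, b] -> Phi t *m Psi t = 1%:M,
   forall t, t \in `[a, b] -> `|Phi t| <= B & forall t, t \in `[a, b] -> `|Psi t| <= B]].
Proof.
have ab := ltW a_lt_b; have [C C0 [_ mA bA _]] := gc_smooth gc_muhat.
have {}bA : {ae leb, forall t, t \in `[a, b] -> `|A muhat t| <= C}.
  by apply: (aeS _ bA) => t H tab; case: (H tab).
have [Phi [Phia [C1 lPhi] dPhi]] := @linear_ode R n n (A muhat) a b C 1%:M ab C0 mA bA.
have [||X [Xa [C2 lX] dX]] := @linear_ode R n n (fun t => - (A muhat t)^T) a b C 1%:M ab C0.
- by move=> i j; have := lmeasN (mA j i); apply: lmeas_ae; apply: aeW => t; rewrite !mxE.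
- apply: (aeS _ bA) => t H tab; rewrite normrN; apply: mxnorm_le => // i j.
  by rewrite mxE (le_trans (mxnorm_entry _ _ _))// H.
have dPsi : primitive_on a b (fun t => - (A muhat t *m (X t)^T)) (fun t => (X t)^T).
  apply: primitive_on_ae (primitive_on_trmx dX); apply: aeW => t _.
  by rewrite mulmxN linearN /= trmx_mul trmxK.
have lPsi : lipschitz_with C2 (fun t => (X t)^T).
  move=> s t st; have h := lX s t st; apply: mxnorm_le => [|i j]; first exact: le_trans h.
  by apply: le_trans h; apply: le_trans (mxnorm_entry _ j i); rewrite !mxE.
have bnd (Y : R -> 'M[R]_n) c : lipschitz_with c Y ->
    exists2 B, 0 <= B & forall t, t \in `[a, b] -> `|Y t| <= B.
  move=> lY; have [B B0 HB] := @lip_on_bounded _ _ a b c Y (fun s t _ st _ => lY s t st).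
  by exists B => // t; rewrite in_itv/= => /andP[]; exact: HB.
have [B1 B10 HB1] := bnd _ _ lPhi; have [B2 B20 HB2] := bnd _ _ lPsi.
exists Phi, (fun t => (X t)^T), (B1 + B2); split.
- exact: addr_ge0.
- exact: lipschitz_with_continuous lPhi.
- exact: lipschitz_with_continuous lPsi.
- by rewrite Xa trmx1.
split=> //.
- move=> t; rewrite in_itv/= => /andP[at_ tb].
  apply: (@primitive_on_eq _ _ _ a b (fun=> 0) (fun t => Phi t *m (X t)^T) (fun=> 1%:M) _
    (primitive_on_cst a b 1%:M) _ t at_ tb); last first.
    by rewrite Phia Xa trmx1 mulmx1.
  apply: primitive_on_ae (primitive_on_mulmx dPhi dPsi); apply: aeW => s _.
  by rewrite mulmxN mulmxA subrr.
- by move=> t tab; rewrite (le_trans (HB1 t tab))// lerDl.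
- by move=> t tab; rewrite (le_trans (HB2 t tab))// lerDr.
Qed.

Section variations.
Variables (Phi Psi : R -> 'M[R]_n) (B : R).
Hypotheses (B0 : 0 <= B) (cPhi : continuous Phi) (cPsi : continuous Psi) (Psia : Psi a = 1%:M).
Hypotheses (dPhi : primitive_on a b (fun t => Phi t *m A muhat t) Phi).
Hypotheses (dPsi : primitive_on a b (fun t => - (A muhat t *m Psi t)) Psi).
Hypotheses (PhiPsi : forall t, t \in `[a, b] -> Phi t *m Psi t = 1%:M).
Hypotheses (PhiB : forall t, t \in `[a, b] -> `|Phi t| <= B).
Hypotheses (PsiB : forall t, t \in `[a, b] -> `|Psi t| <= B).

Definition kfield nu t := (F nu t (xi t) - F muhat t (xi t)) *m Psi t.

Definition variation nu (G : R -> 'rV[R]_n) := G a = 0 /\ primitive_on a b (kfield nu) G.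

Lemma kfield_lmeas nu : GC nu -> forall i j, lmeas (fun t => kfield nu t i j).
Proof.
move=> gnu; have [_ _ [m1 _ _ _]] := gc_smooth gnu; have [_ _ [m2 _ _ _]] := gc_smooth gc_muhat.
apply: lmeas_mulmx; last exact: lmeas_entry_continuous.
move=> i j; have := lmeasB (m1 _ xi_continuous i j) (m2 _ xi_continuous i j).
by apply: lmeas_ae; apply: aeW => t; rewrite !mxE.
Qed.

Lemma kfield_bounded nu : GC nu -> exists2 C, 0 <= C &
  {ae leb, forall t, t \in `[a, b] -> `|kfield nu t| <= C}.
Proof.
move=> gnu; have [C1 C10 [_ _ b1 _]] := gc_smooth gnu.
have [C2 C20 [_ _ b2 _]] := gc_smooth gc_muhat.
exists (n%:R * (C1 + C2) * B); first by rewrite !mulr_ge0// addr_ge0.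
apply: (aeS2 _ b1 b2) => t H1 H2 tab; have [h1 _] := H1 tab; have [h2 _] := H2 tab.
rewrite (le_trans (mxnorm_mul _ _))// ler_pM// ?mulr_ge0 ?PsiB// ler_wpM2l//.
by rewrite (le_trans (ler_normB _ _))// lerD.
Qed.

Lemma variation_exists nu : GC nu -> exists G, variation nu G.
Proof.
move=> gnu; have [C C0 bk] := kfield_bounded gnu.
have [G [Ga _ _ HG]] := clamped_primitive (ltW a_lt_b) C0 (kfield_lmeas gnu) bk.
by exists G.
Qed.

Lemma variation_muhat : variation muhat (fun=> 0).
Proof.
split=> //; apply: primitive_on_ae (primitive_on_cst a b 0); apply: aeW => t _.
by rewrite /kfield subrr mul0mx.
Qed.

Definition endpoint_cone (v : 'rV[R]_n) : set 'rV[R]_n := [set x | exists la s nu G,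
  [/\ 0 <= la, 0 <= s, GC nu, variation nu G & x = la *: G b - s *: v]].

Lemma endpoint_cone0 v : endpoint_cone v 0.
Proof.
exists 0, 0, muhat, (fun=> 0); split => //; [exact: gc_muhat|exact: variation_muhat|].
by rewrite !scale0r subrr.
Qed.

Lemma endpoint_coneZ v c x : 0 <= c -> endpoint_cone v x -> endpoint_cone v (c *: x).
Proof.
move=> c0 [la [s [nu [G [la0 s0 gnu vG ->]]]]]; exists (c * la), (c * s), nu, G.
by split; rewrite ?mulr_ge0// scalerBr !scalerA.
Qed.

Lemma variation_mix nu nu' G G' th : GC nu -> GC nu' -> variation nu G -> variation nu' G' ->
  0 <= th <= 1 -> exists2 la, GC la & variation la (fun t => th *: G t + (1 - th) *: G' t).
Proof.
move=> gnu gnu' [Ga GP] [G'a GP'] th1.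
have [la gla laE] := gc_mix gnu gnu' (lmeas_cst th) (fun=> th1).
exists la => //; split; first by rewrite Ga G'a !scaler0 addr0.
apply: primitive_on_ae (primitive_onD (primitive_onZ th GP) (primitive_onZ (1 - th) GP')).
apply: (aeS _ laE) => t H tab; rewrite /kfield /F H; last exact: (f_continuous_u Hf).
rewrite !scalemxAl -mulmxDl; congr (_ *m _).
by apply/matrixP => i j; rewrite !mxE; ring.
Qed.

(** Mixing the two controls in proportion to [la] and [la'] turns the sum of the variations into
    [la + la'] times a single one. The proportion is undefined when both vanish; then only the
    multiples of [v] add. *)
Lemma endpoint_coneD v x y : endpoint_cone v x -> endpoint_cone v y -> endpoint_cone v (x + y).
Proof.
move=> [la [s [nu [G [la0 s0 gnu vG ->]]]]] [la' [s' [nu' [G' [la'0 s'0 gnu' vG' ->]]]]].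
have : 0 <= la + la' by rewrite addr_ge0.
rewrite le_eqVlt => /predU1P[/esym/eqP|lala].
  rewrite paddr_eq0// => /andP[/eqP -> /eqP ->].
  exists 0, (s + s'), nu, G; split; rewrite ?addr_ge0//.
  by rewrite !scale0r !sub0r -opprD scalerDl.
have [|la1 gla1 vla1] := @variation_mix nu nu' G G' (la / (la + la')) gnu gnu' vG vG'.
  rewrite divr_ge0 ?(ltW lala)//= ler_pdivrMr// mul1r lerDl//.
exists (la + la'), (s + s'), la1, (fun t => la / (la + la') *: G t + (1 - la / (la + la')) *: G' t).
split; rewrite ?addr_ge0// ?(ltW lala)//.
apply/matrixP => i j; rewrite !mxE; field.
by rewrite gt_eqF.
Qed.

(** The transported displacement that must be produced at time [b - e] in order to reach the target
    at that time. *)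
Let dev e := (xhat b - xhat (b - e)) *m Psi (b - e).

Definition end_direction (v : 'rV[R]_n) := forall eta e0, 0 < eta -> 0 < e0 ->
  exists e, [/\ 0 < e, e < e0 & `|dev e - e *: v| <= eta * e].

Lemma end_direction_exists : exists v, end_direction v.
Proof.
have [[C lx] _] := state_primitive; have ab := a_lt_b.
apply: (@bounded_direction _ _ dev (n%:R * C * B) (b - a)); first by rewrite subr_gt0.
move=> e e0 eb; have ae : a <= b - e by lra.
have eb' : b - e <= b by lra.
have h := lx (b - e) b ae eb' (lexx b).
rewrite subKr in h.
have C0 : 0 <= C by have := le_trans (normr_ge0 _) h; rewrite pmulr_lge0.
rewrite (le_trans (mxnorm_mul _ _))//.
have -> : n%:R * C * B * e = n%:R * (C * e) * B by ring.
rewrite ler_pM ?mulr_ge0 ?ler_wpM2l//; apply: PsiB.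
by rewrite in_itv/= ae.
Qed.

(** The unit vectors, and also [v] minus the variations used for them, are put in the form of cone
    elements. Adding up, [(1 + s') v] is the plain sum of the vectors [Lam i *: G i b], whence [mu].
    Substituting this for [v] in the expressions of the unit vectors gives [P]. *)
Lemma full_cone_basis v : (forall x, endpoint_cone v x) ->
  exists (Lam : 'I_n.+1 -> R) (nu : 'I_n.+1 -> R -> probability (borelV R r) R)
    (G : 'I_n.+1 -> R -> 'rV[R]_n) (mu : R) (P : 'M[R]_(n, n.+1)),
  [/\ forall i, 0 <= Lam i, forall i, GC (nu i), forall i, variation (nu i) (G i), 0 < mu &
      v = (const_mx mu : 'rV_n.+1) *m (\matrix_i (Lam i *: G i b)) /\
      P *m (\matrix_i (Lam i *: G i b)) = 1%:M].
Proof.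
move=> full.
have H x : exists p : R * R * (R -> probability (borelV R r) R) * (R -> 'rV[R]_n),
    [/\ 0 <= p.1.1.1, 0 <= p.1.1.2, GC p.1.2, variation p.1.2 p.2 &
        x = p.1.1.1 *: p.2 b - p.1.1.2 *: v].
  by have [la [s [nu [G HG]]]] := full x; exists (la, s, nu, G).
have [p pP] := choice (fun j : 'I_n => H (delta_mx 0 j)).
have [p0 p0P] := H (v - \sum_j (p j).1.1.1 *: (p j).2 b).
pose pp (i : 'I_n.+1) := oapp p p0 (unlift ord0 i).
have pp0 : pp ord0 = p0 by rewrite /pp unlift_none.
have ppl j : pp (lift ord0 j) = p j by rewrite /pp liftK.
have ppP i : [/\ 0 <= (pp i).1.1.1, GC (pp i).1.2 & variation (pp i).1.2 (pp i).2].
  rewrite /pp; case: (unlift ord0 i) => [j|] /=; first by have [] := pP j.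
  by have [] := p0P.
pose s' := p0.1.1.2; have s'0 : 0 <= s' by case: p0P.
have s'1 : 0 < 1 + s' by rewrite ltr_pwDl.
pose mu := (1 + s')^-1.
set Yb := \matrix_i ((pp i).1.1.1 *: (pp i).2 b).
have vE : v = (const_mx mu : 'rV_n.+1) *m Yb.
  rewrite mulmx_sum_row big_ord_recl rowK pp0 mxE.
  under eq_bigr => j _ do rewrite rowK ppl mxE.
  rewrite -scaler_sumr -scalerDr.
  have [_ _ _ _ /eqP] := p0P; rewrite eq_sym subr_eq => /eqP ->.
  rewrite addrAC subrK -/s' -{2}[v]scale1r -scalerDl scalerA mulVf ?scale1r//.
  by rewrite gt_eqF.
exists (fun i => (pp i).1.1.1), (fun i => (pp i).1.2), (fun i => (pp i).2), mu,
  (\matrix_(j < n) (delta_mx 0 (lift ord0 j) - (p j).1.1.2 *: (const_mx mu : 'rV[R]_n.+1))).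
split=> [i|i|i||]; [by case: (ppP i)..|by rewrite invr_gt0|split=> //].
apply/row_matrixP => j; rewrite row_mul rowK row1 mulmxBl -scalemxAl -/Yb -vE -rowE rowK ppl.
by have [_ _ _ _ <-] := pP j.
Qed.

Lemma full_cone_hit v : end_direction v -> (forall x, endpoint_cone v x) ->
  exists e nu y, [/\ 0 < e, admissible_pair f U x1 a (b - e) y nu & y (b - e) = xhat b].
Proof.
move=> dv full; have ab := a_lt_b; have gm := gc_muhat.
have [Lam [nu [G [mu [P [Lam0 gnu vG mu0 [vE PY]]]]]]] := full_cone_basis full.
pose k t := \matrix_i (Lam i *: kfield (nu i) t).
pose Y t := \matrix_i (Lam i *: G i t).
have dY : primitive_on a b k Y.
  by apply: primitive_on_rows => i; apply: primitive_onZ; case: (vG i).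
have Ya : Y a = 0.
  by apply/row_matrixP => i; rewrite rowK row0; case: (vG i) => -> _; rewrite scaler0.
have [CY CY0 HCY] : exists2 CY, 0 <= CY & forall t, a <= t -> t <= b -> `|Y t| <= CY.
  by have [C lY] := dY.1; exact: lip_on_bounded lY.
have mk i j : lmeas (fun t => k t i j).
  have := lmeasM (lmeas_cst (Lam i)) (kfield_lmeas (gnu i) 0 j).
  by apply: lmeas_ae; apply: aeW => t; rewrite !mxE.
have [ck ckP] := choice (fun i => (let: ex_intro2 c x y := kfield_bounded (gnu i) in
  ex_intro (fun c => _ /\ _) c (conj x y))).
have Ck0 : 0 <= \sum_i Lam i * ck i by apply: sumr_ge0 => i _; rewrite mulr_ge0// (ckP i).1.
have kC : {ae leb, forall t, t \in `[a, b] -> `|k t| <= \sum_i Lam i * ck i}.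
  have : {ae leb, forall t, forall i, t \in `[a, b] -> `|kfield (nu i) t| <= ck i}.
    by apply: ae_forall_countable => i; exact: (ckP i).2.
  apply: aeS => t H tab; apply: mxnorm_le => // i j.
  have -> : k t i j = Lam i * kfield (nu i) t 0 j by rewrite !mxE.
  rewrite normrM (ger0_norm (Lam0 i)) (bigD1 i)//= -[leLHS]addr0 lerD//.
    by rewrite ler_wpM2l// (le_trans (mxnorm_entry _ _ _))// H.
  by apply: sumr_ge0 => l _; rewrite mulr_ge0// (ckP l).1.
have [c0 c00 HF0] := gc_smooth gm.
have [ci ciP] := choice (fun i => (let: ex_intro2 c x y := gc_smooth (gnu i) in
  ex_intro (fun c => _ /\ _) c (conj x y))).
pose C := c0 + \sum_i ci i.
have ci0 : 0 <= \sum_i ci i by apply: sumr_ge0 => i _; exact: (ciP i).1.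
have C0 : 0 <= C by exact: addr_ge0.
have {}HF0 : smooth_field a b xi (F muhat) (A muhat) C.
  by apply: smooth_field_le HF0; rewrite lerDl.
have HF i : smooth_field a b xi (F (nu i)) (A (nu i)) C.
  apply: smooth_field_le (ciP i).2; rewrite /C (bigD1 i)//= addrCA lerDl addr_ge0// sumr_ge0// => l _.
  exact: (ciP l).1.
(* The solver works with the scaled variations [Lam i *: G i], so the weight of the control [nu i]
   is [al 0 i * Lam i]. *)
pose DL := diag_mx (\row_i Lam i).
pose Rm := remainder xi (F muhat) (A muhat) (fun i => F (nu i)) Phi Psi.
pose rem t w al := Rm t w (al *m DL).
have rem0 t al : rem t 0 al = 0 by exact: remainder0.
have mrem (w : R -> 'rV[R]_n) al : continuous w -> forall i j, lmeas (fun t => rem t (w t) al i j).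
  by move=> cw; exact: (remainder_lmeas xi_continuous HF0 HF cPhi cPsi (al *m DL) cw).
have rem_small sigma : 0 < sigma -> exists2 d, 0 < d & {ae leb, forall t, t \in `[a, b] ->
    forall (w w' : 'rV[R]_n) (al al' : 'rV[R]_n.+1),
     `|w| < d -> `|w'| < d -> `|al| < d -> `|al'| < d ->
     `|rem t w al - rem t w' al'| <= sigma * (`|w - w'| + `|al - al'|)}.
  move=> sg0; pose L : R := 1 + n.+1%:R * `|DL|.
  have DL0 : 0 <= n.+1%:R * `|DL| by rewrite mulr_ge0.
  have L1 : 1 <= L by rewrite lerDl.
  have L0 : 0 < L by exact: lt_le_trans ltr01 L1.
  have alL (al : 'rV[R]_n.+1) : `|al *m DL| <= L * `|al|.
    rewrite (le_trans (mxnorm_mul _ _))// mulrAC ler_wpM2r// lerDr//.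
  have sL : 0 < sigma / L by rewrite divr_gt0.
  have [d d0 Hd] := remainder_small C0 B0 HF0 HF PhiB PsiB sL.
  exists (d / L); first by rewrite divr_gt0.
  apply: (aeS _ Hd) => t H tab w w' al al' wd w'd ald _.
  have dL : d / L <= d by rewrite ler_pdivrMr// ler_peMr// ltW.
  apply: (le_trans (H tab _ _ _ _ (lt_le_trans wd dL) (lt_le_trans w'd dL) _)).
    by apply: le_lt_trans (alL al) _; rewrite mulrC -ltr_pdivlMr.
  rewrite -mulmxBl -mulrA ler_pM2l// ler_pdivrMl// mulrDr lerD//.
  by rewrite ler_peMl.
have sLam : 0 < 1 + \sum_i Lam i by rewrite ltr_pwDl// sumr_ge0.
(* With every [al 0 i] below this bound, the actual weights sum to at most 1. *)
have r00 : 0 < (1 + \sum_i Lam i)^-1 by rewrite invr_gt0.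
have [eta0 [eps0 [eta00 eps00 hit]]] :=
  perturbed_hit ab Ck0 CY0 mu0 mk kC dY Ya HCY PY rem0 mrem r00 rem_small.
have [|e [e0]] := dv eta0 (Num.min eps0 (b - a)) eta00.
  by rewrite lt_min eps00 subr_gt0.
rewrite lt_min => /andP[ee eb] dev_e.
have [|w [al [alr _ dw wa wb]]] := hit e (dev e) e0 ee; first by rewrite -vE.
pose th i := al 0 i * Lam i.
have th0 i : 0 <= th i by rewrite mulr_ge0//; case/andP: (alr i).
have th1 : \sum_i th i <= 1.
  rewrite (le_trans (ler_sum _ (G := fun i => (1 + \sum_i Lam i)^-1 * Lam i) _))//.
    by move=> i _; rewrite ler_wpM2r//; case/andP: (alr i).
  by rewrite -mulr_sumr mulrC ler_pdivrMr// mul1r lerDr.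
have [la gla laE] := gc_finite_mix gm gnu th0 th1.
(* Undoing the transport: multiplication by [Phi] cancels [Psi] and turns the equation for [w] into
   that of the mixed control. *)
pose x t := xhat t + w t *m Phi t.
have dx : primitive_on a b (fun t => F la t (x t)) x.
  apply: primitive_on_ae (primitive_onD state_primitive (primitive_on_mulmx dw dPhi)).
  apply: (aeS _ laE) => t laEt tab.
  pose df i (y : 'rV[R]_n) := F (nu i) t y - F muhat t y.
  have -> : F la t (x t) = F muhat t (x t) + \sum_i th i *: df i (x t).
    by apply: laEt; exact: (f_continuous_u Hf).
  pose Z := \sum_i th i *: df i (xi t) + (F muhat t (x t) - F muhat t (xi t) - w t *m Phi t *m A muhat t +
     \sum_i th i *: (df i (x t) - df i (xi t))).
  have -> : al *m k t + rem t (w t) al = Z *m Psi t.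
    rewrite [RHS]mulmxDl /rem /Rm /remainder xiE// -/(x t); congr (_ + _).
      rewrite mulmx_sum_row mulmx_suml; apply: eq_bigr => i _.
      by rewrite rowK scalerA /kfield xiE// -scalemxAl.
    congr ((_ + _) *m _); apply: eq_bigr => i _.
    by rewrite /DL mul_mx_diag !mxE.
  rewrite -mulmxA (mulmx1C (PhiPsi tab)) mulmx1 /Z -mulmxA.
  rewrite (_ : \sum_i th i *: (df i (x t) - df i (xi t)) =
     \sum_i th i *: df i (x t) - \sum_i th i *: df i (xi t)); last first.
    by rewrite -sumrB; apply: eq_bigr => i _; rewrite scalerBr.
  by apply/matrixP => i j; rewrite !mxE; ring.
exists e, la, x; split => //.
- have be : b - e <= b by rewrite gerBl ltW.
  have [[C1 lx] dx'] := primitive_on_sub (lexx a) be dx.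
  split => //; first by rewrite ltrBrDr -ltrBrDl.
    exact: lip_on_ac lx.
  by rewrite /x wa mul0mx addr0; case: Hadm.
(* At [b - e] the factor [Psi] of [dev e] is cancelled by [Phi], which leaves the missing
   displacement [xhat b - xhat (b - e)]. *)
- rewrite /x wb /dev -mulmxA (mulmx1C (PhiPsi _)) ?mulmx1 ?subrKC//.
  by rewrite in_itv/= gerBl (ltW e0) andbT lerBrDr -lerBrDl ltW.
Qed.

(** * The costate given by a separating vector *)

Section separated.
Variables (v : 'rV[R]_n) (q : 'cV[R]_n).
Hypotheses (dv : end_direction v) (q0 : q != 0).
Hypothesis sep : forall x, endpoint_cone v x -> (x *m q) 0 0 <= 0.

Definition costate t := Psi t *m q.

Definition hamiltonian_along (tu : R * 'rV[R]_r) : R :=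
  (f tu.1 (xi tu.1) tu.2 *m costate tu.1) 0 0.

Lemma sep_variation nu G : GC nu -> variation nu G -> (G b *m q) 0 0 <= 0.
Proof.
move=> gnu vG; apply: sep; exists 1, 0, nu, G; split => //.
by rewrite scale1r scale0r subr0.
Qed.

Lemma sep_direction : 0 <= (v *m q) 0 0.
Proof.
have : (- v *m q) 0 0 <= 0.
  apply: sep; exists 0, 1, muhat, (fun=> 0); split => //; [exact: gc_muhat|exact: variation_muhat|].
  by rewrite scale0r scale1r sub0r.
by rewrite mulNmx mxE oppr_le0.
Qed.

Lemma costate_continuous : continuous costate.
Proof. by apply: mx_continuousM => //; exact: cst_continuous. Qed.

Lemma hamiltonian_along_continuous : continuous hamiltonian_along.
Proof.
apply: continuous_entry; apply: mx_continuousM.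
  exact: (f_continuous_along Hf xi_continuous).
by move=> tu; apply: (@continuous_comp _ _ _ fst costate); [exact: cvg_fst|exact: costate_continuous].
Qed.

Definition state_power t := (F muhat t (xi t) *m costate t) 0 0.

(** The integral of the positive part of the gain is the pairing of [q] with the endpoint of a
    variation, hence at most 0; a nonnegative function with such an integral vanishes almost
    everywhere. *)
Lemma hamiltonian_le_point u : U u -> {ae leb, forall t, t \in `[a, b] ->
  hamiltonian_along (t, u) <= state_power t}.
Proof.
move=> Uu; have gd := gc_dirac n Uu; set nud := (fun=> _) in gd.
pose kap t := (kfield nud t *m q) 0 0.
have kapE t : kap t = hamiltonian_along (t, u) - state_power t.
  rewrite /kap /kfield /F /nud pairing_dirac; last exact: (f_continuous_u Hf).
  have e (X Y : 'M[R]_1) : (X - Y) 0 0 = X 0 0 - Y 0 0 by rewrite !mxE.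
  by rewrite -mulmxA mulmxBl e.
have mkap : lmeas kap.
  apply: lmeas_mulmx; first exact: kfield_lmeas.
  by move=> i j; exact: lmeas_cst.
pose E : set (lebesgueR R) := setT `&` kap @^-1` `]0, +oo[.
have mE : measurable E by apply: mkap; [exact: measurableT|exact: measurable_itv].
(* Switch to [u] exactly where this increases the Hamiltonian. *)
pose chi (t : R) : R := \1_E t.
have mchi : lmeas chi by exact: (@measurable_indic _ (lebesgueR R) R setT E mE).
have chi01 t : 0 <= chi t <= 1 by rewrite /chi indicE; case: (t \in E); rewrite ?lexx ?ler01.
have chik t : 0 <= chi t * kap t.
  rewrite /chi indicE; have [|_] := boolP (t \in E); last by rewrite mul0r.
  by rewrite inE /E/= in_itv/= andbT => -[_ /ltW]; rewrite mul1r.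
have [la gla laE] := gc_mix gd gc_muhat mchi chi01.
have [G vG] := variation_exists gla; have [Ga dG] := vG.
have kE : {ae leb, forall t, t \in `[a, b] -> kfield la t *m q = (chi t * kap t)%:M}.
  apply: (aeS _ laE) => t H tab; rewrite [RHS]mx11_scalar; apply/matrixP => i j.
  have -> : kfield la t = chi t *: kfield nud t.
    rewrite /kfield {1}/F H; last exact: (f_continuous_u Hf).
    rewrite -/(F nud t (xi t)) -/(F muhat t (xi t)) scalemxAl; congr (_ *m _).
    by apply/matrixP => i' j'; rewrite !mxE; ring.
  by rewrite -scalemxAl !ord1 !mxE /kap !mxE mulr1n.
have dGq : primitive_on a b (fun t => (chi t * kap t)%:M) (fun t => G t *m q).
  apply: primitive_on_ae (primitive_on_mulmx dG (primitive_on_cst a b q)).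
  by apply: (aeS _ kE) => t H tab; rewrite mulmx0 addr0 H.
have := ge0_primitive_eq0 dGq _ _.
move=> /(_ _ _) H0; have {}H0 : {ae leb, forall t, t \in `[a, b] -> ((chi t * kap t)%:M : 'M[R]_1) 0 0 = 0}.
  apply: H0; first by apply: aeW => t _; rewrite mxE mulr1n.
  have z : (0 : 'M[R]_1) 0 0 = 0 by rewrite mxE.
  by rewrite Ga mul0mx z (sep_variation gla vG).
apply: (aeS _ H0) => t H tab; have := H tab; rewrite mxE mulr1n -subr_le0 -kapE.
have [//|kpos] := leP (kap t) 0.
rewrite /chi indicE mem_set ?mul1r => [k0|]; first by rewrite k0 ltxx in kpos.
by split => //=; rewrite in_itv/= kpos.
Qed.

(** The exceptional null set of the pointwise inequality depends on [u]; a countable dense subset of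
    [U] and continuity in the control give one null set for all controls. *)
Lemma hamiltonian_le : {ae leb, forall t, t \in `[a, b] -> forall u, U u ->
  hamiltonian_along (t, u) <= state_power t}.
Proof.
have [U0|nU0] := pselect (U !=set0); last first.
  by apply: aeW => t _ u Uu; exfalso; apply: nU0; exists u.
have [d [dU dd]] := countable_dense_subset U0.
have := ae_forall_countable (fun i => hamiltonian_le_point (dU i)).
apply: aeS => t H tab u Uu; rewrite leNgt; apply/negP => hu.
have ch : continuous (fun u => hamiltonian_along (t, u)).
  move=> w; apply: (@continuous_comp _ _ _ (fun w : 'rV[R]_r => (t, w)) hamiltonian_along).
    exact: continuous_pairl.
  exact: hamiltonian_along_continuous.
have oW : open [set w | state_power t < hamiltonian_along (t, w)].
  rewrite (_ : [set w | _] = (fun w => hamiltonian_along (t, w)) @^-1` [set s | state_power t < s])//.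
  by apply: open_comp; [move=> w _; exact: ch|exact: open_gt].
have [i /=] := dd u _ Uu oW hu.
by rewrite ltNge H.
Qed.

(** [U] may be unbounded and not closed, so continuity is first obtained for the supremum [m] over
    the part of [U] in a compact [K] carrying the supports. The power is an average over that part,
    so it equals [m] almost everywhere; the bound by [m] for the remaining controls of [U] extends
    from almost every time to every time by continuity. *)
Lemma max_hamiltonian_continuous : exists m : R -> R, [/\ continuous m,
  forall t, t \in `[a, b] -> max_Hamiltonian f U t (xhat t) (costate t) = (m t)%:E &
  {ae leb, forall t, t \in `[a, b] -> state_power t = m t}].
Proof.
have ab := a_lt_b; have [K cK aeK] := gc_support gc_muhat.
have [u0 [Ku0 Uu0]] : (K `&` U) !=set0.
  have [z [_ _ zK]] := ae_exists_itv aeK ab.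
  by have [u /zK uK] := msupport_neq0 (muhat z); exists u.
have K0 : (K `&` U) !=set0 by exists u0.
have [m [cm mub mle]] := sup_compact_continuous cK hamiltonian_along_continuous (@subIsetl _ K U) K0.
have cs := gc_compactly_supported gc_muhat.
have aem : {ae leb, forall t, t \in `[a, b] -> state_power t = m t}.
  apply: (aeS3 _ hamiltonian_le aeK cs) => t H tK ct tab; apply/eqP; rewrite eq_le; apply/andP; split.
    rewrite /state_power /F -pairing_mulr//; last exact: (f_continuous_u Hf).
    apply: pairing_le => //.
      by apply: mx_continuousM; [exact: (f_continuous_u Hf)|exact: cst_continuous].
    by move=> u /tK uK; exact: (mub t u uK).
  by apply: mle => u [_ Uu]; exact: H.
have mU t u : t \in `[a, b] -> U u -> hamiltonian_along (t, u) <= m t.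
  move=> tab Uu; rewrite -subr_ge0.
  apply: (@ae_ge0_continuous _ (fun t => m t - hamiltonian_along (t, u)) _ _ ab) => //.
    move=> s; have h : {for s, continuous (fun s => hamiltonian_along (s, u))}.
      apply: (@continuous_comp _ _ _ (fun s : R => (s, u)) hamiltonian_along).
        exact: continuous_pairr.
      exact: hamiltonian_along_continuous.
    exact: (continuousB (cm s) h).
  by apply: (aeS2 _ hamiltonian_le aem) => s H1 H2 sab; rewrite subr_ge0 -H2// H1.
exists m; split => // t tab.
have HE u : Hamiltonian f t (xhat t) (costate t) u = hamiltonian_along (t, u).
  by rewrite /Hamiltonian /dual_pairing /hamiltonian_along /= xiE.
apply/eqP; rewrite eq_le; apply/andP; split.
  by apply: ge_ereal_sup => _ [u Uu <-]; rewrite HE lee_fin mU.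
have ubM u : U u -> ((hamiltonian_along (t, u))%:E <= max_Hamiltonian f U t (xhat t) (costate t))%E.
  by move=> Uu; apply: ereal_sup_ubound; exists u => //; rewrite HE.
case: (max_Hamiltonian f U t (xhat t) (costate t)) ubM => [c| |] ubM.
- by rewrite lee_fin; apply: mle => u [_ Uu]; rewrite -lee_fin ubM.
- by rewrite leey.
- by have := ubM _ Uu0; rewrite leeNy_eq.
Qed.

Lemma costate_primitive : primitive_on a b (fun t => - (A muhat t *m costate t)) costate.
Proof.
apply: primitive_on_ae (primitive_on_mulmx dPsi (primitive_on_cst a b q)).
by apply: aeW => t _; rewrite mulmx0 addr0 mulNmx mulmxA.
Qed.

(** If [m b < 0], the pairing of the state with the costate frozen at [b - e] would fall at rate at
    least [th / 2] up to time [b], so [dev e] paired with [q] would be at most [- (th / 2) * e]. But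
    [dev e] is close to [e *: v], whose pairing with [q] is nonnegative. *)
Lemma max_hamiltonian_end_ge0 (m : R -> R) : continuous m ->
  {ae leb, forall t, t \in `[a, b] -> state_power t = m t} -> 0 <= m b.
Proof.
move=> cm aem; have ab := a_lt_b; rewrite leNgt; apply/negP => mb0.
(* Near [b] the maximum stays below [- th]. Freezing the costate costs [th / 2] and the distance of
   [dev e] from [e *: v] costs [th / 4], both per unit of [e], which still leaves a
   contradiction. *)
pose th := - m b / 2; have th0 : 0 < th by rewrite divr_gt0// oppr_gt0.
have [dl dl0 Hdl] : exists2 d, 0 < d & forall t, `|b - t| < d -> m t < - th.
  have : \forall t \near b, m t < - th by have /cvgr_lt := cm b; apply; rewrite /th; lra.
  by move=> /nbhs_ballP[d /= d0 Hd]; exists d => // t bt; apply: Hd; rewrite -ball_normE.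
have [[Cp lp] _] := costate_primitive.
have [L L0 [_ _ bF _]] := gc_smooth gc_muhat.
pose M := n%:R * L * `|Cp|; have M0 : 0 <= M by rewrite !mulr_ge0.
have ba0 : 0 < b - a by rewrite subr_gt0.
have [e1 e10 He1] := @exists_small R [:: (M, th / 2); (1, dl / 2); (1, (b - a) / 2)]
  (ltac:(by move=> ce; rewrite !inE => /or3P[] /eqP ->; rewrite /= divr_gt0)).
pose eta := th / (4 * (n%:R * `|q| + 1)).
have nq0 : 0 <= n%:R * `|q| by rewrite mulr_ge0.
have nq1 : 0 < 4 * (n%:R * `|q| + 1) by rewrite mulr_gt0// ltr_wpDl.
have eta0 : 0 < eta by rewrite divr_gt0.
have [e [e0 ee1 de]] := dv eta0 e10.
have {}He1 := He1 _ (ltW e0) ee1.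
have g1 : M * e <= th / 2 by apply: (He1 (_, _)); rewrite !inE eqxx ?orbT.
have g2 : 1 * e <= dl / 2 by apply: (He1 (_, _)); rewrite !inE eqxx ?orbT.
have g3 : 1 * e <= (b - a) / 2 by apply: (He1 (_, _)); rewrite !inE eqxx ?orbT.
rewrite mul1r in g2 g3.
pose tau := b - e; have atau : a <= tau by rewrite /tau; lra.
have taub : tau <= b by rewrite /tau; lra.
have slope : {ae leb, forall t, t \in `[tau, b] ->
    0 <= ((- (th / 2))%:M - F muhat t (xi t) *m costate tau : 'M[R]_1) 0 0}.
  apply: (aeS2 _ aem bF) => t Hm HF; rewrite in_itv/= => /andP[taut tb].
  have tab : t \in `[a, b] by rewrite in_itv/= (le_trans atau taut) tb.
  have [Fb _] := HF tab.
  have mt : m t < - th by apply: Hdl; rewrite ger0_norm ?subr_ge0//; move: taut; rewrite /tau; lra.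
  have pw := Hm tab.
  have dp : `|(F muhat t (xi t) *m (costate t - costate tau)) 0 0| <= th / 2.
    rewrite (le_trans (mxnorm_entry _ _ _))// (le_trans (mxnorm_mul _ _))//.
    apply: le_trans g1; rewrite /M -!mulrA ler_wpM2l// ler_pM//.
    apply: (le_trans (lp _ _ atau taut tb)).
    have ttau : 0 <= t - tau by rewrite subr_ge0.
    apply: (le_trans (ler_wpM2r ttau (ler_norm Cp))).
    by rewrite ler_wpM2l//; rewrite /tau; lra.
  have eq1 : (F muhat t (xi t) *m (costate t - costate tau)) 0 0 =
      state_power t - (F muhat t (xi t) *m costate tau) 0 0.
    have e' (X Y : 'M[R]_1) : (X - Y) 0 0 = X 0 0 - Y 0 0 by rewrite !mxE.
    by rewrite mulmxBr e'.
  have e' (X : 'M[R]_1) c : (c%:M - X) 0 0 = c - X 0 0 by rewrite !mxE mulr1n.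
  rewrite e'; move: dp; rewrite eq1 pw ler_norml => /andP[]; lra.
have lin : primitive_on tau b (fun=> (- (th / 2))%:M : 'M[R]_1) (fun t => (- (th / 2) * t)%:M).
  have th2 : 0 <= th / 2 by rewrite ltW// divr_gt0.
  split.
    exists (th / 2) => s t _ st _; apply: mxnorm_le => [|i j].
      by rewrite mulr_ge0 ?subr_ge0.
    rewrite !mxE !ord1 !mulr1n -mulrBr normrM normrN (ger0_norm th2).
    by rewrite ger0_norm// subr_ge0.
  apply: aeW => t _; apply/is_derive_mxP => i j; rewrite !ord1 mxE mulr1n.
  rewrite [X in is_derive _ _ X _](_ : _ = (- (th / 2)) \*: id); last first.
    by apply/funext => s; rewrite !mxE mulr1n.
  by have := @is_deriveZ _ _ _ id (- (th / 2)) t 1 1 (is_derive_id _ _); rewrite /GRing.scale/= mulr1.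
have dx := primitive_on_mulmx (primitive_on_sub atau (lexx b) state_primitive)
  (primitive_on_cst tau b (costate tau)).
have dg := primitive_onD lin (primitive_onN dx).
have := @primitive_on_entry_nondecr _ tau b _ _ tau b dg _ (lexx _) taub (lexx _).
have e2 (X Y : 'M[R]_1) : (X - Y) 0 0 = X 0 0 - Y 0 0 by rewrite !mxE.
have e3 c : (c%:M : 'M[R]_1) 0 0 = c by rewrite mxE mulr1n.
rewrite !e2 !e3 => mono.
have {}mono : (dev e *m q) 0 0 <= - (th / 2) * e.
  have {}mono := mono (ltac:(by apply: (aeS _ slope) => t H tab; rewrite mulmx0 addr0; exact: H)).
  rewrite /dev -mulmxA -/(costate tau) mulmxBl e2.
  have -> : - (th / 2) * e = - (th / 2) * b - - (th / 2) * tau by rewrite /tau; ring.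
  lra.
have : `|((dev e - e *: v) *m q) 0 0| <= n%:R * `|q| * (eta * e).
  rewrite (le_trans (mxnorm_entry _ _ _))// (le_trans (mxnorm_mul _ _))// mulrAC ler_wpM2l//.
rewrite mulmxBl e2 -scalemxAl.
have -> : (e *: (v *m q)) 0 0 = e * (v *m q) 0 0 by rewrite mxE.
have vq := sep_direction.
have evq : 0 <= e * (v *m q) 0 0 by rewrite mulr_ge0// ltW.
have etaq : n%:R * `|q| * (eta * e) <= th / 4 * e.
  rewrite mulrA ler_wpM2r ?(ltW e0)// /eta.
  rewrite [leLHS](_ : _ = th / 4 * (n%:R * `|q| / (n%:R * `|q| + 1))); last first.
    by field; rewrite gt_eqF// ltr_wpDl.
  apply: ler_piMr; first by rewrite divr_ge0// ltW.
  by rewrite ler_pdivrMr ?ltr_wpDl// mul1r lerDl.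
have the : 0 < th * e by rewrite mulr_gt0.
rewrite ler_norml => /andP[]; lra.
Qed.

Lemma separated_Lambda : Lambda f U a b xhat muhat costate.
Proof.
have [m [cm mE aem]] := max_hamiltonian_continuous; have ab := a_lt_b.
have [[C lp] dp] := costate_primitive.
split; first exact: lip_on_ac lp.
split.
  (* Since [Psi a = 1%:M], the costate starts at the nonzero vector [q]. *)
  by exists a; [rewrite in_itv/= lexx ltW|rewrite /costate Psia mul1mx].
split.
- by apply: (aeS _ dp) => t H tab; rewrite -xiE//; exact: H.
- apply: (aeS2 _ aem state_primitive.2) => t H dx tab.
  by rewrite mE// -H// (@derive_val _ _ _ _ _ _ _ (dx tab)).
- apply: (@subspace_eq_continuous _ _ _ (fun t => (m t)%:E)).
    by move=> t; rewrite inE => tab; exact: (esym (mE t tab)).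
  apply: continuous_subspaceT => t; apply: cvg_EFin; first exact: nearW.
  exact: cm.
- have bab : b \in `[a, b] by rewrite in_itv/= lexx ltW.
  by rewrite mE// lee_fin (max_hamiltonian_end_ge0 cm).
Qed.

End separated.

End variations.

End maximum_principle.

Theorem corollary3p5 (R : realType) (n r : nat)
    (f : R -> 'rV[R]_n -> 'rV[R]_r -> 'rV[R]_n) (U : set 'rV[R]_r)
    (x1 : 'rV[R]_n) (t1 that2 : R) (xhat : R -> 'rV[R]_n)
    (muhat : R -> probability (borelV R r) R) :
  continuous_with_f_x f ->
  U !=set0 ->
  optimal_pair f U x1 t1 that2 xhat muhat ->
  Lambda f U t1 that2 xhat muhat = set0 ->
  (infimum_time f U x1 (xhat that2) t1 < that2%:E)%E /\
  exists (t2 : nat -> R) (x : nat -> R -> 'rV[R]_n),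
    minimizing_sequence f U x1 (xhat that2) t1 t2 x /\
    converges_uniformly t1 t2 x that2 xhat.
Proof.
move=> Hf _ [adm opt] L0; exfalso.
have [Phi [Psi [B [B0 cPhi cPsi Psia [dPhi dPsi PhiPsi PhiB PsiB]]]]] := fundamental_matrices Hf adm.
have [v dv] := end_direction_exists Hf adm PsiB.
have [|||[q [q0 sep]]|full] :=
  @convex_cone_alternative R n (endpoint_cone f U t1 that2 xhat muhat Psi v).
- exact: endpoint_cone0 adm _ _.
- by move=> x y; exact: (endpoint_coneD Hf).
- by move=> c x; exact: endpoint_coneZ.
- have : Lambda f U t1 that2 xhat muhat (costate Psi q).
    exact: (separated_Lambda Hf adm B0 cPsi Psia dPsi PsiB dv q0 sep).
  by rewrite L0.
- have [e [nu [y [e0 admy yb]]]] := full_cone_hit Hf adm B0 cPhi cPsi dPhi PhiPsi PhiB PsiB dv full.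
  have := opt _ _ _ admy yb.
  by rewrite lerBrDr gerDl leNgt e0.
Qed.
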